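(* Let $d=0$. For any $\gamma\ge0$ and any pinned fluxon $\phi_{\rm pin}$ (with half-length $L$ and parameter $h$), the linear operator $\mathcal L_{\rm pin}(x;L,\gamma,0)$ has an eigenvalue zero if and only if \begin{itemize} \item $\frac{dL}{dh}=0$ (derivative along the $L$-$h$ curve of pinned fluxons, at the given pinned fluxon); \item or $\gamma=\frac1\pi$ (in this case the eigenvalue zero is the largest eigenvalue); \item or $\gamma=\gamma_1\approx0.18$, the solution of $\cos\phi_{\max}(\gamma_1)+1=2\pi\gamma_1$, and $\phi_{\rm pin}$ is such that $\phi_{\rm in}=\pi$ and $\phi_{\rm out}=4\pi-\arccos(2\pi\gamma_1-1)=2\pi+\phi_{\max}(\gamma_1)$ (in this case the eigenvalue zero is not the largest eigenvalue). \end{itemize}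
   Context: For $L>0$ (the half-length of the inhomogeneity) let $D(x)=0$ for $|x|<L$ and $D(x)=1$ for $|x|>L$ (this is the case $d=0$), and let $0\le\gamma\le1$. A pinned fluxon is a function $\phi_{\rm pin}\in C^1(\mathbb R)$, twice differentiable for $|x|\ne L$, with $\phi_{xx}-D(x)\sin\phi+\gamma=0$ for $|x|\ne L$, $\lim_{x\to-\infty}\phi(x)=\arcsin\gamma$, $\lim_{x\to\infty}\phi(x)=\arcsin\gamma+2\pi$. The operator is $\mathcal L_{\rm pin}(x;L,\gamma,0)=\partial_{xx}-\cos\phi_{\rm pin}(x)$ for $|x|>L$ and $\partial_{xx}$ for $|x|<L$, with domain $H^2(\mathbb R)$; $\Lambda$ is an eigenvalue if $\mathcal L_{\rm pin}v=\Lambda v$ for some nonzero $v\in H^2(\mathbb R)$. Notation for a pinned fluxon: $(\phi_{\rm in},p_{\rm in})=(\phi_{\rm pin}(-L),\phi_{\rm pin}'(-L))$, $(\phi_{\rm out},p_{\rm out})=(\phi_{\rm pin}(L),\phi_{\rm pin}'(L))$. With $H_0(\gamma)=\gamma\arcsin\gamma-(1-\sqrt{1-\gamma^2})+2\pi\gamma$, the parameter $h$ of the pinned fluxon is the constant such that $\frac12\phi_x^2+\gamma\phi=H_0(\gamma)+h$ on $|x|<L$. For $0<\gamma<1$, $\phi_{\max}(\gamma)$ is the maximal $\phi$-value on the orbit homoclinic to $(\arcsin\gamma,0)$ of $\phi_{xx}=\sin\phi-\gamma$. $L$-$h$ curves: for fixed $\gamma$ the pinned fluxons form families (curves), along which $L$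 is locally a function of $h$. For $\gamma=0$: $L=\frac{\pi-\arccos(1-h)}{\sqrt{2h}}$, $0<h<2$. For $0<\gamma\le\frac1\pi$, with $h_{\max}=2(1-\pi\gamma)$, $h_2=1-\sqrt{1-\gamma^2}$, $h_1=1-\cos\phi_{\max}(\gamma)$: $L=\frac{p_{\rm in}-p_{\rm out}}{2\gamma}$, $\phi_{\rm in}=\pi\pm\arccos(2\pi\gamma-(1-h))$, $p_{\rm in}=\sqrt{2(H_0(\gamma)+h-\gamma\phi_{\rm in})}$, $|p_{\rm out}|=\sqrt{2(H_0(\gamma)+h-\gamma\phi_{\rm out})}$, and $(\phi_{\rm out},p_{\rm out})$ is on one of five branches: (1) $\phi_{\rm out}=2\pi-\arccos(1-h)$, $p_{\rm out}>0$, $0\le h\le h_{\max}$; (2) $\phi_{\rm out}=2\pi+\arccos(1-h)$, with $p_{\rm out}\ge0$ for $0\le h\le h_2$ and $p_{\rm out}<0$ for $h_2<h\le h_{\max}$; (3) $\phi_{\rm out}=2\pi+\arccos(1-h)$, $p_{\rm out}\ge0$, $h_2<h\le h_{\max}$; (4) $\phi_{\rm out}=4\pi-\arccos(1-h)$, $p_{\rm out}\ge0$, $h_1\le h\le h_{\max}$; (5) $\phi_{\rm out}=4\pi-\arccos(1-h)$, $p_{\rm out}<0$, $h_1<h\le h_{\max}$ (branches being present only when their $h$-range is nonempty). $\frac{dL}{dh}$ denotes the derivative of $L$ with respect to $h$ along such a branch (for a fixed sign choice in $\phi_{\rm in}$) where it exists; points where it does not exist (e.g. isolated pinned fluxons or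 vertical tangents) do not count as $\frac{dL}{dh}=0$. *)

(* Defs.v *)
From HB Require Import structures.
From mathcomp Require Import all_boot all_order all_algebra.
From mathcomp Require Import all_classical all_reals all_analysis.

Set Implicit Arguments.
Unset Strict Implicit.
Unset Printing Implicit Defensive.

Import Order.TTheory GRing.Theory Num.Theory.
Import numFieldNormedType.Exports.

Local Open Scope classical_set_scope.
Local Open Scope ring_scope.

(* [g] is the bias current gamma and [L] the half-length of the inhomogeneity.
   The value of [D] at |x| = L is never used: these two points are excluded
   from the differential equation and form a null set for the operator. *)
Definition D (R : realType) (L x : R) : R := if `|x| < L then 0 else 1.

(* There is no pinned fluxon for g > 1, where [asin g] is a default value: the
   equation has no equilibrium outside the inhomogeneity. *)
Definition pinned_fluxon (R : realType) (g L : R) (phi : R -> R) : Prop :=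
  [/\ (forall x, derivable phi x 1) /\ continuous (derive1 phi),
      forall x, `|x| != L ->
        derivable (derive1 phi) x 1 /\
        derive1 (derive1 phi) x - D L x * sin (phi x) + g = 0,
      phi x @[x --> -oo] --> asin g
    & phi x @[x --> +oo] --> asin g + 2 * pi].

Definition H_0 (R : realType) (g : R) : R :=
  g * asin g - (1 - Num.sqrt (1 - g ^+ 2)) + 2 * pi * g.

Definition fluxon_parameter (R : realType) (g L : R) (phi : R -> R) (h : R) :
  Prop :=
  forall x, `|x| < L -> derive1 phi x ^+ 2 / 2 + g * phi x = H_0 g + h.

Definition L2 (R : realType) (v : R -> R) : Prop :=
  v \in Lfun (@lebesgue_measure R) 2%:E.

(* On the line it suffices to test against compactly supported C^1 functions. *)
Definition test_function (R : realType) (f : R -> R) : Prop :=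
  [/\ forall x, derivable f x 1, continuous (derive1 f)
    & exists M : R, forall x, M < `|x| -> f x = 0].

Definition weak_derivative (R : realType) (v w : R -> R) : Prop :=
  forall f : R -> R, test_function f ->
    \int[@lebesgue_measure R]_x (v x * derive1 f x) =
    - \int[@lebesgue_measure R]_x (w x * f x).

(* [v] belongs to H^2(R) and has second weak derivative [v2]. *)
Definition H2 (R : realType) (v v2 : R -> R) : Prop :=
  L2 v /\ exists v1 : R -> R,
    [/\ L2 v1, weak_derivative v v1, L2 v2 & weak_derivative v1 v2].

(* Elements of H^2(R) are classes modulo almost everywhere equality. *)
Definition is_eigenvalue (R : realType) (L : R) (phi : R -> R) (lam : R) :
  Prop :=
  exists v v2 : R -> R,
    [/\ H2 v v2,
        ~ {ae @lebesgue_measure R, forall x, v x = 0}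
      & {ae @lebesgue_measure R, forall x,
          v2 x - D L x * cos (phi x) * v x = lam * v x}].

Definition is_largest_eigenvalue (R : realType) (L : R) (phi : R -> R) (lam : R) :
  Prop :=
  is_eigenvalue L phi lam /\ forall mu, is_eigenvalue L phi mu -> mu <= lam.

(* For 0 < g < 1 these functions are the translates of a single one, so that the
   supremum in [phi_max] is the maximum on the unique homoclinic orbit. *)
Definition homoclinic (R : realType) (g : R) (u : R -> R) : Prop :=
  [/\ forall x, [/\ derivable u x 1, derivable (derive1 u) x 1
                  & derive1 (derive1 u) x = sin (u x) - g],
      u x @[x --> -oo] --> asin g /\ derive1 u x @[x --> -oo] --> (0 : R),
      u x @[x --> +oo] --> asin g /\ derive1 u x @[x --> +oo] --> (0 : R)
    & exists x, u x != asin g].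

Definition phi_max (R : realType) (g : R) : R :=
  sup [set y | exists u : R -> R, homoclinic g u /\ exists x, u x = y].

(* Derivative at [a] of [f] restricted to [A]; one-sided when [A] is an interval
   with endpoint [a], and non-existent when [a] is isolated in [A]. *)
Definition is_derive_in (R : realType) (A : set R) (f : R -> R) (a l : R) :
  Prop :=
  [/\ A a, limit_point A a
    & (f y - f a) / (y - a) @[y --> within A a^'] --> l].

Definition L_gamma0 (R : realType) (h : R) : R :=
  (pi - acos (1 - h)) / Num.sqrt (2 * h).

Definition h_max (R : realType) (g : R) : R := 2 * (1 - pi * g).
Definition h_2 (R : realType) (g : R) : R := 1 - Num.sqrt (1 - g ^+ 2).
Definition h_1 (R : realType) (g : R) : R := 1 - cos (phi_max g).

Inductive branch : Type := Br1 | Br2 | Br3 | Br4 | Br5.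

Definition branch_range (R : realType) (g : R) (b : branch) : set R :=
  match b with
  | Br1 | Br2 => [set h | 0 <= h <= h_max g]
  | Br3 => [set h | h_2 g < h <= h_max g]
  | Br4 => [set h | h_1 g <= h <= h_max g]
  | Br5 => [set h | h_1 g < h <= h_max g]
  end.

(* The boolean [s] is the choice of sign in phi_in. *)
Definition branch_phi_in (R : realType) (g : R) (s : bool) (h : R) : R :=
  if s then pi + acos (2 * pi * g - (1 - h))
  else pi - acos (2 * pi * g - (1 - h)).

Definition branch_p_in (R : realType) (g : R) (s : bool) (h : R) : R :=
  Num.sqrt (2 * (H_0 g + h - g * branch_phi_in g s h)).

Definition branch_phi_out (R : realType) (b : branch) (h : R) : R :=
  match b with
  | Br1 => 2 * pi - acos (1 - h)
  | Br2 | Br3 => 2 * pi + acos (1 - h)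
  | Br4 | Br5 => 4 * pi - acos (1 - h)
  end.

Definition branch_sign_out (R : realType) (g : R) (b : branch) (h : R) : R :=
  match b with
  | Br1 | Br3 | Br4 => 1
  | Br2 => if h <= h_2 g then 1 else -1
  | Br5 => -1
  end.

Definition branch_p_out (R : realType) (g : R) (b : branch) (h : R) : R :=
  branch_sign_out g b h *
  Num.sqrt (2 * (H_0 g + h - g * branch_phi_out b h)).

Definition branch_L (R : realType) (g : R) (s : bool) (b : branch) (h : R) : R :=
  (branch_p_in g s h - branch_p_out g b h) / (2 * g).

Definition on_branch (R : realType) (g L : R) (phi : R -> R) (h : R)
    (s : bool) (b : branch) : Prop :=
  [/\ branch_range g b h,
      L = branch_L g s b h,
      phi (- L) = branch_phi_in g s h /\ derive1 phi (- L) = branch_p_in g s h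
    & phi L = branch_phi_out b h /\ derive1 phi L = branch_p_out g b h].

(* dL/dh exists at the pinned fluxon [phi], with parameter [h], along an L-h
   curve through it, and is equal to [l]. *)
Definition dL_dh (R : realType) (g L : R) (phi : R -> R) (h l : R) : Prop :=
  [/\ g = 0, 0 < h < 2, L = L_gamma0 h
    & is_derive_in [set k | 0 < k < 2] (@L_gamma0 R) h l] \/
  (0 < g <= pi^-1 /\
   exists s b, on_branch g L phi h s b /\
               is_derive_in (branch_range g b) (branch_L g s b) h l).

Definition gamma_1_equation (R : realType) (g : R) : Prop :=
  0 < g < 1 /\ cos (phi_max g) + 1 = 2 * pi * g.

Definition exceptional_fluxon (R : realType) (g1 g L : R) (phi : R -> R) :
  Prop :=
  [/\ g = g1, phi (- L) = pi & phi L = 4 * pi - acos (2 * pi * g1 - 1)].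

(* Main.v *)
(* Differentiating the fluxon equation, phi' solves the linearized equation on each
   piece, and up to a multiple it is the only decaying solution outside (if phi is
   constant there, an exponential takes its place).  Inside, a solution with
   eigenvalue zero is affine, so that zero is an eigenvalue iff a determinant in the
   data of phi at -L and L vanishes.  Implicit differentiation of the relations
   between phi_in, p_in, phi_out, p_out and h gives dL/dh, which is this determinant up
   to a non-zero factor, except where L is not differentiable: there the determinant is
   non-zero, unless phi_in = pi and phi_out is the turning point of the homoclinic
   orbit.  At gamma = 1/pi the zero mode phi' is positive, so that Picone's identity
   excludes positive eigenvalues; in the exceptional case phi' changes sign, and a
   shooting argument provides a positive eigenvalue. *)

(* Decay means only that a solution and its derivative are square integrable. This is what H^2
   provides, and it suffices: an integrable sum of squares takes arbitrarily small values on a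
   half-line, and Wronskians, Picone quotients and products u u' are estimated at such a point
   instead of in a limit. Conversely an upper bound on u u' gives decay, because (u u')' dominates
   u^2 and u'^2 where the coefficient is positive. Both saddles lie on known energy levels, and the
   momentum is continuous at the two edges; hence cos phi_in = 1 - 2 pi gamma - h and cos phi_out =
   1 - h, from which all branch formulas follow. To show that dL/dh fails to exist, 2 gamma L = p_in
   - p_out is used with a pointwise Lipschitz property. For 0 < gamma < 1/pi, away from the
   exceptional fluxon, only one of the two momenta fails to be Lipschitz at h = 0, at h = h_max and
   at the turning point, so that nothing can cancel. Both irregularities meet only when h = h_max =
   h_1, which characterizes gamma_1; the range of branch 4 is then a single point. *)
Require Import Defs.
From HB Require Import structures.
From mathcomp Require Import all_boot all_order all_algebra.
From mathcomp Require Import all_classical all_reals all_analysis.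
From mathcomp Require Import measurable_realfun.
From mathcomp Require Import ring lra.
Import Order.TTheory GRing.Theory Num.Theory.
Import numFieldNormedType.Exports.
Set Implicit Arguments.
Unset Strict Implicit.
Unset Printing Implicit Defensive.
Local Open Scope classical_set_scope.
Local Open Scope ring_scope.

(** * Calculus *)

Section Calculus.
Context {R : realType}.
Implicit Types (f g : R -> R) (x a b : R).

Lemma is_deriveDx f g x df dg : is_derive x 1 f df -> is_derive x 1 g dg ->
  is_derive x 1 (fun y => f y + g y) (df + dg).
Proof. exact: is_deriveD. Qed.

Lemma is_deriveNx f x df : is_derive x 1 f df ->
  is_derive x 1 (fun y => - f y) (- df).
Proof. exact: is_deriveN. Qed.

Lemma is_deriveBx f g x df dg : is_derive x 1 f df -> is_derive x 1 g dg ->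
  is_derive x 1 (fun y => f y - g y) (df - dg).
Proof. exact: is_deriveB. Qed.

Lemma is_deriveMx f g x df dg : is_derive x 1 f df -> is_derive x 1 g dg ->
  is_derive x 1 (fun y => f y * g y) (df * g x + f x * dg).
Proof.
move=> hf hg; have h := is_deriveM hf hg; apply: (is_derive_eq h).
by rewrite /GRing.scale /=; ring.
Qed.

Lemma is_deriveXx f x n df : is_derive x 1 f df ->
  is_derive x 1 (fun y => f y ^+ n.+1) (n.+1%:R * f x ^+ n * df).
Proof.
move=> hf; have h := @is_deriveX R R f n.+1 x 1 df hf.
rewrite -[X in is_derive _ _ X _]exprfctE; apply: (is_derive_eq h).
by rewrite /GRing.scale.
Qed.

Lemma is_derive_sqrx f x df : is_derive x 1 f df ->
  is_derive x 1 (fun y => f y ^+ 2) (2 * f x * df).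
Proof. by move=> /(is_deriveXx 1); rewrite expr1. Qed.

Lemma is_derive_compx f g x dg df : is_derive x 1 g dg ->
  is_derive (g x) 1 f df -> is_derive x 1 (fun y => f (g y)) (df * dg).
Proof.
move=> hg hf; exact: (@is_derive1_comp _ f g x df dg).
Qed.

Lemma is_derive_sinx f x df : is_derive x 1 f df ->
  is_derive x 1 (fun y => sin (f y)) (cos (f x) * df).
Proof. by move=> h; apply: is_derive_compx. Qed.

Lemma is_derive_cosx f x df : is_derive x 1 f df ->
  is_derive x 1 (fun y => cos (f y)) (- sin (f x) * df).
Proof. by move=> h; apply: is_derive_compx. Qed.

Lemma is_derive_expx f x df : is_derive x 1 f df ->
  is_derive x 1 (fun y => expR (f y)) (expR (f x) * df).
Proof. by move=> h; apply: is_derive_compx. Qed.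

Lemma is_deriveVx f x df : f x != 0 -> is_derive x 1 f df ->
  is_derive x 1 (fun y => (f y)^-1) (- df / f x ^+ 2).
Proof.
move=> f0 h; have h' := @is_deriveV R f x df 1 f0 h; apply: (is_derive_eq h').
by rewrite /GRing.scale /= mulrC mulrN mulNr.
Qed.

Lemma is_derive_sqrtx f x df : 0 < f x -> is_derive x 1 f df ->
  is_derive x 1 (fun y => Num.sqrt (f y)) (df / (2 * Num.sqrt (f x))).
Proof.
move=> f0 h.
by apply: (is_derive_eq (is_derive_compx h (is_derive1_sqrt f0))); rewrite mulrC.
Qed.

Lemma is_derive_cstx c x : is_derive x 1 (fun=> c : R) (0 : R).
Proof. exact: is_derive_cst. Qed.

Lemma is_derive_idx x : is_derive x 1 (fun y : R => y) (1 : R).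
Proof. exact: is_derive_id. Qed.

Lemma is_derive_eqx f x (d d' : R) : is_derive x 1 f d -> d = d' -> is_derive x 1 f d'.
Proof. by move=> h <-. Qed.

Lemma is_derive_cont f x df : is_derive x 1 f df -> {for x, continuous f}.
Proof.
move=> [h _]; apply: differentiable_continuous.
by apply/derivable1_diffP.
Qed.

Lemma is_derive_uniq f x d1 d2 :
  is_derive x 1 f d1 -> is_derive x 1 f d2 -> d1 = d2.
Proof. by move=> [_ <-] [_ <-]. Qed.

Lemma is_derive_derive1 f x : derivable f x 1 -> is_derive x 1 f (derive1 f x).
Proof. by move=> h; rewrite derive1E; apply: derivableP. Qed.

Lemma derive1_is f x d : is_derive x 1 f d -> derive1 f x = d.
Proof. by move=> [_ <-]; rewrite derive1E. Qed.

Lemma mean_value f df a b : a < b ->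
  (forall x, a <= x <= b -> {for x, continuous f}) ->
  (forall x, a < x < b -> is_derive x 1 f (df x)) ->
  exists c, a < c < b /\ f b - f a = df c * (b - a).
Proof.
move=> ab cf dfx.
have d' x : x \in `]a, b[ -> is_derive x 1 f (df x) by rewrite in_itv; exact: dfx.
have [|c] := @MVT R f df a b ab d'.
  apply: continuous_in_subspaceT => x; rewrite inE /= in_itv /= => hx.
  exact: cf.
by rewrite in_itv /= => hc e; exists c.
Qed.

Lemma derive_ge0_le f df a b : a <= b ->
  (forall x, a <= x <= b -> {for x, continuous f}) ->
  (forall x, a < x < b -> is_derive x 1 f (df x)) ->
  (forall x, a < x < b -> 0 <= df x) -> f a <= f b.
Proof.
rewrite le_eqVlt => /orP[/eqP -> //|ab] cf d p.
have [c [hc e]] := mean_value ab cf d.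
by rewrite -subr_ge0 e mulr_ge0 ?p// subr_ge0 ltW.
Qed.

Lemma derive_le0_le f df a b : a <= b ->
  (forall x, a <= x <= b -> {for x, continuous f}) ->
  (forall x, a < x < b -> is_derive x 1 f (df x)) ->
  (forall x, a < x < b -> df x <= 0) -> f b <= f a.
Proof.
rewrite le_eqVlt => /orP[/eqP -> //|ab] cf d p.
have [c [hc e]] := mean_value ab cf d.
by rewrite -subr_le0 e mulr_le0_ge0 ?p// subr_ge0 ltW.
Qed.

Lemma derive_gt0_lt f df a b : a < b ->
  (forall x, a <= x <= b -> {for x, continuous f}) ->
  (forall x, a < x < b -> is_derive x 1 f (df x)) ->
  (forall x, a < x < b -> 0 < df x) -> f a < f b.
Proof.
move=> ab cf d p; have [c [hc e]] := mean_value ab cf d.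
by rewrite -subr_gt0 e mulr_gt0 ?p// subr_gt0.
Qed.

Lemma derive_lt0_lt f df a b : a < b ->
  (forall x, a <= x <= b -> {for x, continuous f}) ->
  (forall x, a < x < b -> is_derive x 1 f (df x)) ->
  (forall x, a < x < b -> df x < 0) -> f b < f a.
Proof.
move=> ab cf d p; have [c [hc e]] := mean_value ab cf d.
by rewrite -subr_lt0 e nmulr_rlt0 ?p// subr_gt0.
Qed.

Lemma derive_0_eq f a b : a <= b ->
  (forall x, a <= x <= b -> {for x, continuous f}) ->
  (forall x, a < x < b -> is_derive x 1 f 0) -> f a = f b.
Proof.
move=> ab cf d; apply/eqP; rewrite eq_le.
apply/andP; split.
  exact: (derive_ge0_le ab cf d).
exact: (derive_le0_le ab cf d).
Qed.

Lemma IVT_sign f a b : a <= b -> (forall x, a <= x <= b -> {for x, continuous f}) ->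
  f a * f b <= 0 -> exists2 c, a <= c <= b & f c = 0.
Proof.
move=> ab cf s.
have cw : {within `[a, b], continuous f}.
  apply: continuous_in_subspaceT => x; rewrite inE /= in_itv /= => hx.
  exact: cf.
have [|c] := @IVT _ f a b 0 ab cw; last by rewrite in_itv; exists c.
have [fa0|fa0] := leP (f a) 0; have [fb0|fb0] := leP (f b) 0; rewrite ge_min le_max.
- have [/eqP h|h] := boolP (f a == 0); first by rewrite h lexx.
  have fa : f a < 0 by rewrite lt_neqAle h.
  by move: s; rewrite nmulr_rle0// => ->; rewrite fa0 orbT.
- by rewrite fa0 (ltW fb0) orbT.
- by rewrite fb0 (ltW fa0) orbT.
- by have := mulr_gt0 fa0 fb0; rewrite ltNge s.
Qed.

Lemma IVT_val f a b v : a <= b -> (forall x, a <= x <= b -> {for x, continuous f}) ->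
  (f a <= v <= f b \/ f b <= v <= f a) -> exists2 c, a <= c <= b & f c = v.
Proof.
move=> ab cf h.
have [||c hc e] := @IVT_sign (fun x => f x - v) a b ab.
- by move=> x hx; apply: cvgB; [exact: cf|exact: cvg_cst].
- case: h => /andP[h1 h2]; first by rewrite mulr_le0_ge0 ?subr_le0 ?subr_ge0.
  by rewrite mulr_ge0_le0 ?subr_le0 ?subr_ge0.
by exists c => //; apply/eqP; rewrite -subr_eq0 e.
Qed.

(** By the mean value theorem each difference quotient at [c] is a value of [g] at a point closer to
    [c]. It serves at the corner of the absolute value, for t |t|. *)
Lemma is_derive_punctured f g c : (forall x, {for x, continuous f}) ->
  {for c, continuous g} ->
  (exists2 e, 0 < e & forall x, x != c -> `|x - c| < e -> is_derive x 1 f (g x)) ->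
  is_derive c 1 f (g c).
Proof.
move=> cf cg [e e0 d].
have key : (fun h => h^-1 *: (f (h + c) - f c)) @ 0^' --> g c.
  apply/cvgrPdist_lt => eps eps0.
  have [dl /= dl0 Hd] : exists2 dl, 0 < dl & forall x, `|x - c| < dl -> `|g c - g x| < eps.
    move/cvgrPdist_lt : cg => /(_ eps eps0) /nbhs_ballP [dl /= dl0 H].
    by exists dl => // x hx; apply: H; rewrite /ball /= distrC.
  have m0 : 0 < Num.min e dl by rewrite lt_min e0.
  exists (Num.min e dl) => //= h; rewrite /ball /= sub0r normrN lt_min => /andP[he hd] hn0.
  have [h0|h0] : h < 0 \/ 0 < h by apply/orP; rewrite -neq_lt.
    have [|x hx|x /andP[x1 x2]|z [/andP[z1 z2] E]] := @mean_value f g (h + c) c.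
    - by rewrite gtrDr.
    - exact: cf.
    - apply: d; first by rewrite lt_eqF.
      move: he; rewrite (ltr0_norm h0) ltr0_norm ?subr_lt0//; lra.
    have -> : f (h + c) - f c = g z * h by rewrite -opprB E; ring.
    rewrite /GRing.scale /= mulrC mulfK//; apply: Hd.
    move: hd; rewrite (ltr0_norm h0) ltr0_norm ?subr_lt0//; lra.
  have [|x hx|x /andP[x1 x2]|z [/andP[z1 z2] E]] := @mean_value f g c (h + c).
  - by rewrite ltrDr.
  - exact: cf.
  - apply: d; first by rewrite gt_eqF.
    move: he; rewrite (gtr0_norm h0) gtr0_norm ?subr_gt0//; lra.
  have -> : f (h + c) - f c = g z * h by rewrite E; ring.
  rewrite /GRing.scale /= mulrC mulfK//; apply: Hd.
  move: hd; rewrite (gtr0_norm h0) gtr0_norm ?subr_gt0//; lra.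
apply: DeriveDef.
  apply/cvg_ex; exists (g c); move: key.
  by under eq_fun do rewrite -[X in f (X + c)]mulr1.
rewrite -derive1E; apply/cvg_lim => //.
Qed.

Lemma dist_thirds (a b c d e : R) : `|a - b| < e / 3 -> `|b - c| < e / 3 ->
  `|d - c| < e / 3 -> `|a - d| < e.
Proof.
by rewrite !ltr_norml => /andP[? ?] /andP[? ?] /andP[? ?]; apply/andP; split; lra.
Qed.

End Calculus.

(** Hypotheses are tried before the structural rules, quantified ones included, so that derivatives
    of unknown functions are taken from the context. [deriv] leaves the equality between the
    computed derivative and the stated one. *)
Ltac der := repeat first
  [ apply is_derive_cstx | apply is_derive_idx | eassumption
  | match goal with H : _ |- _ => apply H end
  | eapply is_derive_sqrx | eapply is_deriveXx
  | eapply is_deriveBx | eapply is_deriveDx | eapply is_deriveNx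
  | eapply is_deriveMx | eapply is_derive_sinx
  | eapply is_derive_cosx | eapply is_derive_expx ].

Ltac deriv := eapply is_derive_eqx; [der|cbv beta].

Ltac abs_case t := let H := fresh "sgn" in
  have [H|H] := leP 0 t; [rewrite ?(ger0_norm H)|rewrite ?(ltr0_norm H)].

(** * Primitives and weak derivatives *)

Section Primitive.
Context {R : realType}.
Notation mu := (@lebesgue_measure R).
Implicit Types (f g : R -> R) (x y a b : R).

Definition loc_int g := forall a b, mu.-integrable `[a, b] (EFin \o g).

(** The oriented integral from 0 to [y]: for either sign of [y], one of the two intervals is empty
    or a point. *)
Definition prim g y := \int[mu]_(t in `[0, y]) g t - \int[mu]_(t in `[y, 0]) g t.

Lemma Rintegral_itv_chain g a b c : loc_int g -> a <= b -> b <= c ->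
  \int[mu]_(t in `[a, c]) g t =
  \int[mu]_(t in `[a, b]) g t + \int[mu]_(t in `[b, c]) g t.
Proof.
move=> lg ab bc.
have h := @Rintegral_itvB R g (BLeft a) (BRight c) b (lg a c).
have /h : (BLeft a <= BRight b)%O by rewrite bnd_simp.
move/(_ _); rewrite bnd_simp => /(_ bc) e.
rewrite [X in _ = _ + X](_ : _ = \int[mu]_(t in `]b, c]) g t); first by rewrite -e; ring.
rewrite Rintegral_itv_obnd_cbnd//.
apply: integrableS (lg b c) => //.
by apply: subset_itvr; rewrite bnd_simp.
Qed.

Lemma prim_diff g x y : loc_int g -> x <= y ->
  prim g y - prim g x = \int[mu]_(t in `[x, y]) g t.
Proof.
move=> lg xy; rewrite /prim.
have e0 a b : b <= a -> \int[mu]_(t in `[a, b]) g t = 0.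
  rewrite le_eqVlt => /orP[/eqP ->|ba]; first by rewrite set_itv1 Rintegral_set1.
  by rewrite set_itv_ge ?Rintegral_set0// bnd_simp -ltNge.
have [x0|x0] := leP 0 x.
  rewrite (e0 x 0)// (e0 y 0) ?(le_trans x0)//.
  by rewrite (@Rintegral_itv_chain g 0 x y)//; ring.
have [y0|y0] := leP 0 y.
  rewrite (e0 y 0)// (e0 0 x) ?ltW// (@Rintegral_itv_chain g x 0 y)// ?ltW//; ring.
rewrite (e0 0 x) ?(e0 0 y) ?ltW// (@Rintegral_itv_chain g x y 0)// ?ltW//; ring.
Qed.

Lemma prim0 g : prim g 0 = 0.
Proof. by rewrite /prim subrr. Qed.

Lemma continuous_near_eq f h x : (\forall y \near x, f y = h y) ->
  {for x, continuous h} -> {for x, continuous f}.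
Proof.
move=> e ch; rewrite /prop_for /continuous_at (nbhs_singleton e).
apply: cvg_trans ch; apply: near_eq_cvg.
by apply: filterS e => y ->.
Qed.

Lemma prim_cont g : loc_int g -> continuous (prim g).
Proof.
move=> lg x.
have ab : x - 1 <= x + 1 by lra.
have ab' : x - 1 < x + 1 by lra.
have cw := parameterized_integral_continuous ab (lg (x - 1) (x + 1)).
have xi : x \in `]x - 1, x + 1[ by rewrite in_itv /=; apply/andP; split; lra.
have h := within_continuous_continuous ab' cw xi.
have h2 : {for x, continuous (fun y => prim g (x - 1) + parameterized_integral mu (x - 1) y g)}.
  by apply: cvgD; [exact: cvg_cst|exact: h].
apply: (continuous_near_eq _ h2).
near=> y; rewrite /parameterized_integral -(@prim_diff _ (x - 1))//; first by ring.
by apply: ltW; near: y; apply: lt_nbhsr; lra.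
Unshelve. all: by end_near. Qed.

Lemma prim_deriv g x : loc_int g -> {for x, continuous g} ->
  is_derive x 1 (prim g) (g x).
Proof.
move=> lg cg.
have xx : x - 1 < x by lra.
have xx1 : x < x + 1 by lra.
have [d1 d2] := @continuous_FTC1_closed R g (x - 1) x (x + 1) xx1 (lg _ _) xx cg.
have h : is_derive x 1 (fun y => \int[mu]_(t in `[x - 1, y]) g t) (g x).
  by rewrite -d2; exact: is_derive_derive1.
have h2 : is_derive x 1 (fun y => prim g (x - 1) + \int[mu]_(t in `[x - 1, y]) g t) (g x).
  by deriv; rewrite add0r.
apply: (near_eq_is_derive _ h2) => //.
near=> y; rewrite -(@prim_diff _ (x - 1))//; first by ring.
by apply: ltW; near: y; apply: lt_nbhsr; lra.
Unshelve. all: by end_near. Qed.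

Lemma continuous_loc_int g : continuous g -> loc_int g.
Proof.
move=> cg a b; apply: continuous_compact_integrable; first exact: segment_compact.
exact: continuous_subspaceT.
Qed.

Lemma L2P g : L2 g <-> measurable_fun setT g /\
  mu.-integrable setT (EFin \o (fun x => g x ^+ 2)).
Proof.
split=> [h|[mg ig]].
  split; last exact: Lfun2_integrable_sqr.
  by move: h; rewrite /L2 inE => /andP[]; rewrite inE.
rewrite /L2 inE; apply/andP; split; first by rewrite inE.
rewrite inE /= /finite_norm unlock /=.
apply: poweR_lty.
move/integrableP: ig => [_]; apply: le_lt_trans.
apply: ge0_le_integral => //.
- apply/measurable_EFinP.
  apply: (@measurableT_comp _ _ _ _ _ _ (fun x : R => x `^ 2)%R) => //.
  exact: measurableT_comp.
- by do 2 apply: measurableT_comp => //; apply: measurable_funX.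
- by move=> x _; rewrite /= lee_fin normrX -powR_mulrn.
Qed.

(** Dominated by 1 + g^2, which is integrable on bounded intervals. *)
Lemma L2_loc_int g : L2 g -> loc_int g.
Proof.
move=> /L2P[mg ig] a b.
apply: (@le_integrable _ _ R mu _ _ (EFin \o g) (EFin \o (fun x => 1 + g x ^+ 2))) => //.
- by apply/measurable_EFinP; apply: measurable_funTS.
- move=> x _; rewrite /= lee_fin [leRHS]ger0_norm; last by rewrite addr_ge0// sqr_ge0.
  have := sqr_ge0 (`|g x| - 1); rewrite -[g x ^+ 2]real_normK ?num_real//; nra.
- have -> : EFin \o (fun x => 1 + g x ^+ 2) =
      ((EFin \o cst 1%R) \+ (EFin \o (fun x => g x ^+ 2)%R))%E by [].
  apply: integrableD => //.
    exact: (continuous_loc_int (fun x => cvg_cst _)).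
  by apply: integrableS ig => //; exact: measurable_itv.
Qed.

(** A positive lower bound on a half-line, which has infinite measure, would contradict
    integrability. This replaces limits at infinity throughout. *)
Lemma integrable_small_right (k : R -> R) (a c : R) : mu.-integrable setT (EFin \o k) -> 0 < c ->
  (forall x, 0 <= k x) -> exists2 x, a <= x & k x < c.
Proof.
move=> ik c0 k0; apply: contrapT => H.
have {}H x : a <= x -> c <= k x.
  by move=> ax; rewrite leNgt; apply/negP => h; apply: H; exists x.
have : (\int[mu]_(x in `[a, +oo[) (k x)%:E < +oo)%E.
  move/integrableP : ik => [mk]; apply: le_lt_trans.
  under [leRHS]eq_integral do rewrite /= ger0_norm//.
  apply: (@ge0_subset_integral _ _ R mu `[a, +oo[%classic setT) => //.
    by move=> x _; rewrite lee_fin.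
apply/negP; rewrite -leNgt.
have -> : (+oo = \int[mu]_(x in `[a, +oo[) (cst c%:E x))%E.
  rewrite integral_cst; last exact: measurable_itv.
  have e : mu `[a, +oo[%classic = +oo%E by rewrite lebesgue_measure_itv /= ltry.
  transitivity (c%:E * +oo)%E; first by rewrite gt0_muley// lte_fin.
  by congr (_ * _)%E; exact: esym e.
apply: ge0_le_integral => //.
- by move=> x _; rewrite lee_fin ltW.
- by move/integrableP : ik => [mk _]; apply: measurable_funTS.
- by move=> x /=; rewrite in_itv /= andbT lee_fin => /H.
Qed.

End Primitive.

(** * Mollified step functions as test functions *)

Section DuBoisReymond.
Context {R : realType}.
Notation mu := (@lebesgue_measure R).
Implicit Types (f g v w : R -> R) (x y a b e t : R).

(* [tent e] is a continuous bump of mass one supported in [-e, e], and [step e]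
   its primitive. *)
Definition tent e t : R := (`|t + e| + `|t - e| - 2 * `|t|) / (2 * e ^+ 2).
Definition step e t : R :=
  ((t + e) * `|t + e| + (t - e) * `|t - e| - 2 * (t * `|t|)) / (4 * e ^+ 2).

Lemma is_derive_mul_norm x : is_derive x 1 (fun t => t * `|t|) (2 * `|x|).
Proof.
apply: (@is_derive_punctured _ (fun t => t * `|t|) (fun t => 2 * `|t|)).
- move=> y; apply: cvgM; first exact: cvg_id.
  exact: norm_continuous.
- apply: cvgM; first exact: cvg_cst.
  exact: norm_continuous.
have [->|x0] := eqVneq x 0.
  exists 1 => // y y0 _.
  have [y1|y1] : y < 0 \/ 0 < y by apply/orP; rewrite -neq_lt.
    have h : is_derive y 1 (fun t => - (t * t)) (2 * - y) by deriv; ring.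
    rewrite ltr0_norm//; apply: near_eq_is_derive h.
    near=> z; rewrite ltr0_norm ?mulrN//; near: z; exact: lt_nbhsl.
  have h : is_derive y 1 (fun t => (t * t)) (2 * y) by deriv; ring.
  rewrite gtr0_norm//; apply: near_eq_is_derive h.
  near=> z; rewrite gtr0_norm//; near: z; exact: lt_nbhsr.
exists `|x|; rewrite ?normr_gt0// => y _ yx.
have [y1|y1] : y < 0 \/ 0 < y.
- apply/orP; rewrite -neq_lt; apply/eqP => y0; move: yx.
  by rewrite y0 sub0r normrN ltxx.
- have h : is_derive y 1 (fun t => - (t * t)) (2 * - y) by deriv; ring.
  rewrite ltr0_norm//; apply: near_eq_is_derive h.
  near=> z; rewrite ltr0_norm ?mulrN//; near: z; exact: lt_nbhsl.
have h : is_derive y 1 (fun t => (t * t)) (2 * y) by deriv; ring.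
rewrite gtr0_norm//; apply: near_eq_is_derive h.
near=> z; rewrite gtr0_norm//; near: z; exact: lt_nbhsr.
Unshelve. all: by end_near. Qed.

Lemma is_derive_step e t : e != 0 -> is_derive t 1 (step e) (tent e t).
Proof.
move=> e0; rewrite /step /tent.
have h c : is_derive t 1 (fun t => (t + c) * `|t + c|) (2 * `|t + c|).
  have h1 : is_derive t 1 (fun t => t + c) (1 : R) by deriv; rewrite addr0.
  by apply: (is_derive_eqx (is_derive_compx h1 (is_derive_mul_norm _))); rewrite mulr1.
have h1 := h e. have h2 := h (- e).
have h3 := is_derive_mul_norm t.
eapply is_derive_eqx.
  eapply is_deriveMx; last exact: is_derive_cstx.
  eapply is_deriveBx; first (eapply is_deriveDx; [exact: h1|exact: h2]).
  eapply is_deriveMx; [exact: is_derive_cstx|exact: h3].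
by rewrite /=; field.
Qed.

Lemma continuous_tent e : continuous (tent e).
Proof.
move=> t; apply: cvgM; last exact: cvg_cst.
apply: cvgB; last first.
  by apply: cvgM; [exact: cvg_cst|exact: norm_continuous].
by apply: cvgD; apply: cvg_norm; apply: cvgD => //; exact: cvg_cst.
Qed.

Lemma tent_ge0 e t : 0 <= tent e t.
Proof.
rewrite /tent divr_ge0//; last by rewrite mulr_ge0// sqr_ge0.
rewrite subr_ge0 [leLHS](_ : _ = `|(t + e) + (t - e)|); first exact: ler_normD.
by rewrite -[2 in LHS](@ger0_norm _ 2)// -normrM; congr (`|_|); ring.
Qed.

Lemma tent_le e t : 0 < e -> tent e t <= e^-1.
Proof.
move=> e0; rewrite /tent ler_pdivrMr ?mulr_gt0 ?exprn_gt0//.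
have -> : e^-1 * (2 * e ^+ 2) = 2 * e by field; rewrite gt_eqF.
abs_case (t + e); abs_case (t - e); abs_case t; lra.
Qed.

Lemma tent_out e t : 0 < e -> e <= `|t| -> tent e t = 0.
Proof.
move=> e0 et; apply/eqP; rewrite /tent mulf_eq0; apply/orP; left; apply/eqP; move: et.
abs_case (t + e); abs_case (t - e); abs_case t; move=> ?; lra.
Qed.

Lemma step_right e t : 0 < e -> e <= t -> step e t = 1 / 2.
Proof.
move=> e0 et; rewrite /step !ger0_norm; try lra.
by field; rewrite gt_eqF.
Qed.

Lemma step_left e t : 0 < e -> t <= - e -> step e t = - (1 / 2).
Proof.
move=> e0 et; rewrite /step !ler0_norm; try lra.
by field; rewrite gt_eqF.
Qed.

Lemma step_le e : e != 0 -> {homo step e : x y / x <= y}.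
Proof.
move=> e0 x y xy; apply: (@derive_ge0_le _ (step e) (tent e)) => //.
- by move=> z _; apply: is_derive_cont; exact: is_derive_step.
- by move=> z _; exact: is_derive_step.
by move=> z _; exact: tent_ge0.
Qed.

Lemma step_bound e t : 0 < e -> - (1 / 2) <= step e t <= 1 / 2.
Proof.
move=> e0; have e00 : e != 0 by rewrite gt_eqF.
have := @step_right e (Num.max e t) e0; have := @step_left e (Num.min (- e) t) e0.
rewrite le_max lexx ge_min lexx /= => <-// <-//.
apply/andP; split; first by apply: step_le => //; rewrite ge_min lexx orbT.
by apply: step_le => //; rewrite le_max lexx orbT.
Qed.

(** A C^1 approximation of the indicator of [a, b], whose derivative is a unit mass near [a] minus a
    unit mass near [b]. *)
Definition bump a b e x := step e (x - a) - step e (x - b).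

Lemma is_derive_bump a b e x : 0 < e ->
  is_derive x 1 (bump a b e) (tent e (x - a) - tent e (x - b)).
Proof.
move=> e0; have h c : is_derive x 1 (fun x => step e (x - c)) (tent e (x - c)).
  have h1 : is_derive x 1 (fun t => t - c) (1 : R) by deriv; rewrite subr0.
  have e1 : e != 0 by rewrite gt_eqF.
  by apply: (is_derive_eqx (is_derive_compx h1 (is_derive_step (x - c) e1))); rewrite mulr1.
by apply: is_deriveBx.
Qed.

Lemma bump_test a b e : a < b -> 0 < e -> test_function (bump a b e).
Proof.
move=> ab e0; split.
- by move=> x; have [] := is_derive_bump a b x e0.
- rewrite (_ : derive1 _ = fun x => tent e (x - a) - tent e (x - b)); last first.
    by apply/funext => x; apply: derive1_is; exact: is_derive_bump.
  move=> x; apply: cvgB.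
    apply: (@continuous_comp _ _ _ (fun x => x - a) (tent e)); last exact: continuous_tent.
    by apply: cvgB => //; exact: cvg_cst.
  apply: (@continuous_comp _ _ _ (fun x => x - b) (tent e)); last exact: continuous_tent.
  by apply: cvgB => //; exact: cvg_cst.
exists (`|a| + `|b| + e) => x.
have ha := ler_norm a; have hb := ler_norm b.
have ha' := ler_norm (- a); have hb' := ler_norm (- b); rewrite !normrN in ha' hb'.
rewrite /bump; abs_case x => hx.
  rewrite !step_right ?subrr//; lra.
rewrite !step_left ?subrr//; lra.
Qed.

Lemma bump_in a b e x : 0 < e -> a + e <= x <= b - e -> bump a b e x = 1.
Proof. move=> e0 /andP[h1 h2]; rewrite /bump step_right ?step_left//; lra. Qed.

Lemma bump_out a b e x : 0 < e -> a < b -> x <= a - e \/ b + e <= x -> bump a b e x = 0.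
Proof.
move=> e0 ab [h|h]; rewrite /bump; first by rewrite !step_left ?subrr//; lra.
rewrite !step_right ?subrr//; lra.
Qed.

Lemma bump_01 a b e x : 0 < e -> a < b -> 0 <= bump a b e x <= 1.
Proof.
move=> e0 ab; rewrite /bump; have /andP[h1 h2] := step_bound (x - a) e0.
have /andP[h3 h4] := step_bound (x - b) e0.
have : step e (x - b) <= step e (x - a) by apply: step_le; [rewrite gt_eqF|lra].
by move=> h; apply/andP; split; lra.
Qed.

End DuBoisReymond.

(** * A weakly differentiable function is a primitive almost everywhere *)

Section WeakClassical.
Context {R : realType}.
Notation mu := (@lebesgue_measure R).
Implicit Types (f g v w : R -> R) (x y a b e t : R).

Lemma loc_int_norm g : loc_int g -> loc_int (fun x => `|g x|).
Proof. by move=> lg a b; have := integrable_norm (lg a b). Qed.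

Lemma loc_intD g h : loc_int g -> loc_int h -> loc_int (fun x => g x + h x).
Proof. by move=> lg lh a b; apply: integrableD (lg a b) (lh a b). Qed.

Lemma loc_int_cst c : loc_int (fun _ : R => c).
Proof. by apply: continuous_loc_int => x; exact: cvg_cst. Qed.

Lemma loc_int_mul g k : loc_int g -> continuous k -> loc_int (fun x => g x * k x).
Proof.
move=> lg ck a b.
have cw : {within `[a, b], continuous k} by exact: continuous_subspaceT.
have bk : [bounded (k x : R^o) | x in `[a, b]%classic].
  have /compact_bounded[M [_ mrt]] := continuous_compact cw (@segment_compact R a b).
  by exists M; split; rewrite ?num_real// => z /mrt h x xab; apply: h; exists x.
have mk : measurable_fun `[a, b]%classic k.
  by apply: measurable_funTS; exact: continuous_measurable_fun.
by have := integrableMl _ (lg a b) mk bk; apply.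
Qed.

Lemma lebesgue_pt_small v a : loc_int v -> lebesgue_pt v a -> forall eps, 0 < eps ->
  exists2 d, 0 < d & forall e, 0 < e < d ->
    \int[mu]_(x in `[a - e, a + e]) `|v x - v a| <= eps * e.
Proof.
move=> lv /fine_cvgP[_ +] eps eps0.
(* The mean is taken over an interval of length 2e, so a mean below eps/2 is an integral below eps
   e. *)
move=> /cvgrPdist_lt /(_ (eps / 2)).
rewrite divr_gt0// => /(_ isT) [d /= d0 H].
exists d => // e /andP[e0 ed].
have := H e; rewrite /= sub0r normrN gtr0_norm// => /(_ ed e0).
rewrite sub0r normrN /davg /iavg ball_itv.
have m : mu `]a - e, a + e[%classic = (2 * e)%:E.
  rewrite lebesgue_measure_itv /= lte_fin ifT; last by lra.
  by rewrite -EFinD; congr EFin; ring.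
set J := (X in (_ * X)%E).
have lvc : loc_int (fun x => `|v x - v a|).
  by apply: loc_int_norm; apply: (loc_intD lv); exact: loc_int_cst.
have J1 : (J = \int[mu]_(x in `](a - e)%R, (a + e)%R[) (`|v x - v a|%R)%:E)%E.
  by apply: eq_integral => x _; rewrite /=.
have J2 : fine J = \int[mu]_(x in `[a - e, a + e]) `|v x - v a|.
  rewrite J1 -[fine _]/(\int[mu]_(x in `]a - e, a + e[) `|v x - v a|).
  rewrite Rintegral_itv_bndo_bndc; last first.
    by apply: integrableS (lvc (a - e) (a + e)) => //; apply: subset_itv_oo_cc.
  rewrite Rintegral_itv_obnd_cbnd//.
  by apply: integrableS (lvc (a - e) (a + e)) => //; apply: subset_itvr; rewrite bnd_simp.
have Jfin : J \is a fin_num.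
  rewrite J1; apply: integrable_fin_num => //.
  by apply: integrableS (lvc (a - e) (a + e)) => //; apply: subset_itv_oo_cc.
rewrite [mu _]m inver mulf_eq0 !gt_eqF// /= -[J]fineK// -EFinM /= J2.
move=> h; have := ltW (le_lt_trans (ler_norm _) h).
rewrite ler_pdivrMl ?mulr_gt0// => /le_trans; apply.
by rewrite le_eqVlt; apply/orP; left; apply/eqP; field.
Qed.

Lemma integral_supp f a b : (forall x, x < a \/ b < x -> f x = 0) ->
  \int[mu]_x f x = \int[mu]_(x in `[a, b]) f x.
Proof.
move=> H; rewrite [RHS]Rintegral_mkcond; apply: eq_Rintegral => x _.
rewrite patchE; case: ifPn => //; rewrite notin_setE /= in_itv /= => /negP.
by rewrite negb_and -!ltNge => /orP h; apply: H.
Qed.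

Lemma integral_tent a e : 0 < e -> \int[mu]_(x in `[a - e, a + e]) tent e (x - a) = 1.
Proof.
move=> e0.
have ct : continuous (fun x => tent e (x - a)).
  move=> x; apply: (@continuous_comp _ _ _ (fun x => x - a) (tent e)); last exact: continuous_tent.
  by apply: cvgB => //; exact: cvg_cst.
have ds x : is_derive x 1 (fun x => step e (x - a)) (tent e (x - a)).
  have h1 : is_derive x 1 (fun t => t - a) (1 : R) by deriv; rewrite subr0.
  have e1 : e != 0 by rewrite gt_eqF.
  by apply: (is_derive_eqx (is_derive_compx h1 (is_derive_step (x - a) e1))); rewrite mulr1.
rewrite -(@prim_diff _ (fun x => tent e (x - a))); [|exact: continuous_loc_int|lra].
pose F x := prim (fun x => tent e (x - a)) x - step e (x - a).
have dF x : is_derive x 1 F 0.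
  have := prim_deriv (continuous_loc_int ct) (ct x) => h.
  by eapply is_derive_eqx; [eapply is_deriveBx; [exact: h|exact: ds]|rewrite subrr].
have : F (a - e) = F (a + e).
  by apply: derive_0_eq => // [|x _]; [lra|exact: is_derive_cont].
by rewrite /F step_left ?step_right//; lra.
Qed.

(** The tent has mass one, so the difference is the integral of (v - v a) against it, and it is at
    most 1/e. *)
Lemma tent_average v a e : loc_int v -> 0 < e ->
  `|\int[mu]_x (v x * tent e (x - a)) - v a| <=
  e^-1 * \int[mu]_(x in `[a - e, a + e]) `|v x - v a|.
Proof.
move=> lv e0.
have ct : continuous (fun x => tent e (x - a)).
  move=> x; apply: (@continuous_comp _ _ _ (fun x => x - a) (tent e)); last exact: continuous_tent.
  by apply: cvgB => //; exact: cvg_cst.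
rewrite (@integral_supp _ (a - e) (a + e)); last first.
  move=> x h; rewrite tent_out ?mulr0//.
  by rewrite ler_normr; case: h => h; apply/orP; [right|left]; lra.
have lvc : loc_int (fun x => v x - v a) by apply: (loc_intD lv); exact: loc_int_cst.
have I1 := loc_int_mul lvc ct.
have I2 := loc_int_mul (loc_int_cst (v a)) ct.
have -> : \int[mu]_(x in `[a - e, a + e]) (v x * tent e (x - a)) =
  \int[mu]_(x in `[a - e, a + e]) ((v x - v a) * tent e (x - a)) + v a.
  rewrite -[X in _ = _ + X]mulr1 -(@integral_tent a e e0) -RintegralZl//; last first.
    exact: (continuous_loc_int ct).
  rewrite -RintegralD//.
  by apply: eq_Rintegral => x _; ring.
rewrite addrK; apply: le_trans (le_normr_Rintegral _ (I1 _ _)) _ => //.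
rewrite -RintegralZl//; last exact: (loc_int_norm lvc).
apply: le_Rintegral => //; first exact: (loc_int_norm I1).
  have h := @integrableZl _ _ R mu `[a - e, a + e]%classic (measurable_itv _) e^-1 _ (loc_int_norm lvc (a - e) (a + e)).
  by apply: eq_integrable h.
move=> x _; rewrite normrM mulrC ler_wpM2r// ger0_norm; first exact: tent_le.
exact: tent_ge0.
Qed.

(** The bump differs from the indicator of [a, b] only within [e] of the endpoints, and there by at
    most one. *)
Lemma bump_average w a b e : loc_int w -> 0 < e -> a + e < b - e ->
  `|\int[mu]_x (w x * bump a b e x) - \int[mu]_(x in `[a, b]) w x| <=
  \int[mu]_(x in `[a - e, a + e]) `|w x| + \int[mu]_(x in `[b - e, b + e]) `|w x|.
Proof.
move=> lw e0 ab; have ab' : a < b by lra.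
have cb : continuous (bump a b e).
  by move=> x; apply: is_derive_cont (is_derive_bump a b x e0).
have lb := loc_int_mul lw cb.
have cb1 : continuous (fun x => bump a b e x - 1).
  by move=> x; apply: cvgB; [exact: cb|exact: cvg_cst].
pose I (f : R -> R) c d : R := \int[mu]_(x in `[c, d]) f x.
pose wb x := w x * bump a b e x; pose wc x := w x * (bump a b e x - 1).
pose aw x : R := `|w x|.
have lc : loc_int wc by exact: loc_int_mul.
have la : loc_int aw by exact: loc_int_norm.
have ch g c d m : loc_int g -> c <= d -> d <= m -> I g c m = I g c d + I g d m.
  exact: Rintegral_itv_chain.
have est k c d : continuous k -> (forall x, `|k x| <= 1) ->
    `|I (fun x => w x * k x) c d| <= I aw c d.
  move=> ck k1; have lk := loc_int_mul lw ck.
  apply: le_trans (le_normr_Rintegral _ (lk _ _)) _ => //.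
  apply: le_Rintegral => //; first exact: (loc_int_norm lk).
  by move=> x _; rewrite normrM ler_piMr.
have b01 x := bump_01 x e0 ab'.
have B1 c d : `|I wb c d| <= I aw c d.
  by apply: est => // x; have /andP[h1 h2] := b01 x; rewrite ger0_norm.
have B2 c d : `|I wc c d| <= I aw c d.
  by apply: est => // x; have /andP[h1 h2] := b01 x; rewrite ler0_norm; lra.
have spl c d : I wb c d = I wc c d + I w c d.
  rewrite /I -RintegralD//.
  by apply: eq_Rintegral => x _; rewrite /wb /wc; ring.
have mid : I wb (a + e) (b - e) = I w (a + e) (b - e).
  apply: eq_Rintegral => x; rewrite inE /= in_itv /= => hx.
  by rewrite /wb bump_in ?mulr1.
have -> : \int[mu]_x (w x * bump a b e x) = I wb (a - e) (b + e).
  apply: integral_supp.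
  by move=> x h; rewrite bump_out ?mulr0//; case: h => h; [left|right]; lra.
suff : `|I wb (a - e) (b + e) - I w a b| <= I aw (a - e) (a + e) + I aw (b - e) (b + e) by [].
(* With [I] opaque, the additivity relations become linear facts about atoms. *)
clearbody I.
rewrite (ch wb (a - e) a)//; try lra.
rewrite (ch wb a (a + e))//; try lra.
rewrite (ch wb (a + e) (b - e))//; try lra.
rewrite (ch wb (b - e) b)//; try lra.
rewrite (ch w a (a + e))//; try lra.
rewrite (ch w (a + e) (b - e))//; try lra.
rewrite (ch aw (a - e) a)//; try lra.
rewrite (ch aw (b - e) b)//; try lra.
rewrite mid (spl a) (spl (b - e)).
have := B1 (a - e) a; have := B2 a (a + e); have := B2 (b - e) b; have := B1 b (b + e).
rewrite !ler_norml; move=> /andP[i1 i2] /andP[i3 i4] /andP[i5 i6] /andP[i7 i8].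
by clear -i1 i2 i3 i4 i5 i6 i7 i8; apply/andP; split; lra.
Qed.

Lemma loc_int_locally v : measurable_fun setT v -> loc_int v ->
  locally_integrable setT v.
Proof.
move=> mv lv; split; [exact: mv|exact: openT|move=> K _ cK].
have [M [_ HM]] := compact_bounded cK.
have KM : K `<=` `[- (`|M| + 1), `|M| + 1].
  move=> x /(HM (`|M| + 1)) /=.
  rewrite (le_lt_trans (ler_norm M)) ?ltrDl// => /(_ isT).
  by rewrite in_itv /= -ler_norml.
have /integrableP[m] := loc_int_norm lv (- (`|M| + 1)) (`|M| + 1).
apply: le_lt_trans.
have mK : measurable K by exact: compact_measurable.
under [leRHS]eq_integral do rewrite /= normr_id.
apply: (@ge0_subset_integral _ _ R mu K `[- (`|M| + 1), `|M| + 1]%classic mK _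
  (fun x => (`|v x|%R)%:E)) => //.
Qed.

Lemma prim_norm_small w a eps : loc_int w -> 0 < eps ->
  exists2 d, 0 < d & forall e, 0 < e < d ->
    \int[mu]_(x in `[a - e, a + e]) `|w x| <= eps.
Proof.
move=> lw eps0; have ln := loc_int_norm lw.
have /cvgrPdist_lt /(_ (eps / 2)) := @prim_cont _ _ ln a.
rewrite divr_gt0// => /(_ isT) [d /= d0 H].
exists d => // e /andP[e0 ed].
rewrite -prim_diff//; last by lra.
have h1 := H (a + e); have h2 := H (a - e).
have {}h1 := h1 _; rewrite /= opprD addNKr normrN gtr0_norm// in h1.
rewrite /= opprB addrC subrK gtr0_norm// in h2.
have := h1 ed; have := h2 ed; rewrite !ltr_norml.
move=> /andP[_ i1] /andP[i2 _]; clear -i1 i2; lra.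
Qed.

(** Test against [bump a b e] and let [e] tend to zero: at Lebesgue points the left side tends to v
    a - v b, the right side to minus the integral of [w] over [a, b]. *)
Lemma weak_derivative_diff v w a b : loc_int v -> loc_int w -> weak_derivative v w ->
  lebesgue_pt v a -> lebesgue_pt v b -> a < b -> v b - v a = prim w b - prim w a.
Proof.
move=> lv lw wd la lb ab; rewrite prim_diff// ?ltW//.
apply/eqP; rewrite -subr_eq0 -normr_le0; apply/ler_addgt0Pr => eps eps0.
rewrite add0r; have eps4 : 0 < eps / 4 by rewrite divr_gt0.
have [d1 d10 H1] := lebesgue_pt_small lv la eps4.
have [d2 d20 H2] := lebesgue_pt_small lv lb eps4.
have [d3 d30 H3] := prim_norm_small a lw eps4.
have [d4 d40 H4] := prim_norm_small b lw eps4.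
(* The bound (b - a) / 2 keeps the two smoothing intervals around [a] and [b] disjoint. *)
pose d := Num.min (Num.min d1 d2) (Num.min (Num.min d3 d4) ((b - a) / 2)).
have d0 : 0 < d by rewrite !lt_min d10 d20 d30 d40 /=; lra.
pose e := d / 2; have e0 : 0 < e by rewrite divr_gt0.
have : e < d by rewrite /e; lra.
rewrite {1}/d !lt_min => /andP[/andP[e1 e2] /andP[/andP[e3 e4] e5]].
have abe : a + e < b - e by lra.
have := wd _ (bump_test ab e0).
have -> : derive1 (bump a b e) = fun x => tent e (x - a) - tent e (x - b).
  by apply/funext => x; apply: derive1_is; exact: is_derive_bump.
have ct c : continuous (fun x => tent e (x - c)).
  move=> x; apply: (@continuous_comp _ _ _ (fun x => x - c) (tent e)); last exact: continuous_tent.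
  by apply: cvgB => //; exact: cvg_cst.
have It c : mu.-integrable setT (EFin \o (fun x => v x * tent e (x - c))).
  have l := loc_int_mul lv (ct c) (c - e) (c + e).
  have [+ _] := @integrable_mkcond _ _ R mu `[c - e, c + e]%classic (EFin \o (fun x => v x * tent e (x - c))) (measurable_itv _).
  move=> /(_ l).
  apply: eq_integrable => // x _; rewrite patchE; case: ifPn => //.
  rewrite notin_setE /= in_itv /= => /negP; rewrite negb_and -!ltNge => h.
  rewrite tent_out ?mulr0//.
  by rewrite ler_normr; case/orP: h => h; apply/orP; [right|left]; clear -h; lra.
have -> : \int[mu]_x (v x * (tent e (x - a) - tent e (x - b))) =
  \int[mu]_x (v x * tent e (x - a)) - \int[mu]_x (v x * tent e (x - b)).
  rewrite -RintegralB//.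
  by apply: eq_Rintegral => x _; ring.
have t1 := tent_average a lv e0; have t2 := tent_average b lv e0.
have b1 := bump_average lw e0 abe.
have h1 : e^-1 * \int[mu]_(x in `[a - e, a + e]) `|v x - v a| <= eps / 4.
  by rewrite ler_pdivrMl// mulrC; apply: H1; rewrite e0.
have h2 : e^-1 * \int[mu]_(x in `[b - e, b + e]) `|v x - v b| <= eps / 4.
  by rewrite ler_pdivrMl// mulrC; apply: H2; rewrite e0.
have h3 := H3 e; rewrite e0 e3 in h3; have {}h3 := h3 isT.
have h4 := H4 e; rewrite e0 e4 in h4; have {}h4 := h4 isT.
move=> E.
have fin (A B W I va vb : R) : `|A - va| <= eps / 4 -> `|B - vb| <= eps / 4 ->
    `|W - I| <= eps / 4 + eps / 4 -> A - B = - W -> `|vb - va - I| <= eps.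
  clear; rewrite !ler_norml => /andP[? ?] /andP[? ?] /andP[? ?] ?.
  by apply/andP; split; lra.
exact: (fin _ _ _ _ _ _ (le_trans t1 h1) (le_trans t2 h2) (le_trans b1 (lerD h3 h4)) E).
Qed.

(** Almost every point is a Lebesgue point, and increments between Lebesgue points are those of the
    primitive; one such point fixes the constant. *)
Lemma weak_derivative_prim v w : measurable_fun setT v -> loc_int v -> loc_int w ->
  weak_derivative v w -> exists c, {ae mu, forall x, v x = c + prim w x}.
Proof.
move=> mv lv lw wd.
have aeL := lebesgue_differentiation (loc_int_locally mv lv).
(* Without any Lebesgue point the whole line would be negligible, although [0, 1] has measure
   one. *)
have [a la] : exists a, lebesgue_pt v a.
  apply: contrapT => /forallNP H.
  have : mu.-negligible [set: R].
    by apply: negligibleS aeL => x _ /=; exact: H.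
  rewrite negligibleP//= => h.
  have := lebesgue_measure_itv `[(0:R), 1]; rewrite /= lte_fin ltr01 oppr0 adde0 => h1.
  have : (mu `[0%R, 1%R]%classic <= mu [set: R])%E by apply: le_measure; rewrite ?inE.
  by rewrite h h1 lee_fin ler10.
exists (v a - prim w a).
apply: filterS; first exact: (ae_filter_ringOfSetsType mu).
  2: exact: aeL.
move=> x lx.
have [ax|xa|->] := ltgtP a x; last by rewrite subrK.
- by have := weak_derivative_diff lv lw wd la lx ax; lra.
by have := weak_derivative_diff lv lw wd lx la xa; lra.
Qed.

End WeakClassical.

(** * Classical eigenfunctions *)

Section Eigenfunction.
Context {R : realType}.
Notation mu := (@lebesgue_measure R).
Implicit Types (f g v w phi : R -> R) (L lam : R).

(** The eigenvalue equation reads v'' = [coef] v. *)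
Definition coef L phi lam x : R := D L x * cos (phi x) + lam.

(* Classical form of an eigenfunction [v] with derivative [v1]. *)
Definition eigenfunction L phi lam v v1 : Prop :=
  [/\ continuous v /\ continuous v1,
      forall x : R, `|x| != L ->
        is_derive x 1 v (v1 x) /\ is_derive x 1 v1 (coef L phi lam x * v x),
      L2 v /\ L2 v1
    & exists x, v x != 0].

Lemma ae_imp (P Q : R -> Prop) : {ae mu, forall x, P x} ->
  (forall x, P x -> Q x) -> {ae mu, forall x, Q x}.
Proof.
move=> h PQ; apply: negligibleS h => x /=.
by apply: contra_not => /PQ.
Qed.

Lemma ae_and (P Q : R -> Prop) : {ae mu, forall x, P x} ->
  {ae mu, forall x, Q x} -> {ae mu, forall x, P x /\ Q x}.
Proof.
move=> h h'; apply: negligibleS (negligibleU h h') => x /=.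
by move=> /not_andP.
Qed.

Lemma ae_eq_Rintegral g h a b : loc_int g -> loc_int h ->
  {ae mu, forall x, g x = h x} ->
  \int[mu]_(t in `[a, b]) g t = \int[mu]_(t in `[a, b]) h t.
Proof.
move=> lg lh e; rewrite /Rintegral; congr fine.
have /integrableP[mg _] := lg a b; have /integrableP[mh _] := lh a b.
apply: ae_eq_integral => //.
by apply: (ae_imp e) => x /= -> _.
Qed.

Lemma prim_ae g h : loc_int g -> loc_int h ->
  {ae mu, forall x, g x = h x} -> prim g = prim h.
Proof.
move=> lg lh e; apply/funext => x; rewrite /prim.
by rewrite (ae_eq_Rintegral _ _ lg lh e) (ae_eq_Rintegral x 0 lg lh e).
Qed.

(** The two primitives coincide everywhere, and so do their derivatives. *)
Lemma ae_eq_cont g h : continuous g -> continuous h ->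
  {ae mu, forall x, g x = h x} -> g = h.
Proof.
move=> cg ch e; apply/funext => x.
have lg := continuous_loc_int cg; have lh := continuous_loc_int ch.
have dg := prim_deriv lg (cg x); have dh := prim_deriv lh (ch x).
by rewrite (prim_ae lg lh e) in dg; exact: is_derive_uniq dg dh.
Qed.

Lemma L2_ae g h : L2 g -> measurable_fun setT h ->
  {ae mu, forall x, g x = h x} -> L2 h.
Proof.
move=> /L2P[mg /integrableP[m1 ig]] mh e; apply/L2P; split => //.
apply/integrableP; split.
  by apply/measurable_EFinP; exact: measurable_funX.
move: ig; rewrite (@ae_eq_integral _ _ _ mu setT
  (fun x => `|(EFin \o (fun x => h x ^+ 2)%R) x|)%E)//.
- by apply: measurableT_comp => //; apply/measurable_EFinP; exact: measurable_funX.
- by apply: measurableT_comp => //; apply/measurable_EFinP; exact: measurable_funX.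
by apply: (ae_imp e) => x /= -> _.
Qed.

Lemma D_indic L x : D L x = 1 - \1_(`]- L, L[%classic) x.
Proof.
rewrite /D indicE; have [h|h] := boolP (`|x| < L).
  by rewrite mem_set /= ?subrr// in_itv /= -ltr_norml.
by rewrite memNset /= ?subr0// in_itv /= -ltr_norml; exact/negP.
Qed.

Lemma D_01 L x : D L x = 0 \/ D L x = 1.
Proof. by rewrite /D; case: ifP => _; [left|right]. Qed.

Lemma D_in L x : `|x| < L -> D L x = 0.
Proof. by rewrite /D => ->. Qed.

Lemma D_out L x : L <= `|x| -> D L x = 1.
Proof. by rewrite /D ltNge => ->. Qed.

Lemma D_near L (x : R) : `|x| != L -> \forall y \near x, D L y = D L x.
Proof.
move=> xL; have [h|h] : `|x| < L \/ L < `|x| by apply/orP; rewrite -neq_lt.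
  rewrite (D_in h).
  have : \forall y \near x, `|y| < L.
    by have /cvgr_lt := @norm_continuous R R^o x; apply.
  by apply: filterS => y; exact: D_in.
rewrite (D_out (ltW h)).
have : \forall y \near x, L < `|y|.
  by have /cvgr_gt := @norm_continuous R R^o x; apply.
by apply: filterS => y /ltW; exact: D_out.
Qed.

Lemma measurable_D L : measurable_fun setT (D L).
Proof.
rewrite (_ : D L = fun x => 1 - \1_(`]- L, L[%classic) x); last first.
  by apply/funext => x; exact: D_indic.
by apply: measurable_funB => //; apply: measurable_indic; exact: measurable_itv.
Qed.

Lemma measurable_coef L phi lam : continuous phi -> measurable_fun setT (coef L phi lam).
Proof.
move=> cp; apply: measurable_funD => //; apply: measurable_funM; first exact: measurable_D.
apply: continuous_measurable_fun => x; apply: continuous_comp; first exact: cp.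
exact: continuous_cos.
Qed.

Lemma coef_bound L phi lam x : `|coef L phi lam x| <= 1 + `|lam|.
Proof.
rewrite /coef; apply: le_trans (ler_normD _ _) _; rewrite lerD2r.
by case: (D_01 L x) => ->; rewrite ?mul0r ?normr0// mul1r cos_max.
Qed.

Lemma continuous_coef L phi lam (x : R) : continuous phi -> `|x| != L ->
  {for x, continuous (coef L phi lam)}.
Proof.
move=> cp xL.
apply: (@continuous_near_eq _ _ (fun y => D L x * cos (phi y) + lam)).
  by apply: filterS (D_near xL) => y; rewrite /coef => ->.
apply: cvgD; last exact: cvg_cst.
apply: cvgM; first exact: cvg_cst.
by apply: continuous_comp; [exact: cp|exact: continuous_cos].
Qed.

Lemma L2_coef_mul L phi lam v : continuous phi -> L2 v ->
  L2 (fun x => coef L phi lam x * v x).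
Proof.
move=> cp /L2P[mv iv]; apply/L2P.
have mc : measurable_fun setT (fun x => coef L phi lam x * v x).
  by apply: measurable_funM => //; exact: measurable_coef.
split => //.
have h := @integrableZl _ _ R mu setT measurableT ((1 + `|lam|) ^+ 2) _ iv.
apply: le_integrable h => //.
  by apply/measurable_EFinP; exact: measurable_funX.
move=> x _ /=; rewrite lee_fin exprMn !normrM ler_wpM2r//.
rewrite (@ger0_norm _ (1 + `|lam|)) ?addr_ge0//.
by apply: ler_pM => //; exact: coef_bound.
Qed.

Lemma derive_off_cst L (H : R -> R) : 0 < L -> continuous H ->
  (forall x : R, `|x| != L -> is_derive x 1 H 0) -> forall x y, H x = H y.
Proof.
move=> L0 cH dH.
have out a b : a <= b -> (forall x, a < x < b -> `|x| != L) -> H a = H b.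
  move=> ab h; apply: derive_0_eq => // [z _|z /h]; [exact: cH|exact: dH].
have lo a b : a <= b -> b <= - L -> H a = H b.
  move=> ab bL; apply: out => // x /andP[x1 x2].
  by rewrite ltr0_norm; [rewrite gt_eqF//|]; lra.
have mi a b : a <= b -> - L <= a -> b <= L -> H a = H b.
  move=> ab aL bL; apply: out => // x /andP[x1 x2].
  by rewrite lt_eqF// ltr_norml; apply/andP; split; lra.
have hi a b : a <= b -> L <= a -> H a = H b.
  move=> ab aL; apply: out => // x /andP[x1 x2].
  by rewrite gtr0_norm; [rewrite gt_eqF//|]; lra.
have base z : H z = H 0.
  have [z1|z1] := leP z (- L).
    rewrite (lo z (- L))// (mi (- L) 0)//; lra.
  have [z2|z2] := leP z L.
    have [z3|z3] := leP z 0; first by rewrite (mi z 0)//; lra.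
    by rewrite (mi 0 z)//; lra.
  rewrite -(hi L z) ?(mi 0 L)//; lra.
by move=> x y; rewrite !base.
Qed.

(** Integration by parts: F f minus a primitive of F f' + g f has derivative zero off the two edges
    and is continuous there, hence constant. The jumps of [g] at the edges are harmless. *)
Lemma prim_weak_derivative L F g : 0 < L -> continuous F -> loc_int g ->
  (forall x, `|x| != L -> {for x, continuous g}) ->
  (forall x : R, `|x| != L -> is_derive x 1 F (g x)) -> weak_derivative F g.
Proof.
move=> L0 cF lg cg dF f [df cf [M HM]].
have cf0 : continuous f.
  by move=> x; apply: is_derive_cont (is_derive_derive1 (df x)).
have l1 : loc_int (fun x => F x * derive1 f x).
  by apply: loc_int_mul => //; exact: continuous_loc_int.
have l2 : loc_int (fun x => g x * f x) by exact: loc_int_mul.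
pose k x := F x * derive1 f x + g x * f x.
have lk : loc_int k by exact: loc_intD.
have ck x : `|x| != L -> {for x, continuous k}.
  move=> xL; apply: cvgD; first by apply: cvgM; [exact: cF|exact: cf].
  by apply: cvgM; [exact: cg|exact: cf0].
pose H x := F x * f x - prim k x.
have Hc : continuous H.
  move=> x; apply: cvgB; first by apply: cvgM; [exact: cF|exact: cf0].
  exact: prim_cont.
have dH (x : R) : `|x| != L -> is_derive x 1 H 0.
  move=> xL; have h1 := dF x xL; have h2 := is_derive_derive1 (df x).
  have h3 := prim_deriv lk (ck x xL).
  eapply is_derive_eqx; first (eapply is_deriveBx; [eapply is_deriveMx; [exact: h1|exact: h2]|exact: h3]).
  by rewrite /k; ring.
(* Strictly beyond [M], where f vanishes on neighbourhoods, f' vanishes as well. *)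
pose N := `|M| + 1.
have MN : M < N by rewrite /N (le_lt_trans (ler_norm M))// ltrDl.
have N0 : 0 < N by rewrite /N ltr_pwDr.
have fN x : x < - N \/ N < x -> f x = 0.
  move=> h; apply: HM; apply: lt_trans MN _; rewrite lter_normr.
  by case: h => h; apply/orP; [right|left]; lra.
have f'N x : x < - N \/ N < x -> derive1 f x = 0.
  move=> h; apply: derive1_is.
  have c0 : is_derive x 1 (fun _ : R => 0 : R) 0 by exact: is_derive_cstx.
  apply: near_eq_is_derive c0.
  case: h => h.
    by near=> y; apply/esym/fN; left; near: y; exact: lt_nbhsl.
  by near=> y; apply/esym/fN; right; near: y; exact: lt_nbhsr.
have e : \int[mu]_(x in `[- (N + 1), N + 1]) k x = 0.
  rewrite -prim_diff//; last by lra.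
  have := derive_off_cst L0 Hc dH (- (N + 1)) (N + 1).
  rewrite /H !fN ?mulr0; [lra|right; lra|left; lra].
apply/eqP; rewrite -addr_eq0; apply/eqP.
rewrite (@integral_supp _ _ (- (N + 1)) (N + 1)); last first.
  by move=> x h; rewrite f'N ?mulr0//; case: h => h; [left|right]; lra.
rewrite (@integral_supp _ (fun x => g x * f x) (- (N + 1)) (N + 1)); last first.
  by move=> x h; rewrite fN ?mulr0//; case: h => h; [left|right]; lra.
by rewrite -RintegralD.
Unshelve. all: by end_near. Qed.

Lemma eigenfunction_eigenvalue L phi lam v v1 : 0 < L -> continuous phi ->
  eigenfunction L phi lam v v1 -> is_eigenvalue L phi lam.
Proof.
move=> L0 cp [[cv cv1] dv [l2v l2v1] [x0 vx0]].
have l2v2 := L2_coef_mul L lam cp l2v.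
exists v, (fun x => coef L phi lam x * v x); split.
- split=> //; exists v1; split => //.
  + apply: (@prim_weak_derivative L) => //; first exact: continuous_loc_int.
      by move=> x _; exact: cv1.
    by move=> x xL; have [] := dv x xL.
  + apply: (@prim_weak_derivative L) => // [|x xL|x xL]; first exact: L2_loc_int.
      by apply: cvgM; [exact: continuous_coef|exact: cv].
    by have [] := dv x xL.
- move=> h; move/eqP: vx0; apply.
  have e := ae_eq_cont cv _ h.
  by rewrite e// => x; exact: cvg_cst.
apply: aeW => x; rewrite /coef; ring.
Qed.

(** Regularity: a weak eigenfunction and its weak derivative are almost everywhere primitives. These
    continuous representatives satisfy the equation pointwise where the coefficient is continuous,
    since almost everywhere equal functions have the same primitive. *)
Lemma eigenvalue_eigenfunction L phi lam : 0 < L -> continuous phi ->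
  is_eigenvalue L phi lam -> exists v v1, eigenfunction L phi lam v v1.
Proof.
move=> L0 cp [v [v2 [[l2v [v1 [l2v1 w1 l2v2 w2]]] nz ev]]].
have lv := L2_loc_int l2v; have lv1 := L2_loc_int l2v1; have lv2 := L2_loc_int l2v2.
have [mv _] := (L2P _).1 l2v; have [mv1 _] := (L2P _).1 l2v1.
have [c0 e0] := weak_derivative_prim mv lv lv1 w1.
have [c1 e1] := weak_derivative_prim mv1 lv1 lv2 w2.
pose u1 x := c1 + prim v2 x; pose u x := c0 + prim v1 x.
have cu1 : continuous u1 by move=> x; apply: cvgD; [exact: cvg_cst|exact: prim_cont].
have pu1 : prim v1 = prim u1 by apply: prim_ae => //; exact: continuous_loc_int.
have du (x : R) : is_derive x 1 u (u1 x).
  rewrite /u pu1; have h := prim_deriv (continuous_loc_int cu1) (cu1 x).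
  by eapply is_derive_eqx; [eapply is_deriveDx; [exact: is_derive_cstx|exact: h]|rewrite add0r].
have cu : continuous u by move=> x; apply: is_derive_cont (du x).
have l2u : L2 u by apply: L2_ae l2v _ e0; exact: continuous_measurable_fun.
have l2u1 : L2 u1 by apply: L2_ae l2v1 _ e1; exact: continuous_measurable_fun.
have lcu : loc_int (fun x => coef L phi lam x * u x) by apply: L2_loc_int; exact: L2_coef_mul.
have pe : prim v2 = prim (fun x => coef L phi lam x * u x).
  apply: prim_ae => //.
  apply: (ae_imp (ae_and e0 ev)) => x [h]; rewrite /coef /u -h => h2.
  by rewrite mulrDl -h2; ring.
exists u, u1; split => //.
- move=> x xL; split => //; rewrite /u1 pe.
  have cc : {for x, continuous (fun x => coef L phi lam x * u x)}.
    by apply: cvgM; [exact: continuous_coef|exact: cu].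
  have h := prim_deriv lcu cc.
  by eapply is_derive_eqx; [eapply is_deriveDx; [exact: is_derive_cstx|exact: h]|rewrite add0r].
- apply: contrapT => /forallNP H; apply: nz.
  by apply: (ae_imp e0) => x ->; apply/eqP; have /negP := H x; rewrite negbK.
Qed.

End Eigenfunction.

(** * Solutions on half-lines, their decay, and gluing at the two edges *)

Section Gluing.
Context {R : realType}.
Notation mu := (@lebesgue_measure R).
Implicit Types (f g u v w q phi : R -> R) (k G dG : R -> R) (L lam a b c C : R).

Definition glue c f g x : R := if x <= c then f x else g x.

Lemma glue_cont c f g : continuous f -> continuous g -> f c = g c ->
  continuous (glue c f g).
Proof.
move=> cf cg e.
(* Written with minimum and maximum, the glued function is a composition of continuous functions,
   without cases near [c]. *)
have -> : glue c f g = fun x => f (Num.min x c) + g (Num.max x c) - f c.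
  apply/funext => x; rewrite /glue; case: (leP x c) => h.
    by rewrite e; ring.
  by ring.
have cmin : continuous (fun x : R => Num.min x c).
  have -> : (fun x : R => Num.min x c) = fun x => (x + c - `|x - c|) / 2.
    by apply/funext => x; rewrite minr_absE.
  move=> x; apply: cvgM; last exact: cvg_cst.
  apply: cvgB; first by apply: cvgD => //; exact: cvg_cst.
  by apply: cvg_norm; apply: cvgB => //; exact: cvg_cst.
have cmax : continuous (fun x : R => Num.max x c).
  have -> : (fun x : R => Num.max x c) = fun x => (x + c + `|x - c|) / 2.
    by apply/funext => x; rewrite maxr_absE.
  move=> x; apply: cvgM; last exact: cvg_cst.
  apply: cvgD; first by apply: cvgD => //; exact: cvg_cst.
  by apply: cvg_norm; apply: cvgB => //; exact: cvg_cst.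
move=> x; apply: cvgB; last exact: cvg_cst.
apply: cvgD.
  by apply: (@continuous_comp _ _ _ (fun x => Num.min x c) f); [exact: cmin|exact: cf].
by apply: (@continuous_comp _ _ _ (fun x => Num.max x c) g); [exact: cmax|exact: cg].
Qed.

Lemma glue_derive_left c f g x d : x < c -> is_derive x 1 f d ->
  is_derive x 1 (glue c f g) d.
Proof.
move=> xc; apply: near_eq_is_derive; near=> y.
by rewrite /glue ifT// ltW//; near: y; exact: lt_nbhsl.
Unshelve. all: by end_near. Qed.

Lemma glue_derive_right c f g x d : c < x -> is_derive x 1 g d ->
  is_derive x 1 (glue c f g) d.
Proof.
move=> xc; apply: near_eq_is_derive; near=> y.
by rewrite /glue ifF//; apply/negbTE; rewrite -ltNge; near: y; exact: lt_nbhsr.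
Unshelve. all: by end_near. Qed.

Definition sq_int_right a f := mu.-integrable `[a, +oo[ (EFin \o (fun x => f x ^+ 2)).

Lemma continuous_sq f : continuous f -> continuous (fun x => f x ^+ 2).
Proof.
move=> cf.
have -> : (fun x => f x ^+ 2) = (fun x => f x * f x) by apply/funext => x; rewrite expr2.
by move=> x; apply: cvgM; exact: cf.
Qed.

Lemma continuous_neg f : continuous f -> continuous (fun x => f (- x)).
Proof.
move=> cf x; apply: (@continuous_comp _ _ _ (fun x => - x) f); last exact: cf.
by apply: cvgN; exact: cvg_id.
Qed.

Lemma L2_tails f a : continuous f -> sq_int_right a f ->
  sq_int_right a (fun x => f (- x)) -> L2 f.
Proof.
move=> cf hr hl; have cf2 := continuous_sq cf.
have mf := continuous_measurable_fun cf.
have mf2 : measurable_fun setT (fun x => f x ^+ 2) by exact: measurable_funX.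
apply/L2P; split => //.
have hl' : mu.-integrable `]-oo, - a] (EFin \o (fun x => f x ^+ 2)).
  apply/integrableP; split.
    by apply/measurable_EFinP; apply: measurable_funTS.
  under eq_integral do rewrite /= ger0_norm ?sqr_ge0//.
  rewrite ge0_integration_by_substitutionNy; last 2 first.
  - exact: continuous_subspaceT.
  - by move=> x _; rewrite sqr_ge0.
  move/integrableP : hl => [_]; apply: le_lt_trans.
  by under [leRHS]eq_integral do rewrite /= ger0_norm ?sqr_ge0//.
have hm : mu.-integrable `[- a, a] (EFin \o (fun x => f x ^+ 2)) by exact: continuous_loc_int.
have i1 := (@integrable_mkcond _ _ R mu _ _ (measurable_itv _)).1 hl'.
have i2 := (@integrable_mkcond _ _ R mu _ _ (measurable_itv _)).1 hm.
have i3 := (@integrable_mkcond _ _ R mu _ _ (measurable_itv _)).1 hr.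
have i123 := integrableD measurableT (integrableD measurableT i1 i2) i3.
(* The three intervals may overlap: an upper bound by the sum of the restrictions is enough. *)
apply: le_integrable i123 => //; first exact/measurable_EFinP.
move=> x _ /=; rewrite !patchE /=.
have h0 : (0 <= (f x ^+ 2)%:E)%E by rewrite lee_fin sqr_ge0.
have -> : (`|f x ^+ 2|%:E = (f x ^+ 2)%:E)%E by rewrite ger0_norm ?sqr_ge0.
rewrite gee0_abs; last by apply: adde_ge0; [apply: adde_ge0|]; case: ifP.
have [h|h] := leP x (- a).
  rewrite mem_set /=; last by rewrite in_itv.
  by rewrite -addeA; apply: leeDl; apply: adde_ge0; case: ifP.
have [h'|h'] := leP x a.
  rewrite (_ : (x \in `[- a, a]%classic) = true); last by rewrite mem_set //= in_itv /= (ltW h).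
  by rewrite addeAC; apply: leeDr; apply: adde_ge0; case: ifP.
rewrite (_ : (x \in `[a, +oo[%classic) = true); last by rewrite mem_set //= in_itv /= (ltW h').
by apply: leeDr; apply: adde_ge0; case: ifP.
Qed.

Lemma bounded_prim_integrable k a C : continuous k -> (forall x, 0 <= k x) ->
  (forall x, a <= x -> prim k x <= C) -> mu.-integrable `[a, +oo[ (EFin \o k).
Proof.
move=> ck k0 HC; have lk := continuous_loc_int ck.
have nd : nondecreasing_fun (prim k).
  by move=> x y xy; rewrite -subr_ge0 prim_diff//; apply: Rintegral_ge0.
have ub : has_ubound (range (prim k)).
  exists C => _ [x _ <-]; have [ax|xa] := leP a x; first exact: HC.
  by apply: le_trans (HC a _) => //; apply: nd; exact: ltW.
have cv := nondecreasing_cvgr nd ub.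
have d x := prim_deriv lk (ck x).
apply/integrableP; split.
  by apply/measurable_EFinP; apply: measurable_funTS; exact: continuous_measurable_fun.
under eq_integral do rewrite /= ger0_norm//.
rewrite (ge0_continuous_FTC2y _ _ cv)//.
- exact: ltry.
- exact: continuous_subspaceT.
- by apply: cvg_at_right_filter; exact: prim_cont.
by move=> x _; apply: derive1_is; exact: d.
Qed.

(** The primitive of [k] minus [G] does not increase, so an upper bound on [G] bounds the primitive
    of [k]. No rate of decay enters. *)
Lemma dominated_integrable_right k G dG a C : continuous k -> (forall x, 0 <= k x) ->
  (forall x, a <= x -> {for x, continuous G}) ->
  (forall x : R, a < x -> is_derive x 1 G (dG x)) ->
  (forall x, a < x -> k x <= dG x) -> (forall x, a <= x -> G x <= C) ->
  mu.-integrable `[a, +oo[ (EFin \o k).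
Proof.
move=> ck k0 cG dGx kG GC; have lk := continuous_loc_int ck.
apply: (@bounded_prim_integrable _ _ (prim k a + C - G a)) => // x ax.
have : G a - prim k a <= G x - prim k x.
  apply: (@derive_ge0_le _ (fun x => G x - prim k x) (fun x => dG x - k x)) => //.
  - by move=> y /andP[ay _]; apply: cvgB; [exact: cG|exact: prim_cont].
  - move=> y /andP[ay _]; apply: is_deriveBx; first exact: dGx.
    by apply: prim_deriv => //; exact: ck.
  - by move=> y /andP[ay _]; rewrite subr_ge0 kG.
have := GC x ax; lra.
Qed.

(* Solutions of [u'' = q u] on [a, +oo[ , given with their derivative [u1]. *)
Definition half_sol q a u u1 : Prop :=
  [/\ continuous u, continuous u1
    & forall x : R, a < x -> is_derive x 1 u (u1 x) /\ is_derive x 1 u1 (q x * u x)].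

(** H^1 near infinity, with no pointwise limit. The quantification over [a] makes the base point
    irrelevant. *)
Definition decaying u u1 : Prop :=
  (forall a, sq_int_right a u) /\ (forall a, sq_int_right a u1).

Lemma sq_int_right_shift f a b : continuous f -> sq_int_right a f -> sq_int_right b f.
Proof.
move=> cf h; have cf2 := continuous_sq cf.
have [ab|ba] := leP a b.
  by apply: integrableS h => //; apply: subset_itvr; rewrite bnd_simp.
have mf2 : measurable_fun setT (fun x => f x ^+ 2).
  by apply: measurable_funX; exact: continuous_measurable_fun.
have hm : mu.-integrable `[b, a] (EFin \o (fun x => f x ^+ 2)) by exact: continuous_loc_int.
have i2 := (@integrable_mkcond _ _ R mu _ _ (measurable_itv _)).1 hm.
have i3 := (@integrable_mkcond _ _ R mu _ _ (measurable_itv _)).1 h.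
have i23 := integrableD measurableT i2 i3.
have i123 := @integrableS _ _ R mu setT `[b, +oo[%classic _ measurableT (measurable_itv _) (@subsetT _ _) i23.
apply: le_integrable i123 => //; first by apply/measurable_EFinP; apply: measurable_funTS.
move=> x; rewrite /= in_itv /= andbT => bx; rewrite !patchE /=.
have h0 : (0 <= (f x ^+ 2)%:E)%E by rewrite lee_fin sqr_ge0.
have -> : (`|f x ^+ 2|%:E = (f x ^+ 2)%:E)%E by rewrite ger0_norm ?sqr_ge0.
rewrite gee0_abs; last by apply: adde_ge0; case: ifP.
have [h'|h'] := leP x a.
  rewrite (_ : (x \in `[b, a]%classic) = true); last by rewrite mem_set //= in_itv /= bx.
  by apply: leeDl; case: ifP.
rewrite (_ : (x \in `[a, +oo[%classic) = true); last by rewrite mem_set //= in_itv /= (ltW h').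
by apply: leeDr; case: ifP.
Qed.

(** (u u')' = u'^2 + q u^2 dominates both u'^2 and dl u^2 beyond [X], so that an upper bound on u u'
    makes both squares integrable. *)
Lemma half_sol_decaying q a u u1 X dl C : half_sol q a u u1 -> 0 < dl -> a <= X ->
  (forall x, X < x -> dl <= q x) -> (forall x, X <= x -> u x * u1 x <= C) ->
  decaying u u1.
Proof.
move=> [cu cu1 du] dl0 aX qd hC.
have cG x : {for x, continuous (fun x => u x * u1 x)} by apply: cvgM; [exact: cu|exact: cu1].
have dG x : X < x -> is_derive x 1 (fun x => u x * u1 x) (u1 x ^+ 2 + q x * u x ^+ 2).
  move=> Xx; have [d1 d2] := du x (le_lt_trans aX Xx).
  by eapply is_derive_eqx; [eapply is_deriveMx; [exact: d1|exact: d2]|ring].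
have k1 : sq_int_right X u1.
  apply: (dominated_integrable_right (continuous_sq cu1) _ (fun x _ => cG x) dG _ hC).
    by move=> x; exact: sqr_ge0.
  move=> x Xx; rewrite lerDl mulr_ge0 ?sqr_ge0//.
  by apply: le_trans (qd x Xx); exact: ltW.
have k2 : sq_int_right X u.
  apply: (@dominated_integrable_right _ (fun x => dl^-1 * (u x * u1 x))
     (fun x => dl^-1 * (u1 x ^+ 2 + q x * u x ^+ 2)) _ (dl^-1 * C) (continuous_sq cu)).
  - by move=> x; exact: sqr_ge0.
  - by move=> x _; apply: cvgM; [exact: cvg_cst|exact: cG].
  - move=> x Xx; have h := dG x Xx.
    by eapply is_derive_eqx; [eapply is_deriveMx; [exact: is_derive_cstx|exact: h]|rewrite mul0r add0r].
  - move=> x Xx; rewrite ler_pdivlMl//.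
    rewrite -[leLHS]add0r lerD ?sqr_ge0// ler_wpM2r ?sqr_ge0//; exact: qd.
  - by move=> x Xx; rewrite ler_wpM2l ?hC// invr_ge0 ltW.
by split => b; [apply: sq_int_right_shift k2|apply: sq_int_right_shift k1].
Qed.

(** The left tail is given by its mirror image [s] on [L, +oo[, whence the sign in w'(-L) = - s'(L).
    All three pieces are continuous on the whole line, so only the values at the two edges have to
    match. *)
Lemma glued_eigenvalue L phi lam r r1 s s1 w w1 : 0 < L -> continuous phi ->
  half_sol (fun x => cos (phi x) + lam) L r r1 -> decaying r r1 ->
  half_sol (fun x => cos (phi (- x)) + lam) L s s1 -> decaying s s1 ->
  continuous w -> continuous w1 ->
  (forall x : R, `|x| < L -> is_derive x 1 w (w1 x) /\ is_derive x 1 w1 (lam * w x)) ->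
  w L = r L -> w1 L = r1 L -> w (- L) = s L -> w1 (- L) = - s1 L ->
  (exists2 x, L < x & r x != 0) \/ (exists2 x, L < x & s x != 0) ->
  is_eigenvalue L phi lam.
Proof.
move=> L0 cp [cr cr1 dr] [r2 r12] [cs cs1 ds] [s2 s12] cw cw1 dw e1 e2 e3 e4 nz.
pose v := glue (- L) (fun x => s (- x)) (glue L w r).
pose v1 := glue (- L) (fun x => - s1 (- x)) (glue L w1 r1).
have mLL : - L < L by lra.
have cns1 : continuous (fun x => - s1 (- x)).
  by move=> x; apply: cvgN; exact: (continuous_neg cs1).
have cv : continuous v.
  apply: glue_cont; [exact: continuous_neg|exact: glue_cont|].
  by rewrite /glue opprK ifT ?e3// ltW.
have cv1 : continuous v1.
  apply: glue_cont; [exact: cns1|exact: glue_cont|].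
  by rewrite /glue opprK ifT ?e4// ltW.
have vr x : L < x -> v x = r x /\ v1 x = r1 x.
  move=> Lx; rewrite /v /v1 /glue.
  have -> : (x <= - L) = false by apply/negbTE; rewrite -ltNge; lra.
  by have -> : (x <= L) = false by apply/negbTE; rewrite -ltNge.
have vm x : - L < x -> x <= L -> v x = w x /\ v1 x = w1 x.
  move=> Lx xL; rewrite /v /v1 /glue.
  have -> : (x <= - L) = false by apply/negbTE; rewrite -ltNge; lra.
  by rewrite xL.
have vl x : x <= - L -> v x = s (- x) /\ v1 x = - s1 (- x).
  by move=> Lx; rewrite /v /v1 /glue Lx.
apply: (@eigenfunction_eigenvalue _ L phi lam v v1) => //; split => //.
- move=> x xL.
  have [h|h] : `|x| < L \/ L < `|x| by apply/orP; rewrite -neq_lt.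
    have := h; rewrite ltr_norml => /andP[x1 x2]; have [d1 d2] := dw x h.
    have [-> ->] := vm x x1 (ltW x2); rewrite /coef D_in// mul0r add0r.
    by split; apply: glue_derive_right => //; apply: glue_derive_left.
  rewrite /coef D_out ?(ltW h)// mul1r.
  move: h; rewrite lter_normr => /orP[h|h].
    have [-> ->] := vr x h; have [d1 d2] := dr x h.
    by split; apply: glue_derive_right; (try lra); apply: glue_derive_right.
  have xl : x < - L by lra.
  have [-> ->] := vl x (ltW xl); have [d1 d2] := ds (- x) h; rewrite opprK in d2.
  have dn : is_derive x 1 (fun x => - x) (- 1 : R) by deriv.
  split; apply: glue_derive_left => //.
    by apply: (is_derive_eqx (is_derive_compx dn d1)); ring.
  by apply: (is_derive_eqx (is_deriveNx (is_derive_compx dn d2))); ring.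
- have iL : mu.-integrable `[L + 1, +oo[ (EFin \o (fun x => r x ^+ 2)) by exact: r2.
  split.
    apply: (@L2_tails _ (L + 1)) => //.
      apply: eq_integrable (r2 (L + 1)) => // x; rewrite inE /= in_itv /= andbT => h.
      by have [|-> _] := vr x; [lra|].
    apply: eq_integrable (s2 (L + 1)) => // x; rewrite inE /= in_itv /= andbT => h.
    by have [|-> _] := vl (- x); [lra|rewrite opprK].
  apply: (@L2_tails _ (L + 1)) => //.
    apply: eq_integrable (r12 (L + 1)) => // x; rewrite inE /= in_itv /= andbT => h.
    by have [|_ ->] := vr x; [lra|].
  apply: eq_integrable (s12 (L + 1)) => // x; rewrite inE /= in_itv /= andbT => h.
  by have [|_ ->] := vl (- x); [lra|rewrite opprK sqrrN].
case: nz => [[x Lx nx]|[x Lx nx]].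
  by exists x; have [-> _] := vr x Lx.
by exists (- x); have [|-> _] := vl (- x); [lra|rewrite opprK].
Qed.

End Gluing.

(** * Picard iteration *)

Section Picard.
Context {R : realType}.
Implicit Types (f g h y : R -> R) (x : R).

(** [h] is convex with critical point 0, so its minimum is at 0. *)
Lemma convex_min_ge0 h h1 h2 : (forall x : R, is_derive x 1 h (h1 x)) ->
  (forall x : R, is_derive x 1 h1 (h2 x)) -> (forall x, 0 <= h2 x) -> h1 0 = 0 ->
  0 <= h 0 -> forall x, 0 <= h x.
Proof.
move=> d1 d2 h20 h10 h0 x.
have c1 (z : R) : {for z, continuous h1} by exact: is_derive_cont (d2 z).
have c0 (z : R) : {for z, continuous h} by exact: is_derive_cont (d1 z).
apply: le_trans h0 _; have [x0|x0] := leP 0 x.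
  apply: (@derive_ge0_le _ h h1) => // z /andP[z0 _]; rewrite -h10.
  by apply: (@derive_ge0_le _ h1 h2) => //; exact: ltW.
apply: (@derive_le0_le _ h h1) => // [|z /andP[_ z0]]; first exact: ltW.
by rewrite -h10; apply: (@derive_ge0_le _ h1 h2) => //; exact: ltW.
Qed.

Lemma half_pow_small (C e : R) : 0 < e -> exists n : nat, C * 2^-1 ^+ n < e.
Proof.
move=> e0; have [n hn] : exists n : nat, `|C| / e < n%:R.
  by exists (Num.bound (`|C| / e)); apply: archi_boundP; rewrite divr_ge0// ltW.
exists n; rewrite exprVn ltr_pdivrMr ?exprn_gt0//.
apply: le_lt_trans (ler_norm C) _; rewrite -ltr_pdivrMl// mulrC.
by apply: lt_trans hn _; rewrite -natrX ltr_nat ltn_expl.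
Qed.

Section Iteration.
Variables (F : R -> R -> R) (K B al be : R).
Hypothesis K0 : 0 < K.
Hypothesis FL : forall x u v, `|F x u - F x v| <= K * `|u - v|.
Hypothesis FB : forall x, `|F x 0| <= B.
Hypothesis FC : forall y, continuous y -> continuous (fun x => F x (y x)).

Let T y x := al + be * x + prim (prim (fun s => F s (y s))) x.
Let Y n := iter n T (fun=> 0).

(* A weight with [w'' >= 2 K w], for which the integral operator is a contraction. *)
Let m := 2 * K + 1.
Let m0 : 0 < m. Proof. by rewrite /m addr_gt0// mulr_gt0. Qed.
Let w x := expR (m * x) + expR (- m * x).
Let w1 x := m * (expR (m * x) - expR (- m * x)).

Let dw (x : R) : is_derive x 1 w (w1 x).
Proof. by rewrite /w /w1; deriv; ring. Qed.

Let dw1 (x : R) : is_derive x 1 w1 (m ^+ 2 * w x).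
Proof. by rewrite /w /w1; deriv; ring. Qed.

Let w_ge1 x : 1 <= w x.
Proof.
rewrite /w; have [x0|x0] := leP 0 x.
  by rewrite -[1]addr0 lerD ?expR_ge0// -expR0 ler_expR mulr_ge0// ltW.
rewrite -[1]add0r lerD ?expR_ge0// -expR0 ler_expR mulNr -mulrN.
by rewrite mulr_ge0 ?oppr_ge0// ltW.
Qed.

Let w_geM x : m * `|x| <= w x.
Proof.
rewrite /w; abs_case x.
  have := expR_ge1Dx (m * x); have := expR_ge0 (- m * x); lra.
have := expR_ge1Dx (- m * x); have := expR_ge0 (m * x); lra.
Qed.

Let m2 : 2 * K <= m ^+ 2.
Proof. by rewrite /m; nra. Qed.

Let Tcont y : continuous y -> [/\ continuous (fun s => F s (y s)),
  continuous (prim (fun s => F s (y s))) & continuous (T y)].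
Proof.
move=> cy; have c1 := FC cy.
have c2 : continuous (prim (fun s => F s (y s))).
  by apply: prim_cont; exact: continuous_loc_int.
split => // x; apply: cvgD; last by apply: prim_cont; exact: continuous_loc_int.
by apply: cvgD; [exact: cvg_cst|apply: cvgM; [exact: cvg_cst|exact: cvg_id]].
Qed.

Let dP y x : continuous y ->
  is_derive x 1 (prim (prim (fun s => F s (y s)))) (prim (fun s => F s (y s)) x) /\
  is_derive x 1 (prim (fun s => F s (y s))) (F x (y x)).
Proof.
move=> cy; have [c1 c2 c3] := Tcont cy.
by split; apply: prim_deriv; [exact: continuous_loc_int|exact: c2|
  exact: continuous_loc_int|exact: c1].
Qed.

(** The functions C w + F and C w - F, where F is the double primitive of [f], are convex because
    w'' = m^2 w; both have their minimum at 0, where they are nonnegative. *)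
Let prim2_le f C : continuous f -> 0 <= C -> (forall x, `|f x| <= C * m ^+ 2 * w x) ->
  forall x, `|prim (prim f) x| <= C * w x.
Proof.
move=> cf C0 fC x.
have cp : continuous (prim f) by apply: prim_cont; exact: continuous_loc_int.
have d1 (z : R) : is_derive z 1 (prim (prim f)) (prim f z).
  by apply: prim_deriv; [exact: continuous_loc_int|exact: cp].
have d2 (z : R) : is_derive z 1 (prim f) (f z).
  by apply: prim_deriv; [exact: continuous_loc_int|exact: cf].
have w10 : w1 0 = 0 by rewrite /w1 !mulr0 subrr mulr0.
have key (s : R) : s ^+ 2 = 1 -> 0 <= C * w x + s * prim (prim f) x.
  move=> s2; pose h z := C * w z + s * prim (prim f) z.
  pose h1 z := C * w1 z + s * prim f z; pose h2 z := C * (m ^+ 2 * w z) + s * f z.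
  have dh (z : R) : is_derive z 1 h (h1 z) by rewrite /h; deriv; rewrite /h1; ring.
  have dh1 (z : R) : is_derive z 1 h1 (h2 z) by rewrite /h1; deriv; rewrite /h2; ring.
  apply: (convex_min_ge0 dh dh1).
  - move=> z; rewrite /h2 -lerBlDr sub0r; apply: le_trans (ler_norm _) _.
    rewrite normrN normrM -(ger0_norm (ler01 : 0 <= 1 :> R)) in s2 *.
    suff -> : `|s| = 1 by rewrite mul1r mulrA fC.
    by apply/eqP; rewrite -(@eqrXn2 _ 2)// ?expr1n -?normrX ?s2 ?normr1.
  - by rewrite /h1 prim0 w10 !mulr0 addr0.
  - by rewrite /h prim0 mulr0 addr0 mulr_ge0// (le_trans _ (w_ge1 0)).
have k1 := key 1 (expr1n _ _); have k2 := key (-1) (sqrr_sign _ 1).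
by rewrite ler_norml; apply/andP; split; lra.
Qed.

Let prim2B f g x : continuous f -> continuous g ->
  prim (prim f) x - prim (prim g) x = prim (prim (fun s => f s - g s)) x.
Proof.
move=> cf cg.
have key (f1 g1 h1 : R -> R) : continuous f1 -> continuous g1 -> continuous h1 ->
    (forall z : R, f1 z - g1 z = h1 z) -> forall z : R, prim f1 z - prim g1 z = prim h1 z.
  move=> c1 c2 c3 e z.
  pose G (z : R) := prim f1 z - prim g1 z - prim h1 z.
  have d (t : R) : is_derive t 1 G 0.
    have q1 := prim_deriv (continuous_loc_int c1) (c1 t).
    have q2 := prim_deriv (continuous_loc_int c2) (c2 t).
    have q3 := prim_deriv (continuous_loc_int c3) (c3 t).
    have q := is_deriveBx (is_deriveBx q1 q2) q3.
    by apply: (is_derive_eqx q); rewrite e subrr.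
  have cG (t : R) : {for t, continuous G} := is_derive_cont (d t).
  have G0 : G 0 = 0 by rewrite /G !prim0 !subr0.
  have Gz : G z = G 0.
    have [hz|hz] := leP 0 z.
      by apply/esym; exact: (derive_0_eq hz (fun t _ => cG t) (fun t _ => d t)).
    exact: (derive_0_eq (ltW hz) (fun t _ => cG t) (fun t _ => d t)).
  by move: Gz; rewrite G0 /G => /eqP; rewrite subr_eq0 => /eqP.
have cp (h1 : R -> R) : continuous h1 -> continuous (prim h1).
  by move=> c; apply: prim_cont; exact: continuous_loc_int.
have cfg : continuous (fun s => f s - g s) by move=> t; apply: cvgB; [exact: cf|exact: cg].
by apply: (key (prim f) (prim g)); do ?exact: cp; exact: key.
Qed.

(** K C w is at most (C / 2) m^2 w because 2 K is at most m^2; this gives the factor one half. *)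
Let contr y (z : R -> R) C : continuous y -> continuous z -> 0 <= C ->
  (forall x, `|y x - z x| <= C * w x) -> forall x, `|T y x - T z x| <= C / 2 * w x.
Proof.
move=> cy cz C0 h x.
have -> : T y x - T z x = prim (prim (fun s => F s (y s) - F s (z s))) x.
  by rewrite -(prim2B _ (FC cy) (FC cz)) /T opprD addrACA subrr add0r.
apply: prim2_le; last 1 first.
- move=> t; apply: le_trans (FL _ _ _) _.
  have h1 := h t; have w0 : 0 <= w t by rewrite (le_trans _ (w_ge1 t)).
  have h2 : K * `|y t - z t| <= K * (C * w t) by rewrite ler_wpM2l// ltW.
  have h3 : 2 * K * (C * w t) <= m ^+ 2 * (C * w t) by rewrite ler_wpM2r ?mulr_ge0.
  lra.
- by move=> t; apply: cvgB; [exact: (FC cy)|exact: (FC cz)].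
by rewrite divr_ge0.
Qed.

Let Ycont n : continuous (Y n).
Proof.
elim: n => [|n IH]; first by move=> x; exact: cvg_cst.
by have [] := Tcont IH.
Qed.

Lemma picard0 : exists y y1 : R -> R,
  [/\ forall x : R, is_derive x 1 y (y1 x), forall x : R, is_derive x 1 y1 (F x (y x)),
      y 0 = al & y1 0 = be].
Proof.
have B0 : 0 <= B by apply: le_trans (FB 0).
pose C := `|al| + `|be| / m + B / m ^+ 2.
have C0 : 0 <= C by rewrite /C !addr_ge0 ?divr_ge0// ?sqr_ge0 ?ltW.
have c0 : continuous (fun _ : R => 0 : R) by move=> x; exact: cvg_cst.
have init x : `|Y 1 x - Y 0 x| <= C * w x.
  rewrite /= subr0 /T.
  have h1 : `|prim (prim (fun s => F s 0)) x| <= B / m ^+ 2 * w x.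
    apply: prim2_le; first exact: (FC c0).
      by rewrite divr_ge0 ?sqr_ge0.
    move=> t; rewrite divfK ?expf_neq0 ?gt_eqF//.
    by apply: le_trans (FB t) _; rewrite ler_peMr// w_ge1.
  have h2 : `|be * x| <= `|be| / m * w x.
    by rewrite normrM -mulrA ler_wpM2l// ler_pdivlMl// w_geM.
  have h3 : `|al| <= `|al| * w x by rewrite ler_peMr// w_ge1.
  apply: le_trans (ler_normD _ _) _; apply: le_trans (lerD (ler_normD _ _) (lexx _)) _.
  by rewrite /C !mulrDl !lerD.
have step n x : `|Y n.+1 x - Y n x| <= C * 2^-1 ^+ n * w x.
  elim: n x => [|n IH] x; first by rewrite expr0 mulr1.
  have -> : C * 2^-1 ^+ n.+1 = (C * 2^-1 ^+ n) / 2 by rewrite exprSr mulrA.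
  by apply: (contr (@Ycont n.+1) (@Ycont n)) => //; rewrite mulr_ge0// exprn_ge0// invr_ge0.
(* The steps sum to at most 2 C 2^-n w from rank n on; hence [lo] increases, [hi] decreases, and the
   limit is the supremum of the lower bounds. *)
pose lo n x := Y n x - 2 * C * 2^-1 ^+ n * w x.
pose hi n x := Y n x + 2 * C * 2^-1 ^+ n * w x.
have half n x : C * 2^-1 ^+ n.+1 * w x = C * 2^-1 ^+ n * w x / 2 by rewrite exprS; field.
have loS n x : lo n x <= lo n.+1 x.
  rewrite /lo; have := step n x; rewrite ler_norml => /andP[]; have := half n x; lra.
have hiS n x : hi n.+1 x <= hi n x.
  rewrite /hi; have := step n x; rewrite ler_norml => /andP[]; have := half n x; lra.
have loh n x : lo n x <= hi n x.
  rewrite /lo /hi lerD2l ge0_cp// !mulr_ge0// ?exprn_ge0// ?invr_ge0//.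
  by rewrite (le_trans _ (w_ge1 x)).
have mono_lo x : {homo (fun n => lo n x) : i j / (i <= j)%N >-> i <= j}.
  by apply: homo_leq => // ? ? ?; exact: le_trans.
have mono_hi i j x : (i <= j)%N -> hi j x <= hi i x.
  move=> ij; rewrite -lerN2.
  have H : {homo (fun n => - hi n x) : i j / (i <= j)%N >-> i <= j}.
    by apply: homo_leq => // [? ? ?|n]; rewrite ?lerN2; [exact: le_trans|exact: hiS].
  exact: H.
have lohi i j x : lo i x <= hi j x.
  have [ij|ji] := leqP i j.
    exact: le_trans (mono_lo x _ _ ij) (loh _ _).
  exact: le_trans (loh _ _) (mono_hi _ _ x (ltnW ji)).
pose y x := sup (range (fun n => lo n x)).
have ylo n x : lo n x <= y x.
  apply: ub_le_sup; last by exists n.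
  by exists (hi 0 x) => _ [k _ <-]; exact: lohi.
have yhi n x : y x <= hi n x.
  apply: ge_sup; first by exists (lo 0 x), 0%N.
  by move=> _ [k _ <-]; exact: lohi.
have yY n x : `|y x - Y n x| <= 2 * C * 2^-1 ^+ n * w x.
  by rewrite ler_norml; have := ylo n x; have := yhi n x; rewrite /lo /hi => ? ?; apply/andP; split; lra.
have cw : continuous w by move=> x; exact: is_derive_cont (dw x).
have cy : continuous y.
  move=> x; apply/cvgrPdist_lt => e e0.
  have [n hn] := half_pow_small (2 * C * (w x + 1)) (e := e / 3) ltac:(lra).
  have [d1 d10 hd1] : exists2 d, 0 < d & forall z : R, `|x - z| < d -> `|w x - w z| < 1.
    by have /cvgrPdist_lt /(_ 1 ltr01) [d /= d0 H] := @cw x; exists d.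
  have [d2 d20 hd2] : exists2 d, 0 < d & forall z : R, `|x - z| < d -> `|Y n x - Y n z| < e / 3.
    have e3 : 0 < e / 3 by lra.
    by have /cvgrPdist_lt /(_ _ e3) [d /= d0 H] := @Ycont n x; exists d.
  exists (Num.min d1 d2); first by rewrite /= lt_min d10.
  move=> z /=; rewrite lt_min => /andP[z1 z2].
  have b t : w t <= w x + 1 -> `|y t - Y n t| < e / 3.
    move=> ht; apply: le_lt_trans (yY n t) _; apply: le_lt_trans hn.
    have p0 : 0 <= 2 * C * 2^-1 ^+ n by rewrite !mulr_ge0// exprn_ge0// invr_ge0.
    have := ler_wpM2l p0 ht; lra.
  have b1 : `|y x - Y n x| < e / 3 by apply: b; rewrite lerDl.
  have b2 : `|y z - Y n z| < e / 3.
    by apply: b; have := hd1 z z1; rewrite ltr_norml => /andP[]; lra.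
  have b3 := hd2 z z2.
  exact: dist_thirds b1 b3 b2.
have fixT x : y x = T y x.
  apply/eqP; rewrite -subr_eq0 -normr_le0; apply/ler_addgt0Pr => e e0; rewrite add0r.
  have [n hn] := half_pow_small (2 * C * w x) (e := e) ltac:(lra).
  have h1 := yY n.+1 x.
  have h2 : `|T y x - T (Y n) x| <= 2 * C * 2^-1 ^+ n / 2 * w x.
    by apply: contr => //; rewrite !mulr_ge0// exprn_ge0// invr_ge0.
  have -> : y x - T y x = (y x - Y n.+1 x) - (T y x - T (Y n) x).
    by rewrite opprB addrA subrK.
  apply: le_trans (ler_normB _ _) _; apply: le_trans (lerD h1 h2) _.
  have -> : 2 * C * 2^-1 ^+ n.+1 * w x + 2 * C * 2^-1 ^+ n / 2 * w x =
      2 * C * w x * 2^-1 ^+ n.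
    by rewrite exprS; move: (2^-1 ^+ n : R) (w x) => p q; field.
  exact: ltW.
(* The fixed point is returned as T y, a double primitive whose derivatives are explicit. *)
exists (fun x => T y x), (fun x => be + prim (fun s => F s (y s)) x); split.
- move=> x; have [d1 d2] := dP x cy; rewrite /T.
  by deriv; ring.
- move=> x; have [d1 d2] := dP x cy; rewrite -fixT.
  by eapply is_derive_eqx; [eapply is_deriveDx; [exact: is_derive_cstx|exact: d2]|rewrite add0r].
- by rewrite /T prim0; ring.
- by rewrite prim0 addr0.
Qed.

End Iteration.

Lemma picard (F : R -> R -> R) (K B a al be : R) : 0 < K ->
  (forall x u v, `|F x u - F x v| <= K * `|u - v|) ->
  (forall x, `|F x 0| <= B) ->
  (forall y, continuous y -> continuous (fun x => F x (y x))) ->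
  exists y y1 : R -> R,
  [/\ forall x : R, is_derive x 1 y (y1 x), forall x : R, is_derive x 1 y1 (F x (y x)),
      y a = al & y1 a = be].
Proof.
move=> K0 FL FB FC.
have tr (b : R) : continuous (fun x : R => x + b).
  by move=> x; apply: cvgD; [exact: cvg_id|exact: cvg_cst].
have [|||y [y1 [d1 d2 e1 e2]]] := @picard0 (fun x => F (x + a)) K B al be K0.
- by move=> x u v; exact: FL.
- by move=> x; exact: FB.
- move=> y cy.
  have c1 : continuous (fun x => y (x + - a)).
    by move=> x; apply: (@continuous_comp _ _ _ (fun x => x + - a) y); [exact: tr|exact: cy].
  have c2 := FC _ c1.
  have -> : (fun x => F (x + a) (y x)) = (fun x => (fun z => F z (y (z + - a))) (x + a)).
    by apply/funext => x /=; rewrite addrK.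
  move=> x; apply: (@continuous_comp _ _ _ (fun x => x + a) (fun z : R => F z (y (z - a)))); first exact: tr.
  exact: c2.
have ds (x : R) : is_derive x 1 (fun x => x - a) (1 : R) by deriv; rewrite subr0.
exists (fun x => y (x - a)), (fun x => y1 (x - a)); split.
- by move=> x; apply: (is_derive_eqx (is_derive_compx (ds x) (d1 _))); rewrite mulr1.
- move=> x; apply: (is_derive_eqx (is_derive_compx (ds x) (d2 _))).
  by rewrite mulr1 subrK.
- by rewrite subrr.
- by rewrite subrr.
Qed.

End Picard.

(** * Phase plane of the pendulum *)

Section PhasePlane.
Context {R : realType}.
Implicit Types (f u e : R -> R) (g l a x y : R).

(** exp(-K x) e does not increase to the right of [x0], and exp(K x) e does not decrease to the left
    of it; both vanish at [x0], and [e] is nonnegative. *)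
Lemma gronwall_zero e (de : R -> R) a K x0 : (forall x, a <= x -> {for x, continuous e}) ->
  (forall x : R, a < x -> is_derive x 1 e (de x)) ->
  (forall x, a < x -> `|de x| <= K * e x) -> (forall x, a <= x -> 0 <= e x) ->
  a <= x0 -> e x0 = 0 -> forall x, a <= x -> e x = 0.
Proof.
move=> ce dex bd e0 ax0 ex0 x ax.
have expc (k y : R) : {for y, continuous (fun y => expR (k * y))}.
  have h : is_derive y 1 (fun y => expR (k * y)) (expR (k * y) * k) by deriv; ring.
  exact: is_derive_cont h.
have dexp (k y : R) : a < y -> is_derive y 1 (fun y => expR (k * y) * e y)
    (expR (k * y) * (k * e y + de y)).
  by move=> ay; have d := dex y ay; deriv; ring.
have cexp (k y : R) : a <= y -> {for y, continuous (fun y => expR (k * y) * e y)}.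
  by move=> ay; apply: cvgM; [exact: expc|exact: ce].
apply/eqP; rewrite eq_le e0// andbT.
have [xx0|xx0] := leP x0 x.
  have : expR (- K * x) * e x <= expR (- K * x0) * e x0.
    apply: (@derive_le0_le _ (fun y => expR (- K * y) * e y) (fun y => expR (- K * y) * (- K * e y + de y))); first exact: xx0.
    - by move=> y /andP[y0 _]; apply: cexp; exact: le_trans y0.
    - by move=> y /andP[y0 _]; apply: dexp; exact: le_lt_trans y0.
    move=> y /andP[y0 _]; rewrite pmulr_rle0 ?expR_gt0//.
    have := bd y (le_lt_trans ax0 y0); rewrite ler_norml => /andP[_]; lra.
  by rewrite ex0 mulr0 pmulr_rle0 ?expR_gt0.
have : expR (K * x) * e x <= expR (K * x0) * e x0.
  apply: (@derive_ge0_le _ (fun y => expR (K * y) * e y) (fun y => expR (K * y) * (K * e y + de y))) => //.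
  - exact: ltW.
  - by move=> y /andP[y0 _]; apply: cexp; exact: le_trans y0.
  - by move=> y /andP[y0 _]; apply: dexp; exact: le_lt_trans y0.
  move=> y /andP[y0 _]; rewrite pmulr_rge0 ?expR_gt0//.
  have := bd y (le_lt_trans ax y0); rewrite ler_norml => /andP[+ _]; lra.
by rewrite ex0 mulr0 pmulr_rle0 ?expR_gt0.
Qed.

Lemma sin_sub_le (x y : R) : `|sin x - sin y| <= `|x - y|.
Proof.
wlog xy : x y / x <= y.
  move=> H; have [xy|yx] := leP x y; first exact: H.
  by rewrite distrC (distrC x); apply: H; exact: ltW.
have [->|ne] := eqVneq x y; first by rewrite !subrr.
have lt : x < y by rewrite lt_neqAle ne.
have [t _|c [_ e]] := @mean_value R sin cos x y lt; first exact: continuous_sin.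
by rewrite distrC (distrC x) e normrM ler_piMl// cos_max.
Qed.

(* Orbits of [u'' = sin u - g] on [a, +oo[ , with [u1] the derivative of [u]. *)
Definition orbit g a u (u1 : R -> R) : Prop :=
  [/\ continuous u, continuous u1
    & forall x : R, a < x -> is_derive x 1 u (u1 x) /\ is_derive x 1 u1 (sin (u x) - g)].

(** The potential of the pendulum: the equation is u'' = - V'(u). *)
Definition V g x : R := cos x + g * x.

Definition energy g u (u1 : R -> R) x : R := u1 x ^+ 2 / 2 + V g (u x).

Lemma is_derive_V g x : is_derive x 1 (V g) (g - sin x).
Proof. by rewrite /V; deriv; ring. Qed.

Lemma continuous_V g : continuous (V g).
Proof. by move=> x; exact: is_derive_cont (is_derive_V g x). Qed.

Lemma continuous_comp_V g u : continuous u -> continuous (fun x => V g (u x)).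
Proof.
by move=> cu x; apply: (@continuous_comp _ _ _ u (V g)); [exact: cu|exact: continuous_V].
Qed.

Lemma energy_cst g a u u1 x y : orbit g a u u1 -> a <= x -> a <= y ->
  energy g u u1 x = energy g u u1 y.
Proof.
move=> [cu cu1 d].
have cE (z : R) : {for z, continuous (energy g u u1)}.
  apply: cvgD; last exact: continuous_comp_V.
  apply: cvgM; last exact: cvg_cst.
  by apply: (@continuous_comp _ _ _ u1 (fun y => y ^+ 2)); [exact: cu1|exact: exprn_continuous].
have dE (z : R) : a < z -> is_derive z 1 (energy g u u1) 0.
  move=> az; have [d1 d2] := d z az.
  have d3 := is_derive_compx d1 (is_derive_V g (u z)).
  by rewrite /energy; deriv; field.
wlog xy : x y / x <= y.
  by move=> H ax ay; case: (leP x y) => [xy|/ltW yx]; [exact: H|apply/esym/H].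
move=> ax ay; apply: derive_0_eq => // z /andP[xz _]; apply: dE; exact: le_lt_trans xz.
Qed.

(** Uniqueness at an equilibrium, by the Gronwall lemma for the squared distance to (l, 0) in the
    phase plane. *)
Lemma orbit_equilibrium g a u u1 l x0 : orbit g a u u1 -> sin l = g -> a <= x0 ->
  u x0 = l -> u1 x0 = 0 -> forall x, a <= x -> u x = l /\ u1 x = 0.
Proof.
move=> [cu cu1 d] sl ax0 e0 e1 x ax.
pose e y := (u y - l) ^+ 2 + u1 y ^+ 2.
have : e x = 0.
  apply: (@gronwall_zero e (fun y => 2 * (u y - l) * u1 y + 2 * u1 y * (sin (u y) - g)) a 2 x0) => //.
  - move=> y _; rewrite /e; apply: cvgD.
      apply: (@continuous_comp _ _ _ (fun y => u y - l) (fun y => y ^+ 2)); last exact: exprn_continuous.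
      by apply: cvgB; [exact: cu|exact: cvg_cst].
    by apply: (@continuous_comp _ _ _ u1 (fun y => y ^+ 2)); [exact: cu1|exact: exprn_continuous].
  - by move=> y ay; have [d1 d2] := d y ay; rewrite /e; deriv; ring.
  - move=> y ay; have := sin_sub_le (u y) l; rewrite sl => h.
    apply: le_trans (ler_normD _ _) _; rewrite !normrM !(@ger0_norm _ 2)//.
    have := real_normK (num_real (u y - l)); have := real_normK (num_real (u1 y)).
    have := normr_ge0 (u1 y); have := normr_ge0 (u y - l); have := normr_ge0 (sin (u y) - g).
    rewrite /e; move: (`|u y - l|) (`|u1 y|) (`|sin (u y) - g|) h => p q r h r0 p0 q0 <- <-.
    by have := sqr_ge0 (p - q); nra.
  - by move=> y _; rewrite /e addr_ge0// sqr_ge0.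
  - by rewrite /e e0 e1 subrr !expr0n addr0.
move=> /eqP; rewrite /e paddr_eq0 ?sqr_ge0// !sqrf_eq0 subr_eq0.
by move=> /andP[/eqP -> /eqP ->].
Qed.

Lemma cvgy_dist f l : f x @[x --> +oo] --> l -> forall eps, 0 < eps ->
  exists M, forall x, M <= x -> `|f x - l| < eps.
Proof.
move=> /cvgrPdist_lt h eps e0; have [M [_ H]] := h eps e0.
exists (M + 1) => x Mx; rewrite distrC; apply: H.
by apply: lt_le_trans Mx; rewrite ltrDl.
Qed.

Lemma cvgy_const (c l : R) f a : (forall x, a <= x -> f x = c) -> f x @[x --> +oo] --> l -> l = c.
Proof.
move=> h fl; apply: contrapT => /eqP lc.
have [|M HM] := cvgy_dist fl (eps := `|c - l|); first by rewrite normr_gt0 subr_eq0 eq_sym.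
have := HM (Num.max M a); rewrite le_max lexx => /(_ isT).
by rewrite h ?ltxx// le_max lexx orbT.
Qed.

Lemma continuous_at_dist f x : {for x, continuous f} -> forall eps, 0 < eps ->
  exists2 d, 0 < d & forall y, `|y - x| < d -> `|f y - f x| < eps.
Proof.
move=> /cvgrPdist_lt h eps e0; have [d /= d0 H] := h eps e0.
by exists d => // y yd; rewrite distrC; apply: H; rewrite /= distrC.
Qed.

(* Over an interval of length one, [u] varies by a value of [u1] and [u1] by a
   value of [sin u - g]; hence both tend to zero. *)
Lemma orbit_limit g a u u1 l : orbit g a u u1 -> u x @[x --> +oo] --> l ->
  sin l = g /\ forall x, a <= x -> energy g u u1 x = V g l.
Proof.
move=> o ul; have [cu cu1 d] := o.
have incr f (df : R -> R) x : continuous f -> (forall x : R, a < x -> is_derive x 1 f (df x)) ->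
    a <= x -> exists2 c, x <= c <= x + 1 & f (x + 1) - f x = df c.
  move=> cf dfx ax; have xx : x < x + 1 by lra.
  have [y _|y /andP[xy _]|c [/andP[c1 c2] e]] := @mean_value R f df x (x + 1) xx.
  - exact: cf.
  - by apply: dfx; exact: le_lt_trans xy.
  by exists c; [rewrite !ltW|rewrite e; ring].
have E x : a <= x -> energy g u u1 x = V g l.
  move=> ax; apply/eqP; rewrite -subr_eq0 -normr_le0; apply/ler_addgt0Pr => eps eps0.
  rewrite add0r.
  have [d1 d10 H1] := continuous_at_dist (@continuous_V g l) (eps := eps / 2) ltac:(lra).
  (* From |u1 c| <= 2 t with t <= 1/2 and t <= eps/2, the kinetic energy is at most 2 t^2 <=
     eps/2. *)
  pose t := Num.min d1 (Num.min 1 eps / 2).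
  have t0 : 0 < t by rewrite lt_min d10 divr_gt0// lt_min ltr01.
  have [M HM] := cvgy_dist ul t0.
  pose z := Num.max M (Num.max a x).
  have az : a <= z by rewrite !le_max lexx orbT.
  have Mz : M <= z by rewrite le_max lexx.
  have [c /andP[zc c1] ec] := incr u u1 z cu (fun x h => (d x h).1) az.
  have Mz1 : M <= z + 1 by rewrite ler_wpDr.
  have h1 := HM z Mz; have h2 := HM (z + 1) Mz1; have h3 := HM c (le_trans Mz zc).
  rewrite (@energy_cst g a u u1 x c)//; last by exact: le_trans zc.
  have h4 : `|V g (u c) - V g l| < eps / 2.
    by apply: H1; apply: lt_le_trans h3 _; rewrite ge_min lexx.
  have h5 : t <= 1 / 2 /\ t <= eps / 2.
    by split; rewrite /t ge_min; apply/orP; right; rewrite ler_pM2r// ge_min lexx ?orbT.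
  have h6 : `|u1 c| <= 2 * t.
    rewrite -ec; have -> : u (z + 1) - u z = (u (z + 1) - l) - (u z - l) by ring.
    by apply: le_trans (ler_normB _ _) _; clear -h1 h2; lra.
  have h7 : u1 c ^+ 2 / 2 <= eps / 2.
    have := real_normK (num_real (u1 c)); have := normr_ge0 (u1 c).
    by move: h5 h6 => [] i1 i2 i3; clear -i1 i2 i3; nra.
  have h8 := sqr_ge0 (u1 c).
  rewrite /energy; move: h4; rewrite ltr_norml => /andP[i1 i2]; rewrite ler_norml.
  by clear -h7 h8 i1 i2; apply/andP; split; lra.
split => //.
apply/eqP; rewrite -subr_eq0 -normr_le0; apply/ler_addgt0Pr => eps eps0; rewrite add0r.
have [d1 d10 H1] := continuous_at_dist (@continuous_sin R l) (eps := eps / 2) ltac:(lra).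
(* A potential within (eps/4)^2 / 2 of its limit forces |u1| <= eps/4, by energy conservation. *)
have eps2 : 0 < (eps / 4) ^+ 2 / 2 by rewrite divr_gt0// exprn_gt0// divr_gt0.
have [d2 d20 H2] := continuous_at_dist (@continuous_V g l) eps2.
pose t := Num.min d1 d2.
have t0 : 0 < t by rewrite lt_min d10.
have [M HM] := cvgy_dist ul t0.
pose z := Num.max M a.
have az : a <= z by rewrite !le_max lexx orbT.
have Mz : M <= z by rewrite le_max lexx.
have [c /andP[zc c1] ec] := incr u1 (fun x => sin (u x) - g) z cu1 (fun x h => (d x h).2) az.
have small y : z <= y -> `|u1 y| <= eps / 4.
  move=> zy; have := E y (le_trans az zy); rewrite /energy => h.
  have h1 := H2 (u y) (lt_le_trans (HM y (le_trans Mz zy)) _).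
  rewrite /t ge_min lexx orbT in h1; have {}h1 := h1 isT.
  rewrite -ler_sqr ?nnegrE//; last by lra.
  rewrite real_normK ?num_real//.
  by move: h1; rewrite ltr_norml => /andP[]; lra.
have h1 := small z (lexx _); have h2 := small (z + 1) ltac:(lra).
have h3 := H1 (u c) (lt_le_trans (HM c (le_trans Mz zc)) _).
rewrite /t ge_min lexx in h3; have {}h3 := h3 isT.
have -> : sin l - g = (u1 (z + 1) - u1 z) - (sin (u c) - sin l) by rewrite ec; ring.
apply: le_trans (ler_normB _ _) _; apply: le_trans (lerD (ler_normB _ _) (lexx _)) _.
lra.
Qed.

End PhasePlane.

(** * The potential well and its turning point *)

Section Homoclinic.
Context {R : realType}.
Implicit Types (f u : R -> R) (g l a x y m : R).

Lemma sin_pi_sub x : sin (pi - x) = sin x :> R.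
Proof. by rewrite sinB sinpi cospi; ring. Qed.

Lemma sin_Dpi x : sin (x + pi) = - sin x :> R.
Proof. by rewrite sinD sinpi cospi; ring. Qed.

Lemma cos_Dpi x : cos (x + pi) = - cos x :> R.
Proof. by rewrite cosD sinpi cospi; ring. Qed.

Lemma sin_D2pi x : sin (x + 2 * pi) = sin x :> R.
Proof. by rewrite (_ : x + 2 * pi = x + pi + pi) ?sin_Dpi ?opprK//; ring. Qed.

Lemma cos_D2pi x : cos (x + 2 * pi) = cos x :> R.
Proof. by rewrite (_ : x + 2 * pi = x + pi + pi) ?cos_Dpi ?opprK//; ring. Qed.

Lemma sin_gt_between r x : - (pi / 2) <= r -> r < x -> x < pi - r -> sin r < sin x.
Proof.
move=> r1 rx xr; have p0 := @pi_gt0 R.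
have key (t : R) : r < t -> t <= pi / 2 -> sin r < sin t.
  by move=> rt tp; rewrite ltr_sin// in_itv /=; apply/andP; split; lra.
have [h|h] := leP x (pi / 2); first exact: key.
by rewrite -(sin_pi_sub x); apply: key; lra.
Qed.

Section Equilibrium.
Variable g : R.
Hypothesis g01 : 0 < g < 1.
Let s := asin g.

Lemma sin_asin : sin (asin g) = g.
Proof.
move: g01 => /andP[g0 g1].
by apply: asinK; rewrite in_itv /=; apply/andP; split; lra.
Qed.

Lemma cos_asin_gt0 : 0 < cos (asin g).
Proof.
move: g01 => /andP[g0 g1].
by rewrite cos_asin ?sqrtr_gt0; [nra|apply/andP; split; lra].
Qed.

Lemma asin_bounds : 0 < asin g < pi / 2.
Proof.
move: g01 => /andP[g0 g1]; have p0 := @pi_gt0 R.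
have h1 : asin g < pi / 2 by apply: asin_ltpi2; apply/andP; split; lra.
have h2 : - (pi / 2) < asin g by apply: asin_gtNpi2; apply/andP; split; lra.
rewrite h1 andbT; rewrite ltNge; apply/negP => h3.
have : sin (asin g) <= sin 0.
  rewrite leNgt ltr_sin ?in_itv /=; first by rewrite -leNgt.
    by apply/andP; split; lra.
  by apply/andP; split; lra.
rewrite sin_asin sin0; lra.
Qed.

Lemma sin_gt_g x : asin g < x -> x < pi - asin g -> g < sin x.
Proof.
have /andP[s0 s1] := asin_bounds.
by move=> h1 h2; rewrite -{1}sin_asin; apply: sin_gt_between => //; lra.
Qed.

Lemma sin_lt_g x : pi - asin g < x -> x < 2 * pi + asin g -> sin x < g.
Proof.
have /andP[s0 s1] := asin_bounds.
move=> h1 h2; have e : sin x = - sin (x - pi) by rewrite -sin_Dpi subrK.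
rewrite e ltrNl -{1}sin_asin -sinN; apply: sin_gt_between; lra.
Qed.

Lemma sin_lt_g_left x : - pi - asin g < x -> x < asin g -> sin x < g.
Proof.
have /andP[s0 s1] := asin_bounds.
by move=> h1 h2; rewrite -sin_D2pi; apply: sin_lt_g; lra.
Qed.

(** On one period to the left of the saddle V increases. Further left the cosine gains at most 1 -
    cos(asin g) <= g^2, less than the loss g (pi + 2 asin g) of the linear term. *)
Lemma V_lt_left x : x < asin g -> V g x < V g (asin g).
Proof.
have /andP[s0 s1] := asin_bounds; have /andP[g0 g1] := g01; have p2 := @pi_ge2 R.
have cc := cos_asin_gt0; have cs := cos2Dsin2 (asin g).
move=> xs; have [h|h] := leP (- pi - asin g) x.
  apply: (@derive_gt0_lt _ (V g) (fun x => g - sin x)) => //.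
  - by move=> y _; exact: continuous_V.
  - by move=> y _; exact: is_derive_V.
  by move=> y /andP[y1 y2]; rewrite subr_gt0 sin_lt_g_left//; lra.
have c1 := cos_le1 x; have c2 := cos_le1 (asin g).
have h3 : g * x < g * (- pi - asin g) by rewrite ltr_pM2l.
rewrite sin_asin in cs; rewrite /V.
have : 1 - cos (asin g) <= g ^+ 2 by nra.
nra.
Qed.

Lemma V_dec x y : asin g <= x -> y <= pi - asin g -> x < y -> V g y < V g x.
Proof.
move=> sx ys xy; apply: (@derive_lt0_lt _ (V g) (fun x => g - sin x)) => //.
- by move=> z _; exact: continuous_V.
- by move=> z _; exact: is_derive_V.
by move=> z /andP[z1 z2]; rewrite subr_lt0 sin_gt_g//; lra.
Qed.

Lemma V_inc x y : pi - asin g <= x -> y <= 2 * pi + asin g -> x < y -> V g x < V g y.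
Proof.
move=> sx ys xy; apply: (@derive_gt0_lt _ (V g) (fun x => g - sin x)) => //.
- by move=> z _; exact: continuous_V.
- by move=> z _; exact: is_derive_V.
by move=> z /andP[z1 z2]; rewrite subr_gt0 sin_lt_g//; lra.
Qed.

(* The turning point of the homoclinic orbit. *)
Definition turning m := pi - asin g < m < 2 * pi /\ V g m = V g (asin g).

(** Intermediate value theorem on the rising side of the well: V is below the saddle level at pi -
    asin g and above it at 2 pi. *)
Lemma turning_exists : exists m, turning m.
Proof.
have /andP[s0 s1] := asin_bounds; have /andP[g0 g1] := g01; have p0 := @pi_gt0 R.
have h1 : V g (pi - asin g) < V g (asin g) by apply: V_dec => //; lra.
have h2 : V g (asin g) < V g (2 * pi).
  rewrite /V -[2 * pi]add0r cos_D2pi cos0 add0r.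
  have := cos_le1 (asin g); nra.
have [|||m /andP[m1 m2] e] := @IVT_val R (V g) (pi - asin g) (2 * pi) (V g (asin g)).
- lra.
- by move=> x _; exact: continuous_V.
- by left; rewrite !ltW.
exists m; split => //; rewrite !lt_neqAle m1 m2 !andbT; apply/andP; split.
  by apply/eqP => em; move: h1; rewrite em e ltxx.
by apply/eqP => em; move: h2; rewrite -em e ltxx.
Qed.

Variable m : R.
Hypothesis tm : turning m.

Lemma V_lt_well x : asin g < x -> x < m -> V g x < V g (asin g).
Proof.
have /andP[s0 s1] := asin_bounds; have [/andP[m1 m2] e] := tm.
move=> sx xm; have [h|h] := leP x (pi - asin g); first by apply: V_dec => //; lra.
by rewrite -e; apply: V_inc => //; lra.
Qed.

Lemma V_gt_right x : m < x -> x <= 2 * pi + asin g -> V g (asin g) < V g x.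
Proof.
have [/andP[m1 m2] e] := tm.
by move=> mx xs; rewrite -e; apply: V_inc => //; lra.
Qed.

Lemma turning_uniq m' : turning m' -> m' = m.
Proof.
move=> [/andP[m1 m2] e]; have /andP[s0 s1] := asin_bounds; have [/andP[m3 m4] e'] := tm.
have [h|h|//] := ltgtP m' m.
  have sm' : asin g < m' by lra.
  by have := V_lt_well sm' h; rewrite e ltxx.
have ms : m' <= 2 * pi + asin g by lra.
by have := V_gt_right h ms; rewrite e ltxx.
Qed.

Lemma sin_turning : sin m < g.
Proof.
have /andP[s0 s1] := asin_bounds; have [/andP[m3 m4] e'] := tm.
by apply: sin_lt_g => //; lra.
Qed.

Lemma orbit_well_energy a u (u1 : R -> R) x : energy g u u1 x = V g (asin g) ->
  asin g < u x -> u x <= m -> u1 x = 0 -> u x = m.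
Proof.
rewrite /energy => e sx; rewrite le_eqVlt => /orP[/eqP//|h] e1.
by have := V_lt_well sx h; rewrite -e e1 expr0n mul0r add0r ltxx.
Qed.

Lemma energy_V_le u (u1 : R -> R) x : energy g u u1 x = V g (asin g) ->
  V g (u x) <= V g (asin g).
Proof. by rewrite /energy => <-; rewrite lerDr divr_ge0// sqr_ge0. Qed.

(* An orbit inside the homoclinic loop that does not move up at time [a] moves
   down ever after: it could only turn at [m], which lies above. *)
Lemma orbit_well_decr a u (u1 : R -> R) : orbit g a u u1 ->
  (forall x, a <= x -> energy g u u1 x = V g (asin g)) ->
  (forall x, a <= x -> asin g < u x <= m) -> u1 a <= 0 -> forall x, a < x -> u1 x < 0.
Proof.
move=> o E W u1a x ax; rewrite ltNge; apply/negP => u1x.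
have [cu cu1 d] := o; have sm := sin_turning.
(* If [u1 a] = 0 the orbit is at the turning point, where u'' = sin m - g < 0, so the momentum
   becomes negative at once. *)
have [b /andP[ab bx] u1b] : exists2 b, a <= b < x & u1 b < 0.
  move: u1a; rewrite le_eqVlt => /orP[/eqP u1a|h]; last by exists a => //; rewrite lexx.
  have uam : u a = m.
    have /andP[w1 w2] := W a (lexx a).
    exact: (orbit_well_energy a (E a (lexx a))).
  have c : {for a, continuous (fun y => sin (u y) - g)}.
    apply: cvgB; last exact: cvg_cst.
    by apply: (@continuous_comp _ _ _ u sin); [exact: cu|exact: continuous_sin].
  have [|e e0 He] := continuous_at_dist c (eps := g - sin m); first by rewrite subr_gt0.
  pose b := a + Num.min e (x - a) / 2.
  have me : 0 < Num.min e (x - a) by rewrite lt_min e0 subr_gt0.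
  have le : Num.min e (x - a) <= e by rewrite ge_min lexx.
  have lx : Num.min e (x - a) <= x - a by rewrite ge_min lexx orbT.
  have ab : a < b by rewrite /b; lra.
  have bx : b < x by rewrite /b; lra.
  exists b; first by rewrite (ltW ab).
  rewrite -u1a; apply: (@derive_lt0_lt _ u1 (fun y => sin (u y) - g)) => //.
  - by move=> y _; exact: cu1.
  - by move=> y /andP[ay _]; have [] := d y ay.
  move=> y /andP[ay yb]; have := He y _; rewrite uam => h.
  have : `|sin (u y) - g - (sin m - g)| < g - sin m.
    by apply: h; rewrite gtr0_norm ?subr_gt0//; rewrite /b in yb; lra.
  rewrite ltr_norml => /andP[_]; lra.
have [t /andP[bt tx] u1t] : exists2 t, b <= t <= x & u1 t = 0.
  by apply: IVT_val => [|y _|]; [exact: ltW|exact: cu1|left; rewrite (ltW u1b)].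
have aat : a <= t by exact: le_trans bt.
have utm : u t = m.
  have /andP[w1 w2] := W t aat.
  exact: (orbit_well_energy a (E t aat)).
have lbt : b < t by rewrite lt_neqAle bt andbT; apply/eqP => e; move: u1b; rewrite e u1t ltxx.
(* Moving down at [b] and being at the top [m] at [t], the orbit has an interior minimum. There the
   momentum vanishes, which the energy permits only at [m]: a contradiction. *)
have [c cbt Hc] := @EVT_min R u b t bt ltac:(exact: continuous_subspaceT).
move: cbt; rewrite in_itv /= => /andP[bc ct].
have ac : a <= c by exact: le_trans bc.
have /andP[w1 w2] := W c ac.
have db : exists2 z, b < z < t & u z < u b.
  have [e e0 He] := continuous_at_dist (@cu1 b) (eps := - u1 b) ltac:(lra).
  pose z := b + Num.min e (t - b) / 2.
  have me : 0 < Num.min e (t - b) by rewrite lt_min e0 subr_gt0.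
  have le : Num.min e (t - b) <= e by rewrite ge_min lexx.
  have lx : Num.min e (t - b) <= t - b by rewrite ge_min lexx orbT.
  have bz : b < z by rewrite /z; lra.
  have zt : z < t by rewrite /z; lra.
  exists z; first by rewrite bz.
  apply: (@derive_lt0_lt _ u u1) => //.
  - by move=> y _; exact: cu.
  - by move=> y /andP[y1 _]; have [] := d y (le_lt_trans ab y1).
  move=> y /andP[y1 y2]; have := He y _; rewrite gtr0_norm ?subr_gt0// => h.
  have y3 : y - b < e by rewrite /z in y2; lra.
  by have := h y3; rewrite ltr_norml => /andP[_ i]; lra.
have [z /andP[bz zt] uzb] := db.
have ucz : u c <= u z by apply: Hc; rewrite in_itv /= !ltW.
have ubm : u b <= m by have /andP[] := W b ab.
have cb : b < c by rewrite lt_neqAle bc andbT; apply/eqP => e; move: ucz; rewrite -e leNgt uzb.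
have ct' : c < t by rewrite lt_neqAle ct andbT; apply/eqP => e; move: ucz; rewrite e utm; lra.
have [dc _] := d c (le_lt_trans ab cb).
have u1c : u1 c = 0.
  have := @derive1_at_min R u b t c bt.
  move=> /(_ _ _ _) h; have h' := h _ _ _.
  have : is_derive c 1 u 0.
    apply: h'; first by move=> y; rewrite in_itv /= => /andP[y1 _]; have [[]] := d y (le_lt_trans ab y1).
      by rewrite in_itv /= cb ct'.
    by move=> y hy; apply: Hc; apply: subset_itv_oo_cc hy.
  exact: is_derive_uniq dc.
have := orbit_well_energy a (E c ac) w1 w2 u1c; lra.
Qed.

End Equilibrium.
End Homoclinic.

(** * Orbits converging to a saddle and the value of [phi_max] *)

Section Stable.
Context {R : realType}.
Implicit Types (f u : R -> R) (g l a x y m : R).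

Lemma monotone_cvgy f a C : (forall x y, a <= x -> x <= y -> f x <= f y) ->
  (forall x, a <= x -> f x <= C) -> exists l, f x @[x --> +oo] --> l.
Proof.
move=> mf fC; pose h x := f (Num.max a x).
have mh : nondecreasing_fun h.
  move=> x y xy; apply: mf; first by rewrite le_max lexx.
  by rewrite ge_max !le_max lexx xy !orbT.
have ub : has_ubound (range h).
  by exists C => _ [x _ <-]; apply: fC; rewrite le_max lexx.
exists (sup (range h)).
have := nondecreasing_cvgr mh ub; apply: cvg_trans; apply: near_eq_cvg.
near=> x; rewrite /h; congr f; apply/max_idPr.
near: x; apply: nbhs_pinfty_ge; exact: num_real.
Unshelve. all: by end_near. Qed.

Lemma sign_persist f a : continuous f -> (forall x, a <= x -> f x != 0) -> f a < 0 ->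
  forall x, a <= x -> f x < 0.
Proof.
move=> cf nz fa x ax; rewrite ltNge; apply/negP => fx.
have [y _||c /andP[ac _] fc] := @IVT_sign R f a x ax.
- exact: cf.
- by rewrite mulr_le0_ge0// ltW.
by have := nz c ac; rewrite fc eqxx.
Qed.

Lemma leaving_not_cvg u (u1 : R -> R) b l : continuous u ->
  (forall x : R, b < x -> is_derive x 1 u (u1 x)) -> (forall x, b < x -> u1 x <= 0) ->
  u b < l -> u x @[x --> +oo] --> l -> False.
Proof.
move=> cu du u1b ubl ul.
have [M HM] := cvgy_dist ul (eps := l - u b) ltac:(lra).
have := HM (Num.max M b); rewrite le_max lexx => /(_ isT).
have : u (Num.max M b) <= u b.
  apply: (@derive_le0_le _ u u1) => //; first by rewrite le_max lexx orbT.
  - by move=> y _; exact: cu.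
  - by move=> y /andP[y1 _]; exact: du.
  by move=> y /andP[y1 _]; exact: u1b.
by rewrite ltr_norml => h /andP[]; lra.
Qed.

(** A half-orbit on the stable manifold of the equilibrium [l]. A fluxon provides two: its right
    tail, and its left tail read backwards. *)
Definition stable g l a u (u1 : R -> R) : Prop :=
  orbit g a u u1 /\ u x @[x --> +oo] --> l.

(** An orbit on the energy level of [l] that meets [l] does so with zero momentum, and is then the
    equilibrium by uniqueness. *)
Lemma orbit_cst_trichotomy g l a u (u1 : R -> R) : stable g l a u u1 ->
  [\/ forall x, a <= x -> u x = l /\ u1 x = 0,
      forall x, a <= x -> u x < l | forall x, a <= x -> l < u x].
Proof.
move=> [orb ul]; have [sl E] := orbit_limit orb ul; have [cu cu1 d] := orb.
have hit x : a <= x -> u x = l -> forall y, a <= y -> u y = l /\ u1 y = 0.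
  move=> ax e; apply: (orbit_equilibrium orb sl ax e).
  have := E x ax; rewrite /energy e => /eqP.
  by rewrite -subr_eq0 addrK mulf_eq0 sqrf_eq0 invr_eq0 (_ : (2 == 0 :> R) = false) ?orbF => [/eqP|]; rewrite ?pnatr_eq0.
have [ua|ua|ua] := ltgtP (u a) l; last by apply: Or31; apply: (hit a).
  apply: Or32 => x ax; rewrite ltNge; apply/negP => ux.
  have [|c /andP[ac cx] uc] := @IVT_val R u a x l ax (fun y _ => cu y).
    by left; rewrite (ltW ua).
  by have [e _] := hit c ac uc a (lexx a); rewrite e ltxx in ua.
apply: Or33 => x ax; rewrite ltNge; apply/negP => ux.
have [|c /andP[ac cx] uc] := @IVT_val R u a x l ax (fun y _ => cu y).
  by right; rewrite (ltW ua) ux.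
by have [e _] := hit c ac uc a (lexx a); rewrite e ltxx in ua.
Qed.

Lemma stable_shift g l a u (u1 : R -> R) : stable g (l + 2 * pi) a u u1 ->
  stable g l a (fun x => u x - 2 * pi) u1.
Proof.
move=> [[cu cu1 d] ul]; split; last first.
  by rewrite -(addrK (2 * pi) l); apply: cvgB => //; exact: cvg_cst.
split => //; first by move=> x; apply: cvgB; [exact: cu|exact: cvg_cst].
move=> x ax; have [d1 d2] := d x ax; split; first by deriv; rewrite subr0.
by rewrite -(sin_D2pi (u x - 2 * pi)) subrK.
Qed.

Section Positive.
Variables (g m : R).
Hypotheses (g01 : 0 < g < 1) (tm : turning g m).

(** The stable set of the saddle: the equilibrium, the half-orbit from below, and the homoclinic
    loop. Below the saddle the potential is lower, so the momentum keeps a sign, which convergence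
    forces to be positive; just above [m] the potential exceeds the available energy. *)
Lemma stable_cases a u (u1 : R -> R) : stable g (asin g) a u u1 ->
  [\/ forall x, a <= x -> u x = asin g /\ u1 x = 0,
      forall x, a <= x -> u x < asin g /\ 0 < u1 x
    | forall x, a <= x -> asin g < u x <= m].
Proof.
move=> st; have [orb ul] := st; have [sl E] := orbit_limit orb ul; have [cu cu1 d] := orb.
have [h|h|h] := orbit_cst_trichotomy st; first exact: Or31.
  apply: Or32 => x ax; split; first exact: h.
  have nz y : a <= y -> u1 y != 0.
    move=> ay; apply/eqP => e.
    have := V_lt_left g01 (h y ay); rewrite -(E y ay) /energy e expr0n mul0r add0r ltxx.
    by [].
  rewrite ltNge le_eqVlt (negbTE (nz x ax)) /=; apply/negP => neg.
  have neg' := sign_persist cu1 (fun y (xy : x <= y) => nz y (le_trans ax xy)) neg.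
  apply: (@leaving_not_cvg u u1 x (asin g) cu _ _ (h x ax) ul).
    by move=> y xy; have [] := d y (le_lt_trans ax xy).
  by move=> y xy; apply/ltW/neg'/ltW.
apply: Or33 => x ax; rewrite h//= leNgt; apply/negP => mu.
have [/andP[m1 m2] _] := tm; have /andP[s0 s1] := asin_bounds g01.
have [M HM] := cvgy_dist ul (eps := m - asin g) ltac:(lra).
pose z := Num.max M x.
have zx : x <= z by rewrite le_max lexx orbT.
have uz : u z < m.
  by have := HM z; rewrite le_max lexx => /(_ isT); rewrite ltr_norml => /andP[_]; lra.
(* An intermediate value inside the forbidden interval ]m, 2 pi + asin g]; [u x] itself might lie
   beyond it. *)
pose v := Num.min (u x) (2 * pi + asin g).
have mv : m < v by rewrite lt_min mu; lra.
have [|c /andP[ac cx] uc] := @IVT_val R u x z v zx (fun y _ => cu y).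
  by right; rewrite ge_min lexx andbT; lra.
have := energy_V_le (E c (le_trans ax ac)); rewrite uc leNgt (V_gt_right g01 tm)//.
by rewrite ge_min lexx orbT.
Qed.

Lemma stable_well_decr a u (u1 : R -> R) : stable g (asin g) a u u1 ->
  asin g < u a -> u1 a <= 0 -> forall x, a < x -> u1 x < 0.
Proof.
move=> st ua; have [h|h|h] := stable_cases st.
- by have [e _] := h a (lexx a); rewrite e ltxx in ua.
- by have [e _] := h a (lexx a); have := lt_trans e ua; rewrite ltxx.
have [orb ul] := st; have [_ E] := orbit_limit orb ul.
exact: (orbit_well_decr g01 tm orb E h).
Qed.

(** The orbit is trapped in ]asin g, m] and decreases, hence converges; the limit has the saddle
    energy and lies in [asin g, m[, where only the saddle has it. *)
Lemma turning_orbit u (u1 : R -> R) : orbit g 0 u u1 -> u 0 = m -> u1 0 = 0 ->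
  u x @[x --> +oo] --> asin g.
Proof.
move=> o u0 u10; have [cu cu1 d] := o.
have [/andP[m1 m2] em] := tm; have /andP[s0 s1] := asin_bounds g01.
have p0 := @pi_gt0 R.
have E x : 0 <= x -> energy g u u1 x = V g (asin g).
  move=> x0; rewrite (@energy_cst R g 0 u u1 x 0)//.
  by rewrite /energy u0 u10 expr0n mul0r add0r.
have lo x : 0 <= x -> asin g < u x.
  move=> x0; rewrite ltNge; apply/negP => ux.
  have [|c /andP[c0 cx] uc] := @IVT_val R u 0 x (asin g) x0 (fun y _ => cu y).
    by right; rewrite ux u0; lra.
  have e1 : u1 c = 0.
    have := E c c0; rewrite /energy uc => /eqP.
    rewrite -subr_eq0 addrK mulf_eq0 sqrf_eq0 invr_eq0 pnatr_eq0 orbF => /eqP //.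
  have [e _] := orbit_equilibrium o (sin_asin g01) c0 uc e1 (lexx 0).
  by rewrite u0 in e; lra.
have hi x : 0 <= x -> u x <= m.
  move=> x0; rewrite leNgt; apply/negP => ux.
  pose v := Num.min (u x) (2 * pi + asin g).
  have mv : m < v by rewrite lt_min ux; lra.
  have [|c /andP[c0 cx] uc] := @IVT_val R u 0 x v x0 (fun y _ => cu y).
    by left; rewrite u0 (ltW mv) ge_min lexx.
  have := energy_V_le (E c c0); rewrite uc leNgt (V_gt_right g01 tm)//.
  by rewrite ge_min lexx orbT.
have W x : 0 <= x -> asin g < u x <= m by move=> x0; rewrite lo// hi.
have u1x : u1 0 <= 0 by rewrite u10.
have neg := orbit_well_decr g01 tm o E W u1x.
have dec x y : 0 <= x -> x < y -> u y < u x.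
  move=> x0 xy; apply: (@derive_lt0_lt _ u u1) => //.
  - by move=> z _; exact: cu.
  - by move=> z /andP[z1 _]; have [] := d z (le_lt_trans x0 z1).
  by move=> z /andP[z1 _]; apply: neg; exact: le_lt_trans z1.
have [||l' hl] := @monotone_cvgy (fun x => - u x) 0 (- asin g).
- by move=> x y x0; rewrite le_eqVlt => /orP[/eqP -> //|xy]; rewrite lerN2 ltW// dec.
- by move=> x x0; rewrite lerN2 ltW// lo.
have ul : u x @[x --> +oo] --> - l'.
  have -> : u = fun x => - - u x by apply/funext => x; rewrite opprK.
  exact: cvgN hl.
have [sl El] := orbit_limit o ul.
have eV : V g (- l') = V g (asin g) by rewrite -(El 0)// E.
have l1 : asin g <= - l'.
  rewrite leNgt; apply/negP => h.
  have [M HM] := cvgy_dist ul (eps := asin g - - l') ltac:(lra).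
  have := HM (Num.max M 0); rewrite le_max lexx => /(_ isT).
  have := lo (Num.max M 0); rewrite le_max lexx orbT => /(_ isT) h1.
  by rewrite ltr_norml => /andP[_]; lra.
have l2 : - l' < m.
  have u1m : u 1 < m by rewrite -u0; apply: dec.
  have [M HM] := cvgy_dist ul (eps := m - u 1) ltac:(lra).
  have := HM (Num.max M 2); rewrite le_max lexx => /(_ isT).
  have h2 : 1 < Num.max M 2 by rewrite lt_max; apply/orP; right; lra.
  have := dec 1 (Num.max M 2) ler01 h2.
  by move=> h1; rewrite ltr_norml => /andP[]; lra.
move: l1; rewrite le_eqVlt => /orP[/eqP -> //|h].
by have := V_lt_well g01 tm h l2; rewrite eV ltxx.
Qed.

Lemma pendulum_orbit (al be : R) : exists u u1 : R -> R,
  [/\ forall x : R, is_derive x 1 u (u1 x), forall x : R, is_derive x 1 u1 (sin (u x) - g),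
      u 0 = al & u1 0 = be].
Proof.
apply: (@picard R (fun _ y => sin y - g) 1 `|g|) => //.
- move=> _ u v; rewrite mul1r (_ : sin u - g - (sin v - g) = sin u - sin v); last by ring.
  exact: sin_sub_le.
- by move=> _; rewrite sin0 sub0r normrN.
move=> y cy x; apply: cvgB; last exact: cvg_cst.
by apply: (@continuous_comp _ _ _ y sin); [exact: cy|exact: continuous_sin].
Qed.

Lemma energy_lim u (u1 : R -> R) l a : (forall x, a <= x -> energy g u u1 x = V g l) ->
  u x @[x --> +oo] --> l -> u1 x @[x --> +oo] --> (0 : R).
Proof.
move=> E ul; apply/cvgrPdist_lt => eps eps0.
have eps2 : 0 < eps ^+ 2 / 2 by rewrite divr_gt0// exprn_gt0.
have [d d0 H] := continuous_at_dist (@continuous_V R g l) eps2.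
have [M HM] := cvgy_dist ul d0.
near=> x.
have xM : M <= x by near: x; apply: nbhs_pinfty_ge; exact: num_real.
have xa : a <= x by near: x; apply: nbhs_pinfty_ge; exact: num_real.
have := H (u x) (HM x xM); rewrite -(E x xa) /energy ltr_norml => /andP[h1 _].
rewrite sub0r normrN -ltr_sqr ?nnegrE// ?(ltW eps0)// real_normK ?num_real//; lra.
Unshelve. all: by end_near. Qed.

(** The orbit through (m, 0); as the equation is invariant under x -> -x, both limits come from
    [turning_orbit]. *)
Lemma homoclinic_turning : exists2 u, homoclinic g u & u 0 = m.
Proof.
have [/andP[m1 m2] em] := tm; have /andP[s0 s1] := asin_bounds g01.
have [u [u1 [d1 d2 e0 e1]]] := pendulum_orbit m 0.
have cu : continuous u by move=> x; exact: is_derive_cont (d1 x).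
have cu1 : continuous u1 by move=> x; exact: is_derive_cont (d2 x).
have o1 : orbit g 0 u u1 by [].
have dn (x : R) : is_derive x 1 (fun x => - x) (- 1 : R) by deriv.
have o2 : orbit g 0 (fun x => u (- x)) (fun x => - u1 (- x)).
  split.
  - by move=> x; apply: (@continuous_comp _ _ _ (fun x => - x) u); [apply: cvgN; exact: cvg_id|exact: cu].
  - by move=> x; apply: cvgN; apply: (@continuous_comp _ _ _ (fun x => - x) u1); [apply: cvgN; exact: cvg_id|exact: cu1].
  move=> x _; split.
    by apply: (is_derive_eqx (is_derive_compx (dn x) (d1 _))); ring.
  by apply: (is_derive_eqx (is_deriveNx (is_derive_compx (dn x) (d2 _)))); ring.
have l1 := turning_orbit o1 e0 e1.
have l2 : u (- x) @[x --> +oo] --> asin g.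
  by apply: (turning_orbit o2); rewrite oppr0 ?e1 ?oppr0.
have [_ E1] := orbit_limit o1 l1; have [_ E2] := orbit_limit o2 l2.
have u1E : derive1 u = u1 by apply/funext => x; exact: derive1_is (d1 x).
have u2E x : derive1 u1 x = sin (u x) - g by exact: derive1_is (d2 x).
exists u => //; split.
- by move=> x; rewrite u1E; split; [have [] := d1 x|have [] := d2 x|exact: u2E].
- rewrite u1E; split; first exact/cvgNy_compNP.
  apply/cvgNy_compNP.
  have -> : (fun x => u1 (- x)) = fun x => - - u1 (- x) by apply/funext => x; rewrite opprK.
  by have h := cvgN (energy_lim E2 l2); rewrite oppr0 in h; exact: h.
- by rewrite u1E; split => //; exact: energy_lim E1 l1.
by exists 0; rewrite e0 gt_eqF//; lra.
Qed.

Lemma homoclinic_le u x : homoclinic g u -> u x <= m.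
Proof.
move=> [d _ [l _] _].
have [/andP[m1 m2] em] := tm; have /andP[s0 s1] := asin_bounds g01.
have dd (y : R) : is_derive y 1 u (derive1 u y) /\ is_derive y 1 (derive1 u) (sin (u y) - g).
  by have [h1 h2 <-] := d y; split; exact: is_derive_derive1.
have st : stable g (asin g) x u (derive1 u).
  split => //; split => // y; first exact: is_derive_cont (dd y).1.
  exact: is_derive_cont (dd y).2.
have [h|h|h] := stable_cases st.
- by have [-> _] := h x (lexx x); lra.
- by have [h1 _] := h x (lexx x); lra.
by have /andP[] := h x (lexx x).
Qed.

(** Identifies the supremum over homoclinic orbits with a root of the potential equation, which
    makes it computable. *)
Lemma phi_maxE : phi_max g = m.
Proof.
have [u hu u0] := homoclinic_turning.
apply/eqP; rewrite eq_le; apply/andP; split.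
  apply: ge_sup; first by exists m, u; split => //; exists 0.
  by move=> _ [v [hv [x <-]]]; exact: homoclinic_le.
apply: ub_le_sup; last by exists u; split => //; exists 0.
by exists m => _ [v [hv [x <-]]]; exact: homoclinic_le.
Qed.

End Positive.

Lemma phi_max_turning g : 0 < g < 1 -> turning g (phi_max g).
Proof. by move=> g01; have [m tm] := turning_exists g01; rewrite (phi_maxE g01 tm). Qed.

Lemma cos_lt1 x : 0 < x -> x < 2 * pi -> cos x < 1 :> R.
Proof.
move=> x0 x2; have -> : cos x = 1 - 2 * sin (x / 2) ^+ 2.
  have := cos_mulr2n (x / 2); rewrite (_ : x / 2 *+ 2 = x) => [->|]; last by rewrite mulr2n; lra.
  by have := cos2Dsin2 (x / 2); rewrite mulr2n; lra.
have : 0 < sin (x / 2) by apply: sin_gt0_pi; apply/andP; split; lra.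
by move=> h; have := exprn_gt0 2 h; lra.
Qed.

(** For g = 0 the saddles 0 and 2 pi have the same energy, so an orbit reaching 2 pi would be at
    rest there for ever. Negative values reduce to positive ones by oddness. *)
Lemma stable_cases0 a u (u1 : R -> R) : stable 0 0 a u u1 ->
  [\/ forall x, a <= x -> u x = 0 /\ u1 x = 0,
      forall x, a <= x -> - (2 * pi) < u x < 0 /\ 0 < u1 x
    | forall x, a <= x -> 0 < u x < 2 * pi /\ u1 x < 0].
Proof.
have p0 := @pi_gt0 R.
have key u' (v : R -> R) : stable 0 0 a u' v -> (forall x, a <= x -> 0 < u' x) ->
    forall x, a <= x -> 0 < u' x < 2 * pi /\ v x < 0.
  move=> st pos; have [orb ul] := st; have [sl E] := orbit_limit orb ul; have [cu cu1 d] := orb.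
  have E' x : a <= x -> v x ^+ 2 / 2 + cos (u' x) = 1.
    by move=> ax; have := E x ax; rewrite /energy /V cos0 !mul0r !addr0.
  have lt2 x : a <= x -> u' x < 2 * pi.
    move=> ax; rewrite ltNge; apply/negP => h.
    have [M HM] := cvgy_dist ul (eps := 2 * pi) ltac:(lra).
    pose z := Num.max M x.
    have zx : x <= z by rewrite le_max lexx orbT.
    have uz : u' z < 2 * pi.
      by have := HM z; rewrite le_max lexx subr0 => /(_ isT); rewrite ltr_norml => /andP[_].
    have [|c /andP[xc cz] uc] := @IVT_val R u' x z (2 * pi) zx (fun y _ => cu y).
      by right; rewrite (ltW uz).
    have ac : a <= c by exact: le_trans xc.
    have vc : v c = 0.
      have := E' c ac; rewrite uc -[2 * pi]add0r cos_D2pi cos0 => /eqP.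
      by rewrite -subr_eq0 addrK mulf_eq0 sqrf_eq0 invr_eq0 pnatr_eq0 orbF => /eqP.
    have s2 : sin (2 * pi) = 0 :> R by rewrite -[2 * pi]add0r sin_D2pi sin0.
    have H := orbit_equilibrium orb s2 ac uc vc.
    have := cvgy_const (fun y ay => (H y ay).1) ul; lra.
  have nz x : a <= x -> v x != 0.
    move=> ax; apply/eqP => e; have := E' x ax; rewrite e expr0n mul0r add0r.
    by have := cos_lt1 (pos x ax) (lt2 x ax); lra.
  move=> x ax; rewrite pos//= lt2//; split => //.
  rewrite ltNge le_eqVlt eq_sym (negbTE (nz x ax)) /=; apply/negP => pv.
  have cn : continuous (fun y => - v y) by move=> y; apply: cvgN; exact: cu1.
  have neg y : x <= y -> - v y < 0.
    apply: (@sign_persist (fun y => - v y) x cn); last by rewrite oppr_lt0.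
    by move=> t xt; rewrite oppr_eq0 nz// (le_trans ax).
  apply: (@leaving_not_cvg (fun y => - u' y) (fun y => - v y) x 0).
  - by move=> y; apply: cvgN; exact: cu.
  - by move=> y xy; have [h1 _] := d y (le_lt_trans ax xy); exact: is_deriveNx.
  - by move=> y xy; apply/ltW/neg/ltW.
  - by rewrite oppr_lt0 pos.
  by rewrite -oppr0; apply: cvgN.
move=> st; have [h|h|h] := orbit_cst_trichotomy st; first exact: Or31.
  apply: Or32; have [[cu cu1 d] ul] := st.
  have st' : stable 0 0 a (fun x => - u x) (fun x => - u1 x).
    split; last by rewrite -oppr0; apply: cvgN.
    split.
    - by move=> x; apply: cvgN; exact: cu.
    - by move=> x; apply: cvgN; exact: cu1.
    move=> x ax; have [h1 h2] := d x ax; split; first exact: is_deriveNx.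
    by apply: (is_derive_eqx (is_deriveNx h2)); rewrite sinN; ring.
  have pos x : a <= x -> 0 < - u x by move=> ax; rewrite oppr_gt0 h.
  move=> x ax; have [/andP[h1 h2] h3] := key _ _ st' pos x ax.
  by split; [apply/andP; split|]; lra.
by apply: Or33; exact: key.
Qed.

End Stable.

(** * The constant gamma_1 *)

Section GammaOne.
Context {R : realType}.
Implicit Types (g x y : R).

Lemma sin_le_id x : 0 <= x -> sin x <= x.
Proof.
move=> x0; rewrite -subr_ge0 -[leLHS](_ : 0 - sin 0 = 0); last by rewrite sin0 subrr.
have d (y : R) : is_derive y 1 (fun x => x - sin x) (1 - cos y) by deriv; ring.
apply: (@derive_ge0_le R _ _ 0 x x0 (fun y _ => is_derive_cont (d y)) (fun y _ => d y)).
by move=> y _; rewrite subr_ge0 cos_le1.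
Qed.

Lemma cos_ge_sq x : 0 <= x -> 1 - x ^+ 2 / 2 <= cos x.
Proof.
move=> x0; rewrite -subr_ge0 -[leLHS](_ : cos 0 - (1 - 0 ^+ 2 / 2) = 0); last first.
  by rewrite cos0; field.
apply: (@derive_ge0_le R (fun x => cos x - (1 - x ^+ 2 / 2)) (fun x => x - sin x)) => //.
- move=> y _; have d : is_derive y 1 (fun x => cos x - (1 - x ^+ 2 / 2)) (y - sin y) by deriv; field.
  exact: is_derive_cont d.
- by move=> y _; deriv; field.
by move=> y /andP[y0 _]; rewrite subr_ge0 sin_le_id// ltW.
Qed.

Lemma sin_ge_cube x : 0 <= x -> x - x ^+ 3 / 6 <= sin x.
Proof.
move=> x0; rewrite -subr_ge0 -[leLHS](_ : sin 0 - (0 - 0 ^+ 3 / 6) = 0); last first.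
  by rewrite sin0; field.
have d (y : R) : is_derive y 1 (fun x => sin x - (x - x ^+ 3 / 6)) (cos y - (1 - y ^+ 2 / 2)).
  by deriv; field.
apply: (@derive_ge0_le R _ _ 0 x x0 (fun y _ => is_derive_cont (d y)) (fun y _ => d y)).
by move=> y /andP[y0 _]; rewrite subr_ge0 cos_ge_sq// ltW.
Qed.

Lemma cos_le_quartic x : 0 <= x -> cos x <= 1 - x ^+ 2 / 2 + x ^+ 4 / 24.
Proof.
move=> x0; rewrite -subr_ge0 -[leLHS](_ : (1 - 0 ^+ 2 / 2 + 0 ^+ 4 / 24) - cos 0 = 0); last first.
  by rewrite cos0; field.
have d (y : R) : is_derive y 1 (fun x => (1 - x ^+ 2 / 2 + x ^+ 4 / 24) - cos x) (sin y - (y - y ^+ 3 / 6)).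
  by deriv; field.
apply: (@derive_ge0_le R _ _ 0 x x0 (fun y _ => is_derive_cont (d y)) (fun y _ => d y)).
by move=> y /andP[y0 _]; rewrite subr_ge0 sin_ge_cube// ltW.
Qed.

Lemma cos_double x : cos (2 * x) = 2 * cos x ^+ 2 - 1.
Proof. by rewrite mulr_natl cos_mulr2n mulr_natl. Qed.

(** To locate pi, the sign of the cosine is needed near pi/2; three doublings bring the argument
    down to about 0.2, where short Taylor polynomials are accurate. *)
Lemma cos_eight x : cos (8 * x) = 2 * (2 * (2 * cos x ^+ 2 - 1) ^+ 2 - 1) ^+ 2 - 1.
Proof. by rewrite (_ : 8 * x = 2 * (2 * (2 * x))) ?cos_double//; ring. Qed.

Lemma double_ge (c k k' : R) : 0 <= k -> k' <= 2 * k ^+ 2 - 1 -> k <= c ->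
  k' <= 2 * c ^+ 2 - 1.
Proof.
move=> k0 kk kc; apply: le_trans kk _.
by rewrite lerD2r ler_pM2l// lerXn2r// nnegrE// (le_trans k0).
Qed.

Lemma double_le (c k k' : R) : - k <= c -> 2 * k ^+ 2 - 1 <= k' -> c <= k ->
  2 * c ^+ 2 - 1 <= k'.
Proof.
move=> c0 kk kc; apply: le_trans kk; rewrite lerD2r ler_pM2l//.
have h : `|c| <= `|k|.
  by rewrite ler_norml (le_trans _ c0) ?lerN2 ?ler_norm// (le_trans kc) ?ler_norm.
by rewrite -(real_normK (num_real c)) -(real_normK (num_real k)) lerXn2r// nnegrE.
Qed.

Lemma cos_eight_gt0 x : 981 / 1000 <= cos x -> 0 < cos (8 * x).
Proof.
rewrite cos_eight => h.
have h1 := @double_ge _ (981 / 1000) (9247 / 10000) ltac:(clear; lra) ltac:(clear; lra) h.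
have h2 := @double_ge _ (9247 / 10000) (71 / 100) ltac:(clear; lra) ltac:(clear; lra) h1.
have h3 := @double_ge _ (71 / 100) (1 / 1000) ltac:(clear; lra) ltac:(clear; lra) h2.
by apply: lt_le_trans h3; clear; lra.
Qed.

Lemma cos_eight_lt0 x : cos x <= 9801 / 10000 -> 98 / 100 <= cos x -> cos (8 * x) < 0.
Proof.
rewrite cos_eight => h g.
have g1 := @double_ge _ (98 / 100) (9 / 10) ltac:(clear; lra) ltac:(clear; lra) g.
have g2 := @double_ge _ (9 / 10) (6 / 10) ltac:(clear; lra) ltac:(clear; lra) g1.
have h1 : 2 * cos x ^+ 2 - 1 <= 922 / 1000.
  apply: (double_le _ _ h); first by apply: le_trans g; clear; lra.
  by clear; lra.
have h2 : 2 * (2 * cos x ^+ 2 - 1) ^+ 2 - 1 <= 7 / 10 + 1 / 1000.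
  apply: (double_le _ _ h1); first by apply: le_trans g1; clear; lra.
  by clear; lra.
apply: le_lt_trans (double_le _ (lexx _) h2) _; first by apply: le_trans g2; clear; lra.
by clear; lra.
Qed.

Lemma pi_gt31 : 31 / 10 < pi :> R.
Proof.
have c0 : 0 < cos (8 * (155 / 800) : R).
  by apply: cos_eight_gt0; apply: le_trans (cos_ge_sq _); lra.
rewrite ltNge; apply/negP => h; move: c0; apply/negP; rewrite -leNgt -cos_pihalf.
have p2 := @pi_ge2 R.
have : pi / 2 <= 8 * (155 / 800) :> R by lra.
have : 8 * (155 / 800) <= pi :> R by lra.
move: (8 * (155 / 800) : R) => t tp; rewrite le_eqVlt => /orP[/eqP -> //|ht].
by apply: ltW; rewrite ltr_cos// in_itv /=; apply/andP; split; lra.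
Qed.

Lemma pi_lt32 : pi < 32 / 10 :> R.
Proof.
have c0 : cos (8 * (16 / 80) : R) < 0.
  apply: cos_eight_lt0; first by apply: le_trans (cos_le_quartic _) _; lra.
  by apply: le_trans (cos_ge_sq _); lra.
rewrite ltNge; apply/negP => h; move: c0; apply/negP; rewrite -leNgt.
by apply: cos_ge0_pihalf; apply/andP; split; lra.
Qed.

Lemma cos_2pi_sub x : cos (2 * pi - x) = cos x.
Proof. by rewrite addrC cos_D2pi cosN. Qed.

Lemma acos_le x y : -1 <= x -> x <= y -> y <= 1 -> acos y <= acos x.
Proof.
move=> x1 xy y1.
have hx : -1 <= x <= 1 by apply/andP; split; lra.
have hy : -1 <= y <= 1 by apply/andP; split; lra.
rewrite leNgt -ltr_cos; first by rewrite !acosK ?in_itv //= -leNgt.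
- by rewrite in_itv /= acos_ge0// acos_lepi.
- by rewrite in_itv /= acos_ge0// acos_lepi.
Qed.

Lemma cos_decr x y : 0 <= x -> x < y -> y <= pi -> cos y < cos x :> R.
Proof. by move=> x0 xy yp; rewrite ltr_cos ?in_itv /=; [|apply/andP; split; lra..]. Qed.

Lemma cos_incr x y : pi <= x -> x < y -> y <= 2 * pi -> cos x < cos y :> R.
Proof.
by move=> x0 xy yp; rewrite -[cos x]cos_2pi_sub -[cos y]cos_2pi_sub; apply: cos_decr; lra.
Qed.

Lemma acos_cos_turn1 x : pi <= x <= 2 * pi -> acos (cos x) = 2 * pi - x :> R.
Proof.
move=> /andP[x1 x2]; rewrite -cos_2pi_sub cosK// in_itv /=; apply/andP; split; lra.
Qed.

Lemma acos_cos_turn2 x : 2 * pi <= x <= 3 * pi -> acos (cos x) = x - 2 * pi :> R.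
Proof.
move=> /andP[x1 x2]; rewrite -[in LHS](subrK (2 * pi) x) cos_D2pi cosK// in_itv /=.
by apply/andP; split; lra.
Qed.

Lemma acos_cos_turn3 x : 3 * pi <= x <= 4 * pi -> acos (cos x) = 4 * pi - x :> R.
Proof.
move=> /andP[x1 x2]; rewrite -[in LHS](subrK (2 * pi) x) cos_D2pi acos_cos_turn1; last first.
  by apply/andP; split; lra.
by ring.
Qed.

Lemma acos_opp_cos x : 0 <= x <= 2 * pi -> acos (- cos x) = `|x - pi| :> R.
Proof.
move=> /andP[x0 x2]; rewrite -cos_Dpi; have [h|h] := leP pi x.
  rewrite ger0_norm ?subr_ge0// -[in LHS](subrK pi x) -addrA -mulr2n -mulr_natl.
  by rewrite cos_D2pi cosK// in_itv /=; apply/andP; split; lra.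
rewrite ltr0_norm ?subr_lt0// opprB acos_cos_turn1; first by ring.
by apply/andP; split; lra.
Qed.

Lemma cos_eq_lt x y : 0 <= x -> x < y -> y <= 2 * pi -> cos x = cos y ->
  x < pi /\ y = 2 * pi - x.
Proof.
move=> x0 xy y2 e.
have x1 : x < pi.
  by rewrite ltNge; apply/negP => px; have := cos_incr px xy y2; rewrite e ltxx.
have y1 : pi < y.
  by rewrite ltNge; apply/negP => py; have := cos_decr x0 xy py; rewrite e ltxx.
split => //; have : acos (cos x) = acos (cos y) by rewrite e.
rewrite cosK ?in_itv /= ?x0 ?ltW// acos_cos_turn1 ?y2 ?ltW// => ->; ring.
Qed.

(* For [g <= 1/pi] the equation [cos phi_max + 1 = 2 pi g] amounts to
   [gamma_1_fun g = 0], the energy identity at the turning point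
   [2 pi - acos (2 pi g - 1)]. *)
Definition turning_candidate g : R := 2 * pi - acos (2 * pi * g - 1).

Definition gamma_1_fun g : R :=
  2 * pi * g - 1 + g * turning_candidate g - (Num.sqrt (1 - g ^+ 2) + g * asin g).

Lemma inv_pi : 0 < (pi : R)^-1 < 1.
Proof.
have p0 := @pi_gt31; rewrite invr_gt0 pi_gt0/= invf_lt1 ?pi_gt0//; lra.
Qed.

Lemma le_inv_pi g : g <= pi^-1 -> pi * g <= 1.
Proof. by move=> h; have := ler_wpM2l (ltW (@pi_gt0 R)) h; rewrite divff ?gt_eqF ?pi_gt0. Qed.

Lemma ge_inv_pi g : pi * g <= 1 -> g <= pi^-1.
Proof. by move=> h; rewrite -[pi^-1]mul1r ler_pdivlMr ?pi_gt0// mulrC. Qed.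

(** V(pi) = pi g - 1 <= 0 is below the saddle level, and V increases between pi - asin g and 2 pi +
    asin g. *)
Lemma turning_gt_pi g m : 0 < g -> g <= pi^-1 -> turning g m -> pi < m.
Proof.
move=> g0 gp [/andP[m1 m2] e]; have /andP[_ ip] := inv_pi.
have g01 : 0 < g < 1 by rewrite g0 (le_lt_trans gp).
have /andP[s0 s1] := asin_bounds g01; have c0 := cos_asin_gt0 g01.
have h := le_inv_pi gp.
have VP : V g pi < V g (asin g).
  by rewrite /V cospi; have := mulr_gt0 g0 s0; lra.
rewrite ltNge; apply/negP; rewrite le_eqVlt => /orP[/eqP em|mp].
  by rewrite em in e; rewrite e ltxx in VP.
have := V_inc g01 (ltW m1) (_ : pi <= 2 * pi + asin g) mp; rewrite e => H.
have := H ltac:(lra); lra.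
Qed.

Lemma gamma_1_fun_root g : 0 < g < 1 ->
  (cos (phi_max g) + 1 = 2 * pi * g) <-> (g <= pi^-1 /\ gamma_1_fun g = 0).
Proof.
move=> g01; have tm := phi_max_turning g01; have /andP[g0 g1] := g01.
have sq : Num.sqrt (1 - g ^+ 2) = cos (asin g) by rewrite cos_asin//; apply/andP; split; lra.
have p0 := @pi_gt0 R.
split=> [e|[gp G0]].
  have gp : g <= pi^-1 by apply: ge_inv_pi; have := cos_le1 (phi_max g); lra.
  split => //; have mp := turning_gt_pi g0 gp tm.
  have [/andP[m1 m2] em] := tm.
  have am : acos (2 * pi * g - 1) = 2 * pi - phi_max g.
    rewrite (_ : 2 * pi * g - 1 = cos (2 * pi - phi_max g)).
      by rewrite cosK// in_itv /=; apply/andP; split; lra.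
    by rewrite cos_2pi_sub; lra.
  rewrite /gamma_1_fun /turning_candidate am sq.
  by move: em; rewrite /V; lra.
pose M := turning_candidate g.
have b : -1 <= 2 * pi * g - 1 <= 1.
  have := le_inv_pi gp; have := mulr_gt0 p0 g0; move=> *; apply/andP; split; lra.
have cM : cos M = 2 * pi * g - 1.
  by rewrite /M /turning_candidate cos_2pi_sub acosK// in_itv.
have VM : V g M = V g (asin g).
  by rewrite /V cM; move: G0; rewrite /gamma_1_fun -/M sq; lra.
have M1 : pi <= M by rewrite /M /turning_candidate; have := acos_lepi b; lra.
have M2 : M <= 2 * pi by rewrite /M /turning_candidate; have := acos_ge0 b; lra.
have /andP[s0 s1] := asin_bounds g01.
(* [turning] asks for a point strictly below 2 pi; there V already exceeds the saddle level. *)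
have M3 : M != 2 * pi.
  apply/eqP => h; have := V_gt_right g01 tm (x := M); rewrite h; have [/andP[m1 m2] _] := tm.
  by move=> /(_ m2 ltac:(lra)); rewrite -h VM ltxx.
have tM : turning g M by split=> //; rewrite [M < _]lt_neqAle M3 M2 !andbT; lra.
by rewrite (turning_uniq g01 tm tM : M = phi_max g) in cM; rewrite cM; lra.
Qed.

(** The subtracted term has derivative asin g <= pi/2, less than the slope 2 pi of the first term,
    and the product in between is nondecreasing. *)
Lemma gamma_1_fun_incr g g' : 0 <= g -> g < g' -> g' <= pi^-1 ->
  gamma_1_fun g < gamma_1_fun g'.
Proof.
move=> g0 gg gp; have p0 := @pi_gt0 R; have /andP[_ ip] := inv_pi.
have hp := le_inv_pi gp.
have pg0 : 0 <= pi * g by rewrite mulr_ge0// ltW.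
have pgg : pi * g < pi * g' by rewrite ltr_pM2l.
have M1 : turning_candidate g <= turning_candidate g'.
  by rewrite /turning_candidate lerD2l lerN2; apply: acos_le; lra.
have M0 : 0 <= turning_candidate g.
  rewrite /turning_candidate; have : acos (2 * pi * g - 1) <= pi.
    by apply: acos_lepi; apply/andP; split; lra.
  lra.
pose W (x : R) := Num.sqrt (1 - x ^+ 2) + x * asin x.
have dW x : 0 <= x -> x < 1 -> is_derive x 1 W (asin x).
  move=> x0 x1.
  have hx : -1 < x < 1 by apply/andP; split; lra.
  have d1 := is_derive1_asin hx.
  have sp : 0 < 1 - x ^+ 2 by nra.
  have d2 : is_derive x 1 (fun x : R => 1 - x ^+ 2) (- (2 * x)) by deriv; ring.
  have d3 := @is_derive_sqrtx R (fun x : R => 1 - x ^+ 2) x _ sp d2.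
  have nz : Num.sqrt (1 - x ^+ 2) != 0 by rewrite gt_eqF// sqrtr_gt0.
  by rewrite /W; deriv; field.
have hW : W g' - W g <= pi / 2 * (g' - g).
  have [x /andP[x1 x2]|x /andP[x1 x2]|c [/andP[c1 c2] ->]] := @mean_value R W asin g g' gg.
  - by apply: is_derive_cont (dW x _ _); lra.
  - by apply: dW; lra.
  apply: ler_wpM2r; first lra.
  by apply: asin_lepi2; apply/andP; split; lra.
have : g * turning_candidate g <= g' * turning_candidate g'.
  by apply: ler_pM => //; exact: ltW.
rewrite /gamma_1_fun; move: hW; rewrite /W => hW hM.
have := ltr_pM2l p0 g g'; nra.
Qed.

Lemma continuous_gamma_1_fun g : 0 < g -> g < pi^-1 -> {for g, continuous gamma_1_fun}.
Proof.
move=> g0 gp; have /andP[_ ip] := inv_pi; have p0 := @pi_gt0 R.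
have pg : pi * g < 1.
  by have : pi * g < pi * pi^-1 by [rewrite ltr_pM2l]; rewrite divff ?gt_eqF.
have pg0 := mulr_gt0 p0 g0.
have hg : -1 < g < 1 by apply/andP; split; lra.
have d1 := is_derive1_asin hg.
have sp : 0 < 1 - g ^+ 2 by nra.
have d2 : is_derive g 1 (fun x : R => 1 - x ^+ 2) (- (2 * g)) by deriv; ring.
have d3 := @is_derive_sqrtx R (fun x : R => 1 - x ^+ 2) g _ sp d2.
have ha : -1 < 2 * pi * g - 1 < 1 by apply/andP; split; lra.
have d4 : is_derive g 1 (fun x : R => 2 * pi * x - 1) (2 * pi) by deriv; ring.
have d5 := is_derive_compx d4 (is_derive1_acos ha).
have c3 := is_derive_cont d3; have c5 := is_derive_cont d5; have c1 := is_derive_cont d1.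
apply: cvgB; last by apply: cvgD; [exact: c3|apply: cvgM; [exact: cvg_id|exact: c1]].
apply: cvgD; first exact: (is_derive_cont d4).
apply: cvgM; first exact: cvg_id.
by apply: cvgB; [exact: cvg_cst|exact: c5].
Qed.

Lemma cos_pihalf_sub x : cos (pi / 2 - x) = sin x.
Proof. by rewrite cosB cos_pihalf sin_pihalf; ring. Qed.

Lemma acos_ge_sub y t : 0 <= t <= 1 -> -1 <= y -> y <= t - t ^+ 3 / 6 ->
  pi / 2 - t <= acos y.
Proof.
move=> /andP[t0 t1] y1 yt; have p2 := @pi_ge2 R.
rewrite -[leLHS]cosK; last by rewrite in_itv /=; apply/andP; split; lra.
apply: acos_le => //.
by rewrite cos_pihalf_sub; apply: le_trans (sin_ge_cube t0).
Qed.

Lemma acos_le_sub y t : 0 <= t <= 1 -> t <= y -> y <= 1 -> acos y <= pi / 2 - t.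
Proof.
move=> /andP[t0 t1] ty y1; have p2 := @pi_ge2 R.
rewrite -[leRHS]cosK; last by rewrite in_itv /=; apply/andP; split; lra.
apply: acos_le => //; first exact: cos_geN1.
by rewrite cos_pihalf_sub; apply: le_trans (sin_le_id t0) ty.
Qed.

Lemma asin_ge_id g : 0 < g < 1 -> g <= asin g.
Proof.
move=> g01; have /andP[s0 _] := asin_bounds g01.
by rewrite -{1}(sin_asin g01) sin_le_id// ltW.
Qed.

Lemma asin_le_cube g t : 0 < g < 1 -> 0 <= t <= 1 -> g <= t - t ^+ 3 / 6 -> asin g <= t.
Proof.
move=> g01 /andP[t0 t1] h; have /andP[s0 s1] := asin_bounds g01; have p2 := @pi_ge2 R.
rewrite leNgt; apply/negP => lt.
have : sin t < sin (asin g) by rewrite ltr_sin// in_itv /=; apply/andP; split; lra.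
by rewrite (sin_asin g01) ltNge (le_trans h)// sin_ge_cube.
Qed.

Lemma sqrt_ge x y : 0 <= x -> x ^+ 2 <= y -> x <= Num.sqrt y.
Proof.
by move=> x0 h; rewrite -[leLHS]ger0_norm// -sqrtr_sqr ler_sqrt// (le_trans _ h)// sqr_ge0.
Qed.

Lemma sqrt_le x y : 0 <= x -> y <= x ^+ 2 -> Num.sqrt y <= x.
Proof.
by move=> x0 h; rewrite -[leRHS]ger0_norm// -sqrtr_sqr ler_sqrt// sqr_ge0.
Qed.

(** With 3.1 < pi < 3.2, the number 0.14 exceeds the arcsine of 2 pi g - 1 = 0.35 pi - 1, and 0.984
    is below the square root. *)
Lemma gamma_1_fun_lo g : g = 175 / 1000 -> gamma_1_fun g < 0.
Proof.
move=> gE; have p1 := pi_gt31; have p2 := pi_lt32.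
have e0 : 0 < g < 1 by rewrite gE; apply/andP; split; lra.
have s2 := asin_ge_id e0.
have sq : 984 / 1000 <= Num.sqrt (1 - g ^+ 2) by apply: sqrt_ge; rewrite ?gE; lra.
have ac : pi / 2 - 14 / 100 <= acos (2 * pi * g - 1).
  by apply: acos_ge_sub; rewrite ?gE; [apply/andP; split|..]; lra.
move: ac sq s2; rewrite /gamma_1_fun /turning_candidate.
move: (acos _) (Num.sqrt _) (asin g) => A S W; rewrite gE; move: (pi : R) p1 p2 => p; lra.
Qed.

(** Here 0.1 bounds the arcsine of 0.37 pi - 1 from below, while 0.2 and 0.9828 bound asin g and the
    square root from above. *)
Lemma gamma_1_fun_hi g : g = 185 / 1000 -> 0 < gamma_1_fun g.
Proof.
move=> gE; have p1 := pi_gt31; have p2 := pi_lt32.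
have e0 : 0 < g < 1 by rewrite gE; apply/andP; split; lra.
have s2 : asin g <= 2 / 10.
  by apply: asin_le_cube => //; rewrite ?gE; [apply/andP; split|]; lra.
have sq : Num.sqrt (1 - g ^+ 2) <= 9828 / 10000 by apply: sqrt_le; rewrite ?gE; lra.
have ac : acos (2 * pi * g - 1) <= pi / 2 - 1 / 10.
  apply: acos_le_sub; first by clear; apply/andP; split; lra.
    by rewrite gE; clear -p1; lra.
  by rewrite gE; clear -p2; lra.
move: ac sq s2; rewrite /gamma_1_fun /turning_candidate.
move: (acos _) (Num.sqrt _) (asin g) => A S W; rewrite gE; move: (pi : R) p1 p2 => p; lra.
Qed.

(** Sign change between 0.175 and 0.185, hence the stated accuracy; uniqueness by strict
    monotonicity, as every solution satisfies g <= 1/pi. *)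
Lemma gamma_1_exists : exists g1 : R,
  [/\ gamma_1_equation g1, forall g, gamma_1_equation g -> g = g1,
      `|g1 - 18 / 100| < 5 / 1000 & turning_candidate g1 = phi_max g1].
Proof.
have p1 := pi_gt31; have p2 := pi_lt32; have /andP[_ ip] := inv_pi.
have ip3 : 3 / 10 < pi^-1 :> R.
  by rewrite -[pi^-1]mul1r ltr_pdivlMr ?pi_gt0//; lra.
have lo := gamma_1_fun_lo (erefl _); have hi := gamma_1_fun_hi (erefl _).
have [|x /andP[x1 x2]||g1 /andP[g11 g12] e] := @IVT_val R gamma_1_fun (175 / 1000) (185 / 1000) 0.
- lra.
- by apply: continuous_gamma_1_fun; lra.
- by left; rewrite !ltW.
have n1 : g1 != 175 / 1000 by apply/eqP => h; move: lo; rewrite -h e ltxx.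
have n2 : g1 != 185 / 1000 by apply/eqP => h; move: hi; rewrite -h e ltxx.
have l1 : 175 / 1000 < g1 by rewrite lt_neqAle eq_sym n1.
have l2 : g1 < 185 / 1000 by rewrite lt_neqAle n2.
clear lo hi n1 n2 g11 g12 p1 p2.
have g10 : 0 < g1 by apply: lt_trans l1; clear; lra.
have g1p : g1 <= pi^-1 by apply: ltW; apply: lt_trans l2 _; apply: lt_trans ip3; clear; lra.
have num : `|g1 - 18 / 100| < 5 / 1000.
  by rewrite ltr_norml; apply/andP; clear -l1 l2; split; lra.
clear l1 l2 ip3.
have g01 : 0 < g1 < 1 by rewrite g10 (le_lt_trans g1p).
have eq1 : cos (phi_max g1) + 1 = 2 * pi * g1 by apply/(gamma_1_fun_root g01).
exists g1; split => //.
  move=> g [g01' /(gamma_1_fun_root g01')[gp G0]]; have /andP[g0 _] := g01'.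
  have [h|h|//] := ltgtP g g1.
    by have := gamma_1_fun_incr (ltW g0) h g1p; rewrite e G0 ltxx.
  by have := gamma_1_fun_incr (ltW g10) h gp; rewrite e G0 ltxx.
have tm := phi_max_turning g01.
have mp := turning_gt_pi g10 g1p tm; have [/andP[m1 m2] _] := tm.
rewrite /turning_candidate (_ : 2 * pi * g1 - 1 = cos (2 * pi - phi_max g1)).
  by rewrite cosK ?in_itv /=; [ring|apply/andP; split; lra].
by rewrite cos_2pi_sub -eq1 addrK.
Qed.

End GammaOne.

(** * The eigenvalue zero *)

Section Wronskian.
Context {R : realType}.
Notation mu := (@lebesgue_measure R).
Implicit Types (f u v w q phi : R -> R) (L lam a b c x y : R).

Lemma integrable_small_on (k : R -> R) a c : mu.-integrable `[a, +oo[ (EFin \o k) -> 0 < c ->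
  (forall x, a <= x -> 0 <= k x) -> exists2 x, a <= x & k x < c.
Proof.
move=> ik c0 k0.
have ik' := (@integrable_mkcond _ _ R mu _ _ (measurable_itv _)).1 ik.
have [|x|x ax kx] := @integrable_small_right R (k \_ `[a, +oo[) a c _ c0.
- by apply: eq_integrable ik' => // x _; rewrite /= !patchE; case: ifP.
- by rewrite patchE; case: ifPn => //; rewrite inE /= in_itv /= andbT => /k0.
by exists x => //; move: kx; rewrite patchE mem_set //= in_itv /= ax.
Qed.

(** The four squares are summed before a point is chosen, so that one point serves for both
    solutions and both derivatives. *)
Lemma decaying_small u (u1 : R -> R) v (v1 : R -> R) a c : decaying u u1 -> decaying v v1 ->
  0 < c -> exists2 x, a <= x & u x ^+ 2 + u1 x ^+ 2 + v x ^+ 2 + v1 x ^+ 2 < c.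
Proof.
move=> [iu iu1] [iv iv1] c0; apply: integrable_small_on => //; last first.
  by move=> x _; rewrite !addr_ge0 ?sqr_ge0.
have D2 := @integrableD _ _ R mu `[a, +oo[%classic (@measurable_itv R `[a, +oo[).
have i1 := D2 _ _ (iu a) (iu1 a); have i2 := D2 _ _ i1 (iv a).
by apply: eq_integrable (D2 _ _ i2 (iv1 a)).
Qed.

Lemma wronskian_bound (p q r s : R) : `|p * s - q * r| <= p ^+ 2 + q ^+ 2 + r ^+ 2 + s ^+ 2.
Proof.
rewrite ler_norml; apply/andP; split.
  have := sqr_ge0 (p + s); have := sqr_ge0 (q - r).
  have := sqr_ge0 p; have := sqr_ge0 q; have := sqr_ge0 r; have := sqr_ge0 s; lra.
have := sqr_ge0 (p - s); have := sqr_ge0 (q + r).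
have := sqr_ge0 p; have := sqr_ge0 q; have := sqr_ge0 r; have := sqr_ge0 s; lra.
Qed.

Lemma wronskian_continuous u (u1 : R -> R) v (v1 : R -> R) : continuous u -> continuous u1 ->
  continuous v -> continuous v1 -> continuous (fun x => u x * v1 x - u1 x * v x).
Proof.
move=> cu cu1 cv cv1 x; apply: cvgB; apply: cvgM; [exact: cu|exact: cv1|exact: cu1|exact: cv].
Qed.

(** The Wronskian is constant and takes arbitrarily small values. Hence the decaying solutions on a
    half-line form a space of dimension at most one. *)
Lemma wronskian_zero q a u (u1 : R -> R) v (v1 : R -> R) :
  half_sol q a u u1 -> half_sol q a v v1 -> decaying u u1 -> decaying v v1 ->
  u a * v1 a - u1 a * v a = 0.
Proof.
move=> [cu cu1 du] [cv cv1 dv] Du Dv.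
pose W x := u x * v1 x - u1 x * v x.
have cW : continuous W by exact: wronskian_continuous.
have Wa x : a <= x -> W a = W x.
  move=> ax; apply: derive_0_eq => // [y _|y /andP[ay _]]; first exact: cW.
  have [d1 d2] := du y ay; have [d3 d4] := dv y ay.
  have d := is_deriveBx (is_deriveMx d1 d4) (is_deriveMx d2 d3).
  by apply: (is_derive_eqx d); ring.
apply/eqP; rewrite -normr_le0 -[_ - _]/(W a); apply/ler_addgt0Pr => e e0; rewrite add0r.
have [x ax hx] := decaying_small a Du Dv e0.
rewrite (Wa x ax); apply: le_trans (ltW hx); rewrite /W.
have := wronskian_bound (u x) (u1 x) (v x) (v1 x); lra.
Qed.

Lemma half_sol_zero q a u (u1 : R -> R) B : half_sol q a u u1 -> (forall x, `|q x| <= B) ->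
  u a = 0 -> u1 a = 0 -> forall x, a <= x -> u x = 0 /\ u1 x = 0.
Proof.
move=> [cu cu1 d] qB ua u1a x ax.
have B0 : 0 <= B by apply: le_trans (qB 0).
pose e y := u y ^+ 2 + u1 y ^+ 2.
have : e x = 0.
  apply: (@gronwall_zero R e (fun y => 2 * u y * u1 y + 2 * u1 y * (q y * u y)) a (1 + B) a) => //.
  - by move=> y _; apply: cvgD; [exact: (continuous_sq cu)|exact: (continuous_sq cu1)].
  - by move=> y ay; have [d1 d2] := d y ay; rewrite /e; deriv.
  - move=> y ay; rewrite (_ : _ + _ = (1 + q y) * (2 * u y * u1 y)); last by ring.
    rewrite normrM; apply: ler_pM => //.
      by apply: le_trans (ler_normD _ _) _; rewrite normr1 lerD2l.
    rewrite /e ler_norml; apply/andP; split.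
      by have := sqr_ge0 (u y + u1 y); lra.
    by have := sqr_ge0 (u y - u1 y); lra.
  - by move=> y _; rewrite /e addr_ge0// sqr_ge0.
  by rewrite /e ua u1a !expr0n addr0.
move=> /eqP; rewrite /e paddr_eq0 ?sqr_ge0// !sqrf_eq0.
by move=> /andP[/eqP -> /eqP ->].
Qed.

Lemma half_sol_scale q a u (u1 : R -> R) b : half_sol q a u u1 ->
  half_sol q a (fun x => b * u x) (fun x => b * u1 x).
Proof.
move=> [cu cu1 d]; split.
- by move=> x; apply: cvgM; [exact: cvg_cst|exact: cu].
- by move=> x; apply: cvgM; [exact: cvg_cst|exact: cu1].
move=> x ax; have [d1 d2] := d x ax; have c0 := @is_derive_cstx R b x.
split; first by apply: (is_derive_eqx (is_deriveMx c0 d1)); ring.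
by apply: (is_derive_eqx (is_deriveMx c0 d2)); ring.
Qed.

Lemma decaying_scale u (u1 : R -> R) b : decaying u u1 ->
  decaying (fun x => b * u x) (fun x => b * u1 x).
Proof.
move=> [iu iu1].
have sc f : (forall a, sq_int_right a f) -> forall a, sq_int_right a (fun x => b * f x).
  move=> h a.
  have := @integrableZl _ _ R mu `[a, +oo[%classic (@measurable_itv R `[a, +oo[) (b ^+ 2) _ (h a).
  rewrite /sq_int_right.
  by apply: eq_integrable => // x _; rewrite /= exprMn.
by split; apply: sc.
Qed.

Section Eigenfunction_halves.
Variables (L : R) (phi : R -> R) (lam : R) (v v1 : R -> R).
Hypotheses (L0 : 0 < L) (ev : eigenfunction L phi lam v v1).

Lemma eigenfunction_right : half_sol (fun x => cos (phi x) + lam) L v v1 /\ decaying v v1.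
Proof.
have [[cv cv1] d [/L2P[_ i] /L2P[_ i1]] _] := ev; split.
  split=> // x Lx; have := d x; rewrite /coef D_out ?mul1r ?gtr0_norm ?(lt_trans L0)//.
    by apply; rewrite gt_eqF.
  exact: ltW.
by split=> a; [apply: integrableS i|apply: integrableS i1].
Qed.

Lemma sq_int_left f a : continuous f ->
  mu.-integrable setT (EFin \o (fun x => f x ^+ 2)) -> sq_int_right a (fun x => f (- x)).
Proof.
move=> cf i; have cn := continuous_neg cf.
have i' : mu.-integrable `]-oo, (- a)] (EFin \o (fun x => f x ^+ 2)) by apply: integrableS i.
apply/integrableP; split.
  by apply/measurable_EFinP; apply: measurable_funTS; apply: continuous_measurable_fun; exact: continuous_sq.
have := @ge0_integration_by_substitutionNy R (fun x => f x ^+ 2) a.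
move=> /(_ (continuous_subspaceT (continuous_sq cf)) (fun x _ => sqr_ge0 _)) e.
move/integrableP : i' => [_]; apply: le_lt_trans.
under eq_integral do rewrite /= ger0_norm ?sqr_ge0//.
under [leRHS]eq_integral do rewrite /= ger0_norm ?sqr_ge0//.
by rewrite e.
Qed.

Lemma eigenfunction_left :
  half_sol (fun x => cos (phi (- x)) + lam) L (fun x => v (- x)) (fun x => - v1 (- x)) /\
  decaying (fun x => v (- x)) (fun x => - v1 (- x)).
Proof.
have [[cv cv1] d [/L2P[_ i] /L2P[_ i1]] _] := ev; split.
  split; [exact: continuous_neg|by move=> x; apply: cvgN; exact: (continuous_neg cv1)|].
  move=> x Lx; have xL : `|- x| = x by rewrite normrN gtr0_norm// (lt_trans L0).
  have := d (- x); rewrite /coef D_out ?mul1r ?xL ?(ltW Lx)// gt_eqF// => /(_ isT)[d1 d2].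
  have dn : is_derive x 1 (fun x => - x) (- 1 : R) by deriv.
  split; first by apply: (is_derive_eqx (is_derive_compx dn d1)); ring.
  by apply: (is_derive_eqx (is_deriveNx (is_derive_compx dn d2))); ring.
split=> a; first exact: sq_int_left.
have := sq_int_left a cv1 i1; rewrite /sq_int_right.
by apply: eq_integrable => // x _; rewrite /= sqrrN.
Qed.

End Eigenfunction_halves.

(* On |x| < L a solution with [lam = 0] is affine; the determinant expresses that
   it joins the two decaying solutions. *)
Lemma zero_eigenvalue_iff L phi r (r1 : R -> R) s (s1 : R -> R) : 0 < L -> continuous phi ->
  half_sol (fun x => cos (phi x)) L r r1 -> decaying r r1 ->
  half_sol (fun x => cos (phi (- x))) L s s1 -> decaying s s1 ->
  (r L != 0) || (r1 L != 0) -> (s L != 0) || (s1 L != 0) ->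
  is_eigenvalue L phi 0 <-> (s L - 2 * L * s1 L) * r1 L + s1 L * r L = 0.
Proof.
move=> L0 cp hr dr hs ds nr ns.
have q0 (q : R -> R) : (fun x => q x + 0) = q by apply/funext => x; rewrite addr0.
split.
  move=> /(eigenvalue_eigenfunction L0 cp)[v [v1 ev]].
  have [hvr dvr] := eigenfunction_right L0 ev; have [hvl dvl] := eigenfunction_left L0 ev.
  rewrite (q0 (fun x => cos (phi x))) in hvr.
  rewrite (q0 (fun x => cos (phi (- x)))) in hvl.
  have wr := wronskian_zero hvr hr dvr dr.
  have wl := wronskian_zero hvl hs dvl ds.
  have [[cv cv1] d _ [x0 nz]] := ev.
  (* Inside the inhomogeneity the eigenfunction is affine, up to and including the edges. *)
  have mid x y : - L <= x -> x <= y -> y <= L -> v1 x = v1 y /\ v y - v x = (y - x) * v1 x.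
    move=> Lx; rewrite le_eqVlt => /orP[/eqP <- _|xy yL]; first by rewrite !subrr mul0r.
    have e x' y' : - L <= x' -> x' <= y' -> y' <= L -> v1 x' = v1 y'.
      move=> h1 h2 h3; apply: derive_0_eq => // [z _|z /andP[z1 z2]]; first exact: cv1.
      have zL : `|z| < L by rewrite ltr_norml; apply/andP; split; lra.
      have [|_ h] := d z; first by rewrite lt_eqF.
      by apply: (is_derive_eqx h); rewrite /coef D_in// mul0r add0r mul0r.
    split; first by apply: e => //; exact: ltW.
    have [z _|z /andP[z1 z2]|z [/andP[z1 z2] ->]] := @mean_value R v v1 x y xy.
    - exact: cv.
    - have zL : `|z| < L by rewrite ltr_norml; apply/andP; split; lra.
      by have [|] := d z; rewrite ?lt_eqF.
    by rewrite (e x z Lx (ltW z1) (le_trans (ltW z2) yL)) mulrC.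
  have [e1 e2] := mid (- L) L (lexx _) ltac:(lra) (lexx _).
  have cb (q : R -> R) x : `|cos (q x)| <= 1 by exact: cos_max.
  have nzL : (v (- L) != 0) || (v1 (- L) != 0).
    apply/negP => /negP; rewrite negb_or !negbK => /andP[/eqP a1 /eqP a2].
    move/negP: nz; apply; apply/eqP.
    have [h|h] := leP x0 (- L).
      have a2' : - v1 (- L) = 0 by rewrite a2 oppr0.
      have Lx0 : L <= - x0 by lra.
      by have [] := half_sol_zero hvl (cb (fun x => phi (- x))) a1 a2' Lx0; rewrite opprK.
    have z x : - L <= x -> x <= L -> v x = 0 /\ v1 x = 0.
      move=> h1 h2; have [h3 h4] := mid (- L) x (lexx _) h1 h2.
      by rewrite -h3 a2; move: h4; rewrite a1 a2 mulr0 subr0.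
    have [h'|h'] := leP x0 L; first by have [] := z x0 (ltW h) h'.
    have [z1 z2] := z L ltac:(lra) (lexx _).
    by have [] := half_sol_zero hvr (cb phi) z1 z2 (ltW h').
  rewrite -e1 in wr; rewrite /= in wl.
  have vL : v L = v (- L) + 2 * L * v1 (- L) by lra.
  rewrite vL in wr; move: wr wl nzL ns.
  move: (v (- L)) (v1 (- L)) (s L) (s1 L) (r L) (r1 L) => A B p q m n h1 h2 nAB npq.
  (* both [(A, B)] and [(p, - q)] are non-zero and parallel *)
  have [A0|A0] := eqVneq A 0.
    move: nAB h2 h1; rewrite A0 eqxx /= => B0 h2 h1.
    have p0 : p = 0 by apply: (mulfI B0); rewrite mulr0; lra.
    apply: (mulfI B0); rewrite mulr0 p0.
    by transitivity (- q * ((0 + 2 * L * B) * n - B * m)); [ring|rewrite h1 mulr0].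
  apply: (mulfI A0); rewrite mulr0.
  have qE : A * q = - (B * p) by lra.
  transitivity (p * ((A + 2 * L * B) * n - B * m)); last by rewrite h1 mulr0.
  rewrite mulrDr !mulrA (mulrC A (p - _)) mulrBl.
  have -> : 2 * L * q * A = 2 * L * (A * q) by ring.
  by rewrite qE; ring.
move=> det.
(* The multiple of the right solution that continues the affine piece. The vanishing determinant
   makes the two data at [L] parallel; the division is by whichever component of (r, r') does not
   vanish. *)
pose b : R := if r L != 0 then (s L - 2 * L * s1 L) / r L else - s1 L / r1 L.
have b1 : b * r L = s L - 2 * L * s1 L.
  rewrite /b; case: ifPn => h; first by rewrite divfK.
  move: nr; rewrite (negbTE h) /= => n1; move: h; rewrite negbK => /eqP h.
  rewrite h mulr0; apply/esym/eqP; move/eqP: det; rewrite h mulr0 addr0 mulf_eq0 (negbTE n1) orbF.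
  by [].
have b2 : b * r1 L = - s1 L.
  rewrite /b; case: ifPn => h.
    apply: (mulfI h); have e : r L * (r L)^-1 = 1 by rewrite divff.
    transitivity ((s L - 2 * L * s1 L) * r1 L * (r L * (r L)^-1)); first by ring.
    by rewrite e; lra.
  by move: nr; rewrite (negbTE h) /= => n1; rewrite divfK.
have [cr cr1 dr1] := hr; have [cs cs1 ds1] := hs; have [ir ir1] := dr.
apply: (@glued_eigenvalue R L phi 0 (fun x => b * r x) (fun x => b * r1 x) s s1
  (fun x => s L - (x + L) * s1 L) (fun=> - s1 L)) => //.
- by rewrite (q0 (fun x => cos (phi x))); exact: half_sol_scale.
- exact: decaying_scale.
- by rewrite (q0 (fun x => cos (phi (- x)))).
- move=> x; apply: cvgB; first exact: cvg_cst.
  by apply: cvgM; [apply: cvgD; [exact: cvg_id|exact: cvg_cst]|exact: cvg_cst].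
- by move=> x; exact: cvg_cst.
- by move=> x _; split; [deriv; ring|rewrite mul0r; exact: is_derive_cstx].
- by rewrite b1; ring.
- by rewrite addNr mul0r subr0.
(* If [s] vanished beyond [L], so would s', and both would vanish at [L] by continuity. *)
right; apply: contrapT => H.
have s0 x : L < x -> s x = 0.
  by move=> Lx; apply/eqP; apply: contrapT => /negP h; apply: H; exists x.
have sL : s L = 0.
  apply/eqP; rewrite -normr_le0; apply/ler_addgt0Pr => e e0; rewrite add0r.
  have [dl dl0 Hd] := continuous_at_dist (@cs L) e0.
  have := Hd (L + dl / 2); rewrite s0; last lra.
  by rewrite sub0r normrN addrC addKr gtr0_norm ?divr_gt0// => h; apply: ltW; apply: h; lra.
have s1x x : L < x -> s1 x = 0.
  move=> Lx; have [d1 _] := ds1 x Lx.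
  have c0 : is_derive x 1 (fun=> 0 : R) (0 : R) by exact: is_derive_cstx.
  apply: (is_derive_uniq d1); apply: near_eq_is_derive c0.
  by near=> y; rewrite s0//; near: y; exact: lt_nbhsr.
have s1L : s1 L = 0.
  apply/eqP; rewrite -normr_le0; apply/ler_addgt0Pr => e e0; rewrite add0r.
  have [dl dl0 Hd] := continuous_at_dist (@cs1 L) e0.
  have := Hd (L + dl / 2); rewrite s1x; last lra.
  by rewrite sub0r normrN addrC addKr gtr0_norm ?divr_gt0// => h; apply: ltW; apply: h; lra.
by move: ns; rewrite sL s1L eqxx.
Unshelve. all: by end_near. Qed.

End Wronskian.

(** * Pinned fluxons *)

Section Fluxon.
Context {R : realType}.
Implicit Types (x y : R).
Variables (g L h : R) (phi : R -> R).
Hypotheses (g0 : 0 <= g) (L0 : 0 < L) (pf : pinned_fluxon g L phi)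
  (fp : fluxon_parameter g L phi h).
Local Notation p := (derive1 phi).

Lemma fluxon_derive x : is_derive x 1 phi (p x).
Proof. by have [[d _] _ _ _] := pf; exact: is_derive_derive1. Qed.

Lemma fluxon_continuous : continuous phi.
Proof. by move=> x; exact: is_derive_cont (fluxon_derive x). Qed.

Lemma fluxon_p_continuous : continuous p.
Proof. by have [[_ c] _ _ _] := pf. Qed.

Lemma fluxon_derive2 (x : R) : `|x| != L -> is_derive x 1 p (D L x * sin (phi x) - g).
Proof.
have [_ d _ _] := pf; move=> /d[d1 e].
by apply: (is_derive_eqx (is_derive_derive1 d1)); lra.
Qed.

Lemma fluxon_derive2_out (x : R) : L < `|x| -> is_derive x 1 p (sin (phi x) - g).
Proof.
move=> Lx; have hx : `|x| != L by rewrite gt_eqF.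
by apply: (is_derive_eqx (fluxon_derive2 hx)); rewrite D_out ?mul1r// ltW.
Qed.

Lemma fluxon_derive2_in (x : R) : `|x| < L -> is_derive x 1 p (- g).
Proof.
move=> Lx; have hx : `|x| != L by rewrite lt_eqF.
by apply: (is_derive_eqx (fluxon_derive2 hx)); rewrite D_in// mul0r add0r.
Qed.

Lemma fluxon_right : stable g (asin g + 2 * pi) L phi p.
Proof.
have [_ _ _ lr] := pf; split => //; split; [exact: fluxon_continuous|exact: fluxon_p_continuous|].
move=> x Lx; split; first exact: fluxon_derive.
by apply: fluxon_derive2_out; rewrite gtr0_norm// (lt_trans L0).
Qed.

Lemma fluxon_left : stable g (asin g) L (fun x => phi (- x)) (fun x => - p (- x)).
Proof.
have [_ _ ll _] := pf; split; last exact/cvgNy_compNP.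
split; [exact: continuous_neg fluxon_continuous| |].
  by move=> x; apply: cvgN; exact: continuous_neg fluxon_p_continuous x.
move=> x Lx; have dn : is_derive x 1 (fun x => - x) (- 1 : R) by deriv.
split; first by apply: (is_derive_eqx (is_derive_compx dn (fluxon_derive _))); ring.
have Lx' : L < `|- x| by rewrite normrN gtr0_norm// (lt_trans L0).
by apply: (is_derive_eqx (is_deriveNx (is_derive_compx dn (fluxon_derive2_out Lx')))); ring.
Qed.

(** The limit of an orbit is an equilibrium. This excludes g > 1, where [asin] has a default
    value. *)
Lemma fluxon_sin_asin : sin (asin g) = g.
Proof. by have [orb l] := fluxon_left; have [] := orbit_limit orb l. Qed.

Lemma fluxon_g_le1 : g <= 1.
Proof. by rewrite -fluxon_sin_asin; exact: sin_le1. Qed.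

(** So [H_0] + 1 is the energy of the saddle reached at the right end. *)
Lemma fluxon_H0 : H_0 g = V g (asin g) - 1 + 2 * pi * g.
Proof.
rewrite /H_0 /V cos_asin; first by ring.
by apply/andP; split; [have := g0; lra|exact: fluxon_g_le1].
Qed.

Lemma fluxon_energy_left x : L <= x ->
  p (- x) ^+ 2 / 2 + V g (phi (- x)) = V g (asin g).
Proof.
have [orb l] := fluxon_left; have [_ E] := orbit_limit orb l.
by move=> /E <-; rewrite /energy sqrrN.
Qed.

Lemma fluxon_energy_right x : L <= x ->
  p x ^+ 2 / 2 + V g (phi x) = H_0 g + 1.
Proof.
have [orb l] := fluxon_right; have [_ E] := orbit_limit orb l.
move=> /E; rewrite /energy => ->; rewrite fluxon_H0 /V cos_D2pi; ring.
Qed.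

Lemma fluxon_in x y : - L <= x -> x <= L -> - L <= y -> y <= L ->
  p x + g * x = p y + g * y.
Proof.
move=> x1 x2 y1 y2.
have key a b : - L <= a -> b <= L -> a <= b -> p a + g * a = p b + g * b.
  move=> aL bL ab; apply: (@derive_0_eq R (fun x => p x + g * x)) => // [z _|z /andP[z1 z2]].
    apply: cvgD; first exact: fluxon_p_continuous.
    by apply: cvgM; [exact: cvg_cst|exact: cvg_id].
  have zL : `|z| < L by rewrite ltr_norml; apply/andP; split; lra.
  have d := fluxon_derive2_in zL.
  by deriv; ring.
by have [xy|/ltW yx] := leP x y; [|symmetry]; apply: key.
Qed.

Lemma fluxon_p_out : p L = p (- L) - 2 * g * L.
Proof. by have L1 := L0; have := @fluxon_in L (- L) ltac:(lra) (lexx _) (lexx _) ltac:(lra); lra. Qed.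

(** [fluxon_parameter] concerns the open interval; continuity carries the conserved quantity to the
    edges, where it meets the outer energies. *)
Lemma fluxon_energy_in x : - L <= x -> x <= L -> p x ^+ 2 / 2 + g * phi x = H_0 g + h.
Proof.
have key a b : - L <= a -> b <= L -> a <= b ->
    p a ^+ 2 / 2 + g * phi a = p b ^+ 2 / 2 + g * phi b.
  move=> aL bL ab.
  apply: (@derive_0_eq R (fun x => p x ^+ 2 / 2 + g * phi x)) => // [z _|z /andP[z1 z2]].
    apply: cvgD; apply: cvgM; [exact: (continuous_sq fluxon_p_continuous)|exact: cvg_cst|exact: cvg_cst|exact: fluxon_continuous].
  have zL : `|z| < L by rewrite ltr_norml; apply/andP; split; lra.
  have d := fluxon_derive2_in zL; have d0 := fluxon_derive z.
  apply: (is_derive_eqx (is_deriveDx (is_deriveMx (is_derive_sqrx d) (is_derive_cstx 2^-1 z)) (is_deriveMx (is_derive_cstx g z) d0))).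
  by field.
move=> x1 x2; have l0 : `|0 : R| < L by rewrite normr0.
rewrite -(fp l0); have [x3|/ltW x3] := leP x 0; [apply: key|symmetry; apply: key] => //; lra.
Qed.

(** At an edge the inner and the outer energy contain the same momentum and the same linear term;
    their difference leaves only the cosine. *)
Lemma fluxon_cos_in : cos (phi (- L)) = 1 - 2 * pi * g - h.
Proof.
have L1 := L0.
have := fluxon_energy_left (lexx L); have := @fluxon_energy_in (- L) (lexx _) ltac:(lra).
by have := fluxon_H0; rewrite /V; lra.
Qed.

Lemma fluxon_cos_out : cos (phi L) = 1 - h.
Proof.
have L1 := L0.
have := fluxon_energy_right (lexx L); have := @fluxon_energy_in L ltac:(lra) (lexx _).
by have := fluxon_H0; rewrite /V; lra.
Qed.

Lemma fluxon_h_ge0 : 0 <= h.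
Proof. by have := cos_le1 (phi L); rewrite fluxon_cos_out; lra. Qed.

Lemma fluxon_h_max : h <= h_max g.
Proof. by have := cos_geN1 (phi (- L)); rewrite fluxon_cos_in /h_max; lra. Qed.

(** The interval [0, h_max] containing [h] must be nonempty. *)
Lemma fluxon_g_le : g <= pi^-1.
Proof. by apply: ge_inv_pi; have := fluxon_h_max; have := fluxon_h_ge0; rewrite /h_max; lra. Qed.

Lemma fluxon_g_lt1 : g < 1.
Proof. by apply: (le_lt_trans fluxon_g_le); have /andP[] := @inv_pi R. Qed.

Lemma fluxon_cos_asin_gt0 : 0 < cos (asin g).
Proof.
have := g0; rewrite le_eqVlt => /orP[/eqP <-|gp].
  by have [|] := @asin_def R 0; rewrite ?cos_asin ?expr0n ?subr0 ?sqrtr1//; apply/andP; split; lra.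
by apply: cos_asin_gt0; rewrite gp fluxon_g_lt1.
Qed.

Lemma fluxon_decreasing x : p (- L) <= 0 -> - L <= x -> x <= L -> p x <= 0.
Proof.
move=> pL x1 x2; have := @fluxon_in x (- L) x1 x2 (lexx _) ltac:(lra).
have : 0 <= g * (x + L) by rewrite mulr_ge0//; lra.
by lra.
Qed.

Lemma fluxon_decreasing_out : p (- L) <= 0 -> phi L <= phi (- L) /\ p L <= 0.
Proof.
have L1 := L0.
move=> pL; split; last by apply: fluxon_decreasing => //; lra.
apply: (@derive_le0_le R phi p); [lra| | |].
- by move=> x _; exact: fluxon_continuous.
- by move=> x _; exact: fluxon_derive.
- by move=> x /andP[x1 x2]; apply: fluxon_decreasing => //; exact: ltW.
Qed.

Lemma fluxon_increasing_out : 0 < p L -> phi (- L) < phi L.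
Proof.
have L1 := L0.
move=> pL; apply: (@derive_gt0_lt R phi p); [lra| | |].
- by move=> x _; exact: fluxon_continuous.
- by move=> x _; exact: fluxon_derive.
move=> x /andP[x1 x2].
have := @fluxon_in x L (ltW x1) (ltW x2) ltac:(lra) (lexx _).
have : 0 <= g * (L - x) by rewrite mulr_ge0//; lra.
by lra.
Qed.

(** Inside, the momentum is constant, and it must be positive. Then 0 < phi_in < phi_out < 2 pi with
    equal cosines, so the two angles are symmetric about pi, and L is half the distance divided by
    the speed. *)
Lemma fluxon_zero_bias : g = 0 ->
  [/\ 0 < h < 2, 0 < p L, 0 < phi (- L) < pi, phi L = 2 * pi - phi (- L)
    & L = L_gamma0 h].
Proof.
have L1 := L0.
move=> gE; have s0 : asin (0 : R) = 0.
  have := @sinK R 0; rewrite sin0 => ->; rewrite ?sin0//.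
  by rewrite in_itv /=; have := @pi_gt0 R => ?; apply/andP; split; lra.
have p0 := @pi_gt0 R.
have pE := fluxon_p_out; rewrite gE mulr0 mul0r subr0 in pE.
have sr := fluxon_right; rewrite gE s0 in sr; have sr0 := stable_shift sr.
have sl := fluxon_left; rewrite gE s0 in sl.
have H00 : H_0 0 = 0 :> R by rewrite /H_0 s0 expr0n subr0 sqrtr1; ring.
(* Entering at most at 0 and moving down, the fluxon leaves at most at 0 with nonpositive momentum,
   outside every part of the stable set of 2 pi. *)
have key : p (- L) <= 0 -> phi (- L) <= 0 -> False.
  move=> pn fn; have [d1 d2] := fluxon_decreasing_out pn; have d3 := le_trans d1 fn.
  have [hr|hr|hr] := stable_cases0 sr0; have := hr L (lexx L).
  - by case=> r1 _; lra.
  - by case=> _; rewrite ltNge d2.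
  - by case=> /andP[r1 _] _; lra.
have [pin phin] : 0 < p (- L) /\ 0 < phi (- L) < 2 * pi.
  have [hl|hl|hl] := stable_cases0 sl; have := hl L (lexx L).
  - by case=> l1 l2; case: key; rewrite ?l1// -oppr_ge0 l2.
  - by case=> /andP[_ l1] l2; case: key; rewrite ltW// -oppr_gt0.
  - by case=> l1; rewrite oppr_lt0.
have pL : 0 < p L by rewrite pE.
have lt := fluxon_increasing_out pL.
have phout : phi L < 2 * pi.
  rewrite -subr_lt0; have [hr|hr|hr] := stable_cases0 sr0; have := hr L (lexx L).
  + by case=> _ r2; rewrite r2 ltxx in pL.
  + by case=> /andP[].
  + by case=> _; rewrite ltNge (ltW pL).
have c1 := fluxon_cos_in; have c2 := fluxon_cos_out; rewrite gE mulr0 subr0 in c1.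
move: phin => /andP[in0 in2].
have [inpi outE] := cos_eq_lt (ltW in0) lt (ltW phout) (etrans c1 (esym c2)).
have L2 : - L <= L by rewrite ge0_cp// ltW.
have Ein := fluxon_energy_in L2 (lexx _); rewrite gE H00 mul0r addr0 add0r in Ein.
have h0 : 0 < h by rewrite -Ein divr_gt0// exprn_gt0.
have h2 : h < 2.
  by have := cos_decr (ltW in0) inpi (lexx _); rewrite c1 cospi; lra.
have sq : Num.sqrt (2 * h) = p L.
  by rewrite -[RHS]gtr0_norm// -sqrtr_sqr; congr Num.sqrt; lra.
split => //; first by rewrite h0.
  by rewrite in0.
have pc x : - L <= x -> x <= L -> p x = p L.
  by move=> x1 x2; have := fluxon_in x1 x2 L2 (lexx _); rewrite gE !mul0r !addr0.
have [|||c [/andP[c1' c2'] e]] := @mean_value R phi p (- L) L; first by rewrite gt0_cp.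
- by move=> x _; exact: fluxon_continuous.
- by move=> x _; exact: fluxon_derive.
rewrite pc ?ltW// in e.
have aE : acos (1 - h) = phi (- L).
  by rewrite -c1 cosK// in_itv /= !ltW.
have LE : p L * L = pi - phi (- L) by lra.
by rewrite /L_gamma0 aE sq -LE mulrC mulKf// gt_eqF.
Qed.

Lemma stable_cos_tail l a u (u1 : R -> R) : stable g l a u u1 -> 0 < cos l ->
  exists X, forall x, X <= x -> cos l / 2 <= cos (u x).
Proof.
move=> [orb ul] cl.
have cul : cos (u x) @[x --> +oo] --> cos l.
  by have := @cvg_comp _ _ _ u cos _ _ _ ul (@continuous_cos R l).
have [X HX] := cvgy_dist cul (eps := cos l / 2) ltac:(lra).
by exists X => x /HX; rewrite ltr_norml => /andP[]; lra.
Qed.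

(* The derivative of a solution converging to a saddle decays like a solution of
   the linearized equation. *)
Lemma stable_derivative_decaying l a u (u1 : R -> R) : stable g l a u u1 -> 0 < cos l ->
  half_sol (fun x => cos (u x)) a u1 (fun x => sin (u x) - g) /\
  decaying u1 (fun x => sin (u x) - g).
Proof.
move=> [orb ul] cl; have [cu cu1 d] := orb.
have hs : half_sol (fun x => cos (u x)) a u1 (fun x => sin (u x) - g).
  split => //.
    move=> x; apply: cvgB; last exact: cvg_cst.
    by apply: (@continuous_comp _ _ _ u sin); [exact: cu|exact: continuous_sin].
  move=> x ax; have [d1 d2] := d x ax; split; first exact: d2.
  by apply: (is_derive_eqx (is_deriveBx (is_derive_sinx d1) (is_derive_cstx g x))); rewrite subr0.
split=> //; have [_ E] := orbit_limit orb ul.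
have [M1 H1] := cvgy_dist (energy_lim E ul) ltr01.
have [M2 H2] := stable_cos_tail (conj orb ul) cl.
pose X := Num.max a (Num.max M1 M2).
have X1 : M1 <= X by rewrite !le_max lexx orbT.
have X2 : M2 <= X by rewrite !le_max lexx !orbT.
apply: (@half_sol_decaying R _ a _ _ X (cos l / 2) (2 + `|g|) hs); first by lra.
- by rewrite le_max lexx.
- by move=> x /ltW /(le_trans X2); exact: H2.
move=> x Xx; apply: le_trans (ler_norm _) _; rewrite normrM.
have h1 := H1 x (le_trans X1 Xx); rewrite subr0 in h1.
have h2 : `|sin (u x) - g| <= 2 + `|g|.
  apply: le_trans (ler_normB _ _) _; rewrite lerD2r.
  by have := @sin_max R (u x); lra.
by rewrite -[leRHS]mul1r ler_pM// ltW.
Qed.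

Lemma half_sol_exp a (k : R) (q : R -> R) : 0 < k -> (forall x, a < x -> q x = k ^+ 2) ->
  let r x := expR (- k * (x - a)) in
  half_sol q a r (fun x => - k * r x) /\ decaying r (fun x => - k * r x).
Proof.
move=> k0 qk r; have dr x : is_derive x 1 r (- k * r x).
  rewrite /r.
  apply: (is_derive_eqx (is_derive_expx (is_deriveMx (is_derive_cstx (- k) x) (is_deriveBx (is_derive_idx x) (is_derive_cstx a x))))).
  by ring.
have cr : continuous r by move=> x; exact: is_derive_cont (dr x).
have hs : half_sol q a r (fun x => - k * r x).
  split => //; first by move=> x; apply: cvgM; [exact: cvg_cst|exact: cr].
  move=> x ax; split; first exact: dr.
  by apply: (is_derive_eqx (is_deriveMx (is_derive_cstx (- k) x) (dr x))); rewrite qk//; ring.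
split=> //; apply: (@half_sol_decaying R q a _ _ a (k ^+ 2) 0 hs) => //.
- by rewrite exprn_gt0.
- by move=> x /qk ->.
by move=> x _; rewrite mulrCA mulNr oppr_le0 mulr_ge0 ?(ltW k0)// mulr_ge0// expR_ge0.
Qed.

Lemma fluxon_left_decaying :
  half_sol (fun x => cos (phi (- x))) L (fun x => - p (- x)) (fun x => sin (phi (- x)) - g) /\
  decaying (fun x => - p (- x)) (fun x => sin (phi (- x)) - g).
Proof. exact: stable_derivative_decaying fluxon_left fluxon_cos_asin_gt0. Qed.

Lemma fluxon_right_decaying : half_sol (fun x => cos (phi x)) L p (fun x => sin (phi x) - g) /\
  decaying p (fun x => sin (phi x) - g).
Proof.
by apply: stable_derivative_decaying fluxon_right _; rewrite cos_D2pi fluxon_cos_asin_gt0.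
Qed.

Local Notation S_in := (sin (phi (- L)) - g).
Local Notation S_out := (sin (phi L) - g).

Lemma fluxon_eigenvalue_det : p (- L) != 0 -> (p L != 0) || (S_out != 0) ->
  is_eigenvalue L phi 0 <-> (p (- L) + 2 * L * S_in) * S_out - S_in * p L = 0.
Proof.
move=> nin nout; have [hl dl] := fluxon_left_decaying; have [hr dr] := fluxon_right_decaying.
rewrite (zero_eigenvalue_iff L0 fluxon_continuous hr dr hl dl nout); last by rewrite oppr_eq0 nin.
by split=> [e|e]; [rewrite -[RHS]oppr0 -e|rewrite -[RHS]oppr0 -e]; ring.
Qed.

(** By the symmetry about pi, S_out = - S_in and p_out = p_in, so that the determinant is minus a
    sum of positive terms. *)
Lemma fluxon_zero_bias_eigenvalue : g = 0 -> ~ is_eigenvalue L phi 0.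
Proof.
have L1 := L0.
move=> gE; have [_ pL /andP[in0 in1] oE _] := fluxon_zero_bias gE.
have pE := fluxon_p_out; rewrite gE mulr0 mul0r subr0 in pE.
have pn : p L != 0 by rewrite gt_eqF.
rewrite fluxon_eigenvalue_det -?pE ?pn// oE gE !subr0.
have -> : sin (2 * pi - phi (- L)) = - sin (phi (- L)) by rewrite addrC sin_D2pi sinN.
have s0 : 0 < sin (phi (- L)) by apply: sin_gt0_pi; rewrite in0.
move=> e; have : 0 < (p L + 2 * L * sin (phi (- L))) * sin (phi (- L)) + sin (phi (- L)) * p L.
  by rewrite addr_gt0 ?mulr_gt0// addr_gt0// !mulr_gt0.
by lra.
Qed.

Section Positive_bias.
Hypothesis gp : 0 < g.
Let g01 : 0 < g < 1. Proof. by rewrite gp fluxon_g_lt1. Qed.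
Let tm : turning g (phi_max g). Proof. exact: phi_max_turning g01. Qed.
Let m_pi : pi < phi_max g. Proof. exact: turning_gt_pi gp fluxon_g_le tm. Qed.

(** Entering at or below [phi_max] with nonpositive momentum, the fluxon would leave there moving
    down or at rest, where no orbit leads to the right saddle. This leaves the homoclinic loop,
    without its turning point since the momentum is positive. *)
Lemma fluxon_in_bounds : 0 < p (- L) /\ asin g < phi (- L) < phi_max g.
Proof.
have L1 := L0; have /andP[s0 s1] := asin_bounds g01; have p0 := @pi_gt0 R.
have [/andP[m1 m2] em] := tm; have m3 := m_pi.
have shr := stable_shift fluxon_right.
have contra : p (- L) <= 0 -> phi (- L) <= phi_max g -> False.
  move=> pL fm; have [d1 d2] := fluxon_decreasing_out pL.
  have [hr|hr|hr] := stable_cases g01 tm shr.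
  - by have [r1 r2] := hr L (lexx L); lra.
  - by have [r1 r2] := hr L (lexx L); lra.
  - by have /andP[r1 r2] := hr L (lexx L); lra.
have [hl|hl|hl] := stable_cases g01 tm fluxon_left.
- have [l1 l2] := hl L (lexx L); have pl : p (- L) = 0 by lra.
  by exfalso; apply: contra; lra.
- have [l1 l2] := hl L (lexx L).
  by exfalso; apply: contra; lra.
have /andP[l1 l2] := hl L (lexx L).
have pos : 0 < p (- L) by rewrite ltNge; apply/negP => le; exact: contra.
split => //; rewrite l1 lt_neqAle l2 andbT /=; apply/eqP => e.
have := fluxon_energy_left (lexx L); rewrite e em => /eqP.
rewrite -subr_eq0 addrK mulf_eq0 sqrf_eq0 invr_eq0 pnatr_eq0 orbF => /eqP e0.
by move: pos; rewrite e0 ltxx.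
Qed.

(** The lower bound pi of the middle case: otherwise both angles lie in [0, pi] and phi_out >
    phi_in, so that the cosine decreases, while cos phi_out - cos phi_in = 2 pi g > 0. *)
Lemma fluxon_out_cases :
  [\/ forall x, L <= x -> phi x = asin g + 2 * pi /\ p x = 0,
      0 < p L /\ pi <= phi L < asin g + 2 * pi
    | asin g + 2 * pi < phi L <= 2 * pi + phi_max g].
Proof.
have L1 := L0; have /andP[s0 s1] := asin_bounds g01; have p0 := @pi_gt0 R.
have [pin /andP[f1 f2]] := fluxon_in_bounds.
have [hr|hr|hr] := stable_cases g01 tm (stable_shift fluxon_right).
- apply: Or31 => x Lx; have [h1 h2] := hr x Lx; split => //; lra.
- have [h1 h2] := hr L (lexx L); apply: Or32; split=> //.
  apply/andP; split; last by lra.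
  rewrite leNgt; apply/negP => lt; have inc := fluxon_increasing_out h2.
  have : cos (phi L) < cos (phi (- L)).
    by rewrite ltr_cos ?in_itv //=; apply/andP; split; lra.
  rewrite fluxon_cos_in fluxon_cos_out.
  have : 0 < pi * g by rewrite mulr_gt0.
  by lra.
have /andP[h1 h2] := hr L (lexx L); apply: Or33.
by apply/andP; split; lra.
Qed.

Lemma fluxon_p_out_zero : p L = 0 -> phi L != asin g + 2 * pi -> phi L = 2 * pi + phi_max g.
Proof.
have L1 := L0; move=> pL ne; have [hr|[hr _]|/andP[h1 h2]] := fluxon_out_cases.
- by have [e _] := hr L (lexx L); rewrite e eqxx in ne.
- by rewrite pL ltxx in hr.
have E : energy g (fun x => phi x - 2 * pi) p L = V g (asin g).
  have [orb ul] := stable_shift fluxon_right.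
  by have [_ E] := orbit_limit orb ul; rewrite E.
have := orbit_well_energy g01 tm L E; rewrite /= => H.
have h1' : asin g < phi L - 2 * pi by lra.
have h2' : phi L - 2 * pi <= phi_max g by lra.
by have := H h1' h2' pL; lra.
Qed.

(** [g] times the determinant, with 2 g L replaced by p_in - p_out; this eliminates L and produces
    the expression met in dL/dh. *)
Lemma fluxon_eigenvalue : phi L != asin g + 2 * pi ->
  is_eigenvalue L phi 0 <->
  p (- L) * S_out * sin (phi (- L)) = p L * S_in * sin (phi L).
Proof.
move=> ne; have [pin _] := fluxon_in_bounds.
rewrite fluxon_eigenvalue_det; last 2 first.
- by rewrite gt_eqF.
- have [e|//] := eqVneq (p L) 0.
  rewrite /= (fluxon_p_out_zero e ne) [2 * pi + _]addrC sin_D2pi lt_eqF// subr_lt0.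
  exact: (sin_turning g01 tm).
have e := fluxon_p_out; have gn : g != 0 by rewrite gt_eqF.
have eL : 2 * g * L = p (- L) - p L by lra.
have key : g * ((p (- L) + 2 * L * S_in) * S_out - S_in * p L) =
    p (- L) * S_out * sin (phi (- L)) - p L * S_in * sin (phi L).
  transitivity (g * p (- L) * S_out + (2 * g * L) * S_in * S_out - g * S_in * p L); first by ring.
  by rewrite eL; ring.
split=> [e0|e0].
  by apply/eqP; rewrite -subr_eq0 -key e0 mulr0.
by apply: (mulfI gn); rewrite mulr0 key e0 subrr.
Qed.

(** At the saddle the derivative of the fluxon vanishes on the right; its substitute is the
    exponential with the rate of the linearized saddle. *)
Lemma fluxon_eigenvalue_cst : phi L = asin g + 2 * pi ->
  is_eigenvalue L phi 0 <->
  g * S_in + Num.sqrt (cos (asin g)) * p (- L) * sin (phi (- L)) = 0.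
Proof.
move=> fL; have L1 := L0; have [pin _] := fluxon_in_bounds.
have cst : forall x, L <= x -> phi x = asin g + 2 * pi /\ p x = 0.
  by have [//|[_ /andP[_]]|/andP[+ _]] := fluxon_out_cases; rewrite fL ltxx.
set k := Num.sqrt _; have k2 : k ^+ 2 = cos (asin g) by rewrite sqr_sqrtr// ltW// fluxon_cos_asin_gt0.
have k0 : 0 < k by rewrite sqrtr_gt0 fluxon_cos_asin_gt0.
have [hl dl] := fluxon_left_decaying.
have [hr dr] := @half_sol_exp L k (fun x => cos (phi x)) k0 (fun x Lx =>
  etrans (congr1 cos (cst x (ltW Lx)).1) (etrans (cos_D2pi _) (esym k2))).
rewrite (zero_eigenvalue_iff L0 fluxon_continuous hr dr hl dl); last 2 first.
- by rewrite gt_eqF// expR_gt0.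
- by rewrite oppr_eq0 gt_eqF.
rewrite subrr mulr0 expR0 !mulr1.
have e := fluxon_p_out; rewrite (cst L (lexx L)).2 in e.
have eL : 2 * g * L = p (- L) by lra.
have gn : g != 0 by rewrite gt_eqF.
have key : g * ((- p (- L) - 2 * L * S_in) * - k + S_in) =
    g * S_in + k * p (- L) * sin (phi (- L)).
  transitivity (g * S_in + k * (g * p (- L)) + k * (2 * g * L) * S_in); first by ring.
  by rewrite eL; ring.
split=> [e0|e0]; first by rewrite -key e0 mulr0.
by apply: (mulfI gn); rewrite mulr0 key e0.
Qed.

End Positive_bias.
End Fluxon.

(** * Derivatives along the branches *)

Section DeriveIn.
Context {R : realType}.
Implicit Types (f F : R -> R) (A : set R) (a x y l d : R).

Lemma derive_caratheodory f a l : is_derive a 1 f l ->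
  exists2 q : R -> R, {for a, continuous q} /\ q a = l & forall y, f y - f a = q y * (y - a).
Proof. by move=> /is_derive1_caratheodory [q [h1 h2 h3]]; exists q. Qed.

Lemma derive_in_of A f a l : A a -> limit_point A a -> is_derive a 1 f l ->
  is_derive_in A f a l.
Proof.
move=> Aa lp /derive_caratheodory[q [cq qa] e]; split => //; rewrite -qa.
have cq' : q y @[y --> within A a^'] --> q a.
  apply: cvg_trans cq; apply: cvg_app => U [e0 /= e1 H]; exists e0 => // y ye _ _; exact: H.
apply: cvg_trans cq'; apply: near_eq_cvg; near=> y.
have ya : y != a by near: y; rewrite near_withinE; near=> y => _; near: y; exact: nbhs_dnbhs_neq.
by rewrite e mulfK// subr_eq0.
Unshelve. all: by end_near. Qed.

Lemma derive_in_dist A f a l e : is_derive_in A f a l -> 0 < e ->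
  exists2 d, 0 < d & forall y, A y -> `|y - a| < d ->
    `|f y - f a - l * (y - a)| <= e * `|y - a|.
Proof.
move=> [_ _ /cvgrPdist_lt c] e0; have /nbhs_ballP[d /= d0 H] := c e e0.
exists d => // y Ay yd; have [->|ya] := eqVneq y a.
  by rewrite !subrr mulr0 subrr !normr0 mulr0.
have yb : ball a d y by rewrite /ball /= distrC.
have yn : 0 < `|y - a| by rewrite normr_gt0 subr_eq0.
have := H y yb ya Ay; rewrite distrC => h.
rewrite -ler_pdivrMr// -normfV -normrM mulrBl mulfK ?subr_eq0//; exact: ltW.
Qed.

Lemma limit_point_near A a d : limit_point A a -> 0 < d ->
  exists2 y, A y & 0 < `|y - a| < d.
Proof.
move=> lp d0; have [y [ya Ay yb]] := lp _ (nbhsx_ballx a d d0).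
by exists y => //; rewrite normr_gt0 subr_eq0 ya distrC.
Qed.

Lemma derive_in_uniq A f a l l' : is_derive_in A f a l -> is_derive_in A f a l' -> l = l'.
Proof.
move=> h1 h2; have [_ lp _] := h1.
apply/eqP; rewrite -subr_eq0 -normr_le0; apply/ler_addgt0Pr => e e0; rewrite add0r.
have e2 : 0 < e / 2 by lra.
have [d d0 H] := derive_in_dist h1 e2; have [d' d0' H'] := derive_in_dist h2 e2.
have [|y Ay] := @limit_point_near A a (Num.min d d') lp; first by rewrite lt_min d0.
rewrite lt_min => /andP[y0 /andP[y1 y2]].
have i1 := H y Ay y1; have i2 := H' y Ay y2.
rewrite -(ler_pM2r y0) -normrM.
rewrite (_ : (l - l') * (y - a) = (f y - f a - l' * (y - a)) - (f y - f a - l * (y - a))); last by ring.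
by apply: le_trans (ler_normB _ _) _; lra.
Qed.

(** A consequence of differentiability at [a] that passes through sums, absolute values and, by
    [lip_sqrt], from a positive square root to its radicand; it is what refutes the existence of
    dL/dh. *)
Definition lip_at A f a := exists K d, 0 < d /\
  forall y, A y -> `|y - a| < d -> `|f y - f a| <= K * `|y - a|.

Lemma derive_in_lip A f a l : is_derive_in A f a l -> lip_at A f a.
Proof.
move=> /derive_in_dist /(_ ltr01)[d d0 H]; exists (1 + `|l|), d; split => // y Ay yd.
rewrite (_ : f y - f a = (f y - f a - l * (y - a)) + l * (y - a)); last by ring.
apply: le_trans (ler_normD _ _) _; rewrite mulrDl lerD ?H//.
by rewrite normrM.
Qed.

Lemma derive_lip A f a l : is_derive a 1 f l -> lip_at A f a.
Proof.
move=> /derive_caratheodory[q [cq qa] e].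
have [d d0 H] := continuous_at_dist cq ltr01.
exists (`|l| + 1), d; split => // y _ yd; rewrite e normrM ler_wpM2r//.
rewrite -(subrK l (q y)) addrC; apply: le_trans (ler_normD _ _) _; rewrite lerD2l -qa.
exact/ltW/H.
Qed.

Lemma lip_lin A f F a k c e : lip_at A f a -> lip_at A F a ->
  lip_at A (fun y => k * f y + c * F y + e) a.
Proof.
move=> [K [d [d0 H]]] [K' [d' [d0' H']]].
exists (`|k| * K + `|c| * K'), (Num.min d d'); split; first by rewrite lt_min d0.
move=> y Ay; rewrite lt_min => /andP[y1 y2].
rewrite (_ : _ - _ = k * (f y - f a) + c * (F y - F a)); last by ring.
apply: le_trans (ler_normD _ _) _; rewrite !normrM mulrDl -!mulrA lerD// ler_wpM2l//.
  exact: H.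
exact: H'.
Qed.

Lemma lip_norm A f a : lip_at A f a -> lip_at A (fun y => `|f y|) a.
Proof.
move=> [K [d [d0 H]]]; exists K, d; split => // y Ay yd.
by apply: le_trans (ler_dist_dist _ _) _; exact: H.
Qed.

Lemma lip_eq A f F a : A a -> (forall y, A y -> f y = F y) -> lip_at A f a -> lip_at A F a.
Proof. by move=> Aa e [K [d [d0 H]]]; exists K, d; split => // y Ay; rewrite -!e//; exact: H. Qed.

(** A function Lipschitz and positive at a point has a Lipschitz square. As [Num.sqrt] is 0 on
    negative numbers, the positivity of [F] near [a] has to be recovered from its root. *)
Lemma lip_sqrt A F a : lip_at A (fun y => Num.sqrt (F y)) a -> 0 < F a -> lip_at A F a.
Proof.
move=> [K [d [d0 H]]] Fa; pose t := Num.sqrt (F a).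
have t0 : 0 < t by rewrite sqrtr_gt0.
have K0 : 0 < `|K| + 1 by have := normr_ge0 K; lra.
exists (3 * t * (`|K| + 1)), (Num.min d (t / (`|K| + 1))).
split; first by rewrite lt_min d0 divr_gt0.
move=> y Ay; rewrite lt_min => /andP[y1 y2].
have h1 : `|Num.sqrt (F y) - t| <= (`|K| + 1) * `|y - a|.
  apply: le_trans (H y Ay y1) _; rewrite ler_wpM2r//.
  by apply: le_trans (ler_norm _) _; rewrite lerDl.
have h2 : `|Num.sqrt (F y) - t| < t.
  by apply: le_lt_trans h1 _; rewrite mulrC -ltr_pdivlMr.
have Fy : 0 < F y.
  by rewrite -sqrtr_gt0; move: h2; rewrite ltr_norml => /andP[]; lra.
rewrite -(sqr_sqrtr (ltW Fy)) -(sqr_sqrtr (ltW Fa)) -/t subr_sqr normrM.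
rewrite (_ : 3 * t * _ * _ = (`|K| + 1) * `|y - a| * (3 * t)); last by ring.
rewrite ler_pM//.
by rewrite ger0_norm; move: h2; rewrite ltr_norml => /andP[]; lra.
Qed.

(* An arccosine has a vertical tangent where its argument is 1. *)
Lemma not_lip_acos A f a : limit_point A a ->
  (forall y, A y -> 2 * `|y - a| <= (f y - f a) ^+ 2) -> ~ lip_at A f a.
Proof.
move=> lp Hf [K [d [d0 H]]].
have K2 : 0 < K ^+ 2 + 1 by have := sqr_ge0 K; lra.
have [|y Ay] := @limit_point_near A a (Num.min d (2 / (K ^+ 2 + 1))) lp.
  by rewrite lt_min d0 divr_gt0.
rewrite lt_min => /andP[y0 /andP[y1 y2]].
have h1 := H y Ay y1.
have h2 := Hf y Ay.
have : (f y - f a) ^+ 2 <= (K * `|y - a|) ^+ 2.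
  by rewrite -[(f y - f a) ^+ 2]ger0_norm ?sqr_ge0// normrX lerXn2r ?nnegrE// (le_trans _ h1).
rewrite exprMn => h3.
have h4 : 2 * `|y - a| <= K ^+ 2 * `|y - a| * `|y - a| by rewrite -mulrA -expr2; lra.
rewrite ler_pM2r// in h4.
rewrite ltr_pdivlMr// in y2; nra.
Qed.

(** [F] grows at least like (c/2)(y - a), so its root grows like the square root of y - a. *)
Lemma not_lip_sqrt A F a c : limit_point A a -> F a = 0 -> 0 < c ->
  is_derive a 1 F c -> (forall y, A y -> a <= y) -> ~ lip_at A (fun y => Num.sqrt (F y)) a.
Proof.
move=> lp Fa c0 dF Aa [K [d [d0 H]]].
have [q [cq qa] e] := derive_caratheodory dF.
have [d' d0' H'] := continuous_at_dist cq (eps := c / 2) ltac:(lra).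
have K2 : 0 < K ^+ 2 + 1 by have := sqr_ge0 K; lra.
have [|y Ay] := @limit_point_near A a (Num.min d (Num.min d' ((c / 2) / (K ^+ 2 + 1)))) lp.
  by rewrite !lt_min d0 d0' !divr_gt0.
rewrite !lt_min => /andP[y0 /andP[y1 /andP[y2 y3]]].
have ay := Aa y Ay; have yE : `|y - a| = y - a by rewrite ger0_norm// subr_ge0.
have h0 := H' y y2; rewrite qa ltr_norml in h0; have /andP[h1 _] := h0.
have qy : c / 2 < q y by clear -h1; lra.
have ya0 : 0 < y - a by rewrite -yE.
have Fy : c / 2 * (y - a) < F y.
  have Fe : F y = q y * (y - a) by rewrite -e Fa subr0.
  by rewrite Fe (ltr_pM2r ya0).
have Fy0 : 0 < F y by apply: lt_trans Fy; apply: mulr_gt0 => //; exact: divr_gt0.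
have := H y Ay y1; rewrite Fa sqrtr0 subr0 ger0_norm ?sqrtr_ge0// => h2.
have : F y <= (K * `|y - a|) ^+ 2.
  rewrite -(sqr_sqrtr (ltW Fy0)) lerXn2r ?nnegrE ?sqrtr_ge0//.
  by apply: le_trans h2; rewrite sqrtr_ge0.
rewrite exprMn yE expr2 => h3.
have h4 : c / 2 < K ^+ 2 * (y - a).
  by rewrite -(ltr_pM2r y0) yE; clear -h3 Fy; lra.
rewrite ltr_pdivlMr// yE in y3; rewrite yE in y0; clear -y3 y0 h4; lra.
Qed.

End DeriveIn.

(** * Derivatives of angles and momenta with respect to h *)

Section Branches.
Context {R : realType}.
Implicit Types (g h x y c : R) (s : bool) (b : branch).

Lemma is_derive_acosx (f : R -> R) x df : is_derive x 1 f df -> -1 < f x < 1 ->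
  is_derive x 1 (fun y => acos (f y)) (- (sin (acos (f x)))^-1 * df).
Proof.
move=> d fx; have /andP[f1 f2] := fx.
rewrite sin_acos; last by rewrite !ltW.
exact: is_derive_compx d (is_derive1_acos fx).
Qed.

Lemma sin_acos_gt0 x : -1 < x < 1 -> 0 < sin (acos x) :> R.
Proof.
move=> /andP[x1 x2]; apply: sin_gt0_pi.
by rewrite acos_gt0 ?acos_ltpi// ?x1 ?x2 ltW.
Qed.

Lemma h_2E g : 0 < g < 1 -> h_2 g = 1 - cos (asin g).
Proof.
by move=> /andP[g0 g1]; rewrite /h_2 cos_asin//; apply/andP; split; lra.
Qed.

(** [h_2] is the parameter at which branch 2 passes through the right saddle. *)
Lemma acos_h_2 g : 0 < g < 1 -> acos (1 - h_2 g) = asin g.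
Proof.
move=> g01; rewrite h_2E// subKr cosK// in_itv /=.
by have /andP[a0 a1] := asin_bounds g01; apply/andP; split; lra.
Qed.

Lemma h_2_gt0 g : 0 < g < 1 -> 0 < h_2 g.
Proof.
move=> g01; have /andP[a0 a1] := asin_bounds g01; have p0 := @pi_gt0 R.
by rewrite h_2E// subr_gt0 cos_lt1//; lra.
Qed.

Lemma h_1_gt0 g : 0 < g < 1 -> 0 < h_1 g.
Proof.
move=> g01; have [/andP[m1 m2] _] := phi_max_turning g01.
have /andP[a0 a1] := asin_bounds g01; have p0 := @pi_gt0 R.
by rewrite /h_1 subr_gt0 cos_lt1//; lra.
Qed.

(** Implicit differentiation of cos phi_in = 1 - 2 pi g - h, which holds for both signs; likewise of
    cos phi_out = 1 - h below, for all five branches. *)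
Lemma branch_phi_in_derive g s h : -1 < 2 * pi * g - (1 - h) < 1 ->
  sin (branch_phi_in g s h) != 0 /\
  is_derive h 1 (branch_phi_in g s) (sin (branch_phi_in g s h))^-1.
Proof.
move=> hx; have s0 := sin_acos_gt0 hx.
have d0 : is_derive h 1 (fun y => 2 * pi * g - (1 - y)) (1 : R) by deriv; ring.
have d := is_derive_acosx d0 hx.
rewrite /branch_phi_in; case: s; rewrite [pi + _]addrC sin_Dpi ?sinN ?opprK.
  split; first by rewrite oppr_eq0 gt_eqF.
  by apply: (is_derive_eqx (is_deriveDx (is_derive_cstx pi h) d)); rewrite invrN; ring.
split; first by rewrite gt_eqF.
by apply: (is_derive_eqx (is_deriveBx (is_derive_cstx pi h) d)); ring.
Qed.

Lemma branch_phi_out_derive b h : 0 < h < 2 ->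
  sin (branch_phi_out b h) != 0 /\
  is_derive h 1 (branch_phi_out b) (sin (branch_phi_out b h))^-1.
Proof.
move=> /andP[h0 h2]; have hx : -1 < 1 - h < 1 by apply/andP; split; lra.
have s0 := sin_acos_gt0 hx.
have d0 : is_derive h 1 (fun y => 1 - y) (-1 : R) by deriv; ring.
have d := is_derive_acosx d0 hx.
have e4 : 4 * pi - acos (1 - h) = - acos (1 - h) + 2 * pi + 2 * pi by ring.
have e2 : 2 * pi - acos (1 - h) = - acos (1 - h) + 2 * pi by ring.
have c c0 : sin (- acos (1 - h)) != 0 /\
    is_derive h 1 (fun y => c0 - acos (1 - y)) (sin (- acos (1 - h)))^-1.
  rewrite sinN oppr_eq0 gt_eqF//; split => //.
  by apply: (is_derive_eqx (is_deriveBx (is_derive_cstx c0 h) d)); rewrite invrN; ring.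
have c' : sin (acos (1 - h)) != 0 /\
    is_derive h 1 (fun y => 2 * pi + acos (1 - y)) (sin (acos (1 - h)))^-1.
  rewrite gt_eqF//; split => //.
  by apply: (is_derive_eqx (is_deriveDx (is_derive_cstx (2 * pi) h) d)); ring.
case: b => /=; rewrite ?e4 ?e2 ?sin_D2pi; try exact: c.
- by rewrite [2 * pi + _]addrC sin_D2pi.
- by rewrite [2 * pi + _]addrC sin_D2pi.
Qed.

(** Implicit differentiation of p^2/2 + g phi = H_0 + h. *)
Lemma branch_p_in_derive g s h : -1 < 2 * pi * g - (1 - h) < 1 -> 0 < branch_p_in g s h ->
  is_derive h 1 (branch_p_in g s) ((1 - g / sin (branch_phi_in g s h)) / branch_p_in g s h).
Proof.
move=> hx; rewrite /branch_p_in sqrtr_gt0 => p0.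
have [sn0 d] := branch_phi_in_derive s hx.
have d1 : is_derive h 1 (fun y => 2 * (H_0 g + y - g * branch_phi_in g s y))
   (2 * (1 - g / sin (branch_phi_in g s h))).
  apply: (is_derive_eqx (is_deriveMx (is_derive_cstx 2 h) (is_deriveBx (is_deriveDx (is_derive_cstx (H_0 g) h) (is_derive_idx h)) (is_deriveMx (is_derive_cstx g h) d)))).
  by ring.
have sn : Num.sqrt (2 * (H_0 g + h - g * branch_phi_in g s h)) != 0 by rewrite gt_eqF// sqrtr_gt0.
by apply: (is_derive_eqx (@is_derive_sqrtx R (fun y => 2 * (H_0 g + y - g * branch_phi_in g s y)) h _ p0 d1)); field; rewrite sn0 sn.
Qed.

(** The sign jumps only on branch 2 at [h_2], the point treated in [branch_p_out_saddle]. *)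
Lemma branch_sign_near g b h : (b = Br2 -> h != h_2 g) ->
  exists2 e, e ^+ 2 = 1 :> R & \forall y \near h, branch_sign_out g b y = e.
Proof.
case: b => /= hb.
- by exists 1; [rewrite expr1n|near=> y].
- have [lt|gt] : h < h_2 g \/ h_2 g < h by apply/orP; rewrite -neq_lt hb.
    by exists 1; rewrite ?expr1n//; near=> y; rewrite ifT// ltW//; near: y; exact: lt_nbhsl.
  exists (-1); rewrite ?sqrrN ?expr1n//; near=> y; rewrite ifF//; apply/negbTE; rewrite -ltNge.
  by near: y; exact: lt_nbhsr.
- by exists 1; [rewrite expr1n|near=> y].
- by exists 1; [rewrite expr1n|near=> y].
- by exists (-1); [rewrite sqrrN expr1n|near=> y].
Unshelve. all: by end_near. Qed.

Lemma branch_p_out_derive g b h : 0 < h < 2 -> (b = Br2 -> h != h_2 g) ->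
  branch_p_out g b h != 0 ->
  is_derive h 1 (branch_p_out g b)
    ((1 - g / sin (branch_phi_out b h)) / branch_p_out g b h).
Proof.
move=> hx hb pn; have [sn0 d] := branch_phi_out_derive b hx.
have p0 : 0 < 2 * (H_0 g + h - g * branch_phi_out b h).
  rewrite -sqrtr_gt0 lt_neqAle sqrtr_ge0 andbT eq_sym.
  by apply: contra pn => /eqP; rewrite /branch_p_out => ->; rewrite mulr0.
have d1 : is_derive h 1 (fun y => 2 * (H_0 g + y - g * branch_phi_out b y))
   (2 * (1 - g / sin (branch_phi_out b h))).
  apply: (is_derive_eqx (is_deriveMx (is_derive_cstx 2 h) (is_deriveBx (is_deriveDx (is_derive_cstx (H_0 g) h) (is_derive_idx h)) (is_deriveMx (is_derive_cstx g h) d)))).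
  by ring.
have sn : Num.sqrt (2 * (H_0 g + h - g * branch_phi_out b h)) != 0 by rewrite gt_eqF// sqrtr_gt0.
have [e e2 en] := branch_sign_near hb.
have eh := nbhs_singleton en.
have e0 : e != 0 by apply/eqP => e0; move: e2; rewrite e0 expr0n => /esym/eqP; rewrite oner_eq0.
have ev : e^-1 = e by apply: (mulfI e0); rewrite divff// -expr2 e2.
have d2 := is_deriveMx (is_derive_cstx e h) (@is_derive_sqrtx R (fun y => 2 * (H_0 g + y - g * branch_phi_out b y)) h _ p0 d1).
apply: (@near_eq_is_derive _ _ _ (fun y => e * Num.sqrt (2 * (H_0 g + y - g * branch_phi_out b y)))).
- by apply: filterS en => y ye; rewrite /branch_p_out ye.
apply: (is_derive_eqx d2); rewrite /branch_p_out eh [(e * _)^-1]invfM ev.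
by field; rewrite sn0 sn.
Qed.

(* Taylor expansion of the energy at the saddle: the outgoing momentum vanishes to
   first order on both sides of it, with a change of sign. *)
Lemma V_saddle_expansion g t : 0 < g < 1 -> `|t| <= 1 ->
  `|2 * (V g (asin g) - V g (asin g + t)) - cos (asin g) * t ^+ 2| <= `|t| ^+ 3.
Proof.
move=> g01 t1; have c0 := cos_asin_gt0 g01; have c1 := cos_le1 (asin g).
have /andP[gp g1] := g01; have sg := sin_asin g01.
have E : 2 * (V g (asin g) - V g (asin g + t)) - cos (asin g) * t ^+ 2 =
   cos (asin g) * (2 * (1 - cos t) - t ^+ 2) + 2 * g * (sin t - t).
  by rewrite /V cosD sg; ring.
rewrite E.
have b1 : `|2 * (1 - cos t) - t ^+ 2| <= `|t| ^+ 3 / 12.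
  have h1 := cos_ge_sq (normr_ge0 t); have h2 := cos_le_quartic (normr_ge0 t).
  have ct : cos `|t| = cos t by abs_case t; rewrite ?cosN.
  have t2 : `|t| ^+ 2 = t ^+ 2 by rewrite real_normK ?num_real.
  rewrite ct t2 in h1 h2.
  have t4 : `|t| ^+ 4 <= `|t| ^+ 3 by rewrite exprSr ler_piMr// exprn_ge0.
  have t3 : 0 <= `|t| ^+ 3 by rewrite exprn_ge0.
  by rewrite ler_norml; apply/andP; split; lra.
have b2 : `|sin t - t| <= `|t| ^+ 3 / 6.
  have h1 := sin_ge_cube (normr_ge0 t); have h2 := sin_le_id (normr_ge0 t).
  have e : `|sin t - t| = `|sin `|t| - `|t| |.
    by abs_case t => //; rewrite sinN -normrN; congr `|_|; ring.
  by rewrite e ler_norml; apply/andP; split; lra.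
apply: le_trans (ler_normD _ _) _; rewrite !normrM (gtr0_norm c0) (gtr0_norm gp) [ `|2| ]ger0_norm//.
have t3 : 0 <= `|t| ^+ 3 by rewrite exprn_ge0.
have i1 : cos (asin g) * `|2 * (1 - cos t) - t ^+ 2| <= `|2 * (1 - cos t) - t ^+ 2|.
  by rewrite ler_piMl.
have i2 : g * `|sin t - t| <= `|sin t - t| by rewrite ler_piMl// ltW.
by lra.
Qed.

Lemma quadratic_is_derive (f : R -> R) a l K d : 0 < d ->
  (forall x : R, `|x - a| <= d -> `|f x - f a - l * (x - a)| <= K * (x - a) ^+ 2) ->
  is_derive a 1 f l.
Proof.
move=> d0 H.
pose q y := if y == a then l else (f y - f a) / (y - a).
have e y : f y - f a = q y * (y - a).
  by rewrite /q; case: eqVneq => [->|ya]; rewrite ?subrr ?mulr0// divfK// subr_eq0.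
have qa : q a = l by rewrite /q eqxx.
apply/is_derive1_caratheodory; exists q; split => //.
apply/cvgrPdist_lt => eps e0; rewrite qa.
have K0 : 0 < `|K| + 1 by have := normr_ge0 K; lra.
exists (Num.min d (eps / (`|K| + 1))); first by rewrite /= lt_min d0 divr_gt0.
move=> y /=; rewrite distrC lt_min => /andP[y1 y2].
have [->|ya] := eqVneq y a; first by rewrite qa subrr normr0.
have y0 : 0 < `|y - a| by rewrite normr_gt0 subr_eq0.
rewrite distrC -(ltr_pM2r y0) -normrM mulrBl -e.
apply: le_lt_trans (H y (ltW y1)) _; rewrite -[_ ^+ 2]ger0_norm ?sqr_ge0// normrX expr2 mulrA ltr_pM2r//.
rewrite ltr_pdivlMr// mulrC in y2; apply: le_lt_trans y2; rewrite ler_wpM2r//.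
by have := ler_norm K; lra.
Qed.

(** True also for negative [x], where the root is 0: no sign of the radicand has to be known near
    the saddle. *)
Lemma sqrt_dist x c : 0 <= c -> `|Num.sqrt x - c| * c <= `|x - c ^+ 2|.
Proof.
move=> c0; have [x0|x0] := leP 0 x.
  rewrite -{2}(sqr_sqrtr x0) subr_sqr normrM ler_wpM2l//.
  by rewrite ger0_norm ?addr_ge0 ?sqrtr_ge0// lerDr sqrtr_ge0.
rewrite (ltr0_sqrtr x0) sub0r normrN (ger0_norm c0) ltr0_norm; last by have := sqr_ge0 c; lra.
by rewrite -expr2; lra.
Qed.

(** In terms of the angle t = acos(1 - y) the radicand is the potential drop from the saddle, and
    the sign rule h <= h_2 becomes t <= asin g. *)
Lemma branch_p_out_V g y : 0 < g < 1 -> 0 <= y <= 2 -> branch_p_out g Br2 y =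
  (if acos (1 - y) <= asin g then 1 else -1) *
  Num.sqrt (2 * (V g (asin g) - V g (acos (1 - y)))).
Proof.
move=> g01 /andP[y0 y2]; have yb : -1 <= 1 - y <= 1 by apply/andP; split; lra.
have cy : cos (acos (1 - y)) = 1 - y by rewrite acosK.
have ay : acos (1 - y) \in `[0, pi] by rewrite in_itv /= acos_ge0 ?acos_lepi.
have ai : asin g \in `[0, pi].
  by have /andP[a0 a1] := asin_bounds g01; rewrite in_itv /=; apply/andP; split; lra.
have hE := h_2E g01; rewrite /branch_p_out /=; congr (_ * Num.sqrt _).
  congr (if _ then _ else _); rewrite leNgt [RHS]leNgt -(ltr_cos ai ay) cy hE.
  by congr (~~ _); apply/idP/idP => ?; lra.
by move: hE; rewrite /h_2 /V cy /H_0 => hE; lra.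
Qed.

(** Chain rule: as a function of the angle the momentum has slope - k at the saddle, with k^2 =
    cos(asin g), and the angle has slope 1/g in h. *)
Lemma branch_p_out_saddle g : 0 < g < 1 ->
  is_derive (h_2 g) 1 (branch_p_out g Br2) (- (Num.sqrt (cos (asin g)) / g)).
Proof.
move=> g01; have c0 := cos_asin_gt0 g01.
set k := Num.sqrt _; have k0 : 0 < k by rewrite sqrtr_gt0.
have k2 : k ^+ 2 = cos (asin g) by rewrite sqr_sqrtr// ltW.
have hp := h_2_gt0 g01.
have h2 : h_2 g < 1 by rewrite h_2E// gtrBl.
pose G t : R := (if t <= asin g then 1 else -1) * Num.sqrt (2 * (V g (asin g) - V g t)).
have Ga : G (asin g) = 0 by rewrite /G subrr mulr0 sqrtr0 mulr0.
have dG : is_derive (asin g) 1 G (- k).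
  apply: (@quadratic_is_derive G (asin g) (- k) k^-1 1 ltr01) => x x1.
  rewrite Ga subr0 mulNr opprK.
  set t := x - asin g in x1 *; have xE : x = asin g + t by rewrite /t; ring.
  have H := V_saddle_expansion g01 x1; rewrite -xE -k2 in H.
  have kt0 : 0 <= k * `|t| by rewrite mulr_ge0// ltW.
  have S := sqrt_dist (2 * (V g (asin g) - V g x)) kt0.
  have t2 : `|t| ^+ 2 = t ^+ 2 by rewrite real_normK ?num_real.
  have GE : `|G x + k * t| = `|Num.sqrt (2 * (V g (asin g) - V g x)) - k * `|t| |.
    rewrite /G; case: (leP x (asin g)) => xa.
      have -> : `|t| = - t by rewrite ler0_norm// subr_le0.
      by rewrite mul1r mulrN opprK.
    have -> : `|t| = t by rewrite gtr0_norm// subr_gt0.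
    by rewrite mulN1r -normrN opprD opprK.
  rewrite GE; have [t0|t0] := eqVneq t 0.
    have xa : x = asin g by rewrite xE t0 addr0.
    by rewrite t0 normr0 mulr0 subr0 xa subrr mulr0 sqrtr0 normr0 expr0n mulr0.
  have nt : 0 < `|t| by rewrite normr_gt0.
  have kt : 0 < k * `|t| by rewrite mulr_gt0.
  rewrite -(ler_pM2r kt); apply: le_trans S _; rewrite exprMn t2.
  apply: le_trans H _; rewrite (_ : k^-1 * t ^+ 2 * (k * `|t|) = `|t| ^+ 2 * `|t|).
    by rewrite -exprSr.
  by rewrite t2; field; rewrite gt_eqF.
have dt : is_derive (h_2 g) 1 (fun y => acos (1 - y)) (g^-1).
  have d0 : is_derive (h_2 g) 1 (fun y => 1 - y) (-1 : R) by deriv; ring.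
  have hx : -1 < 1 - h_2 g < 1 by apply/andP; split; lra.
  by apply: (is_derive_eqx (is_derive_acosx d0 hx)); rewrite acos_h_2// sin_asin//; ring.
rewrite -(acos_h_2 g01) in dG; have d := is_derive_compx dt dG.
apply: (@near_eq_is_derive _ _ _ (fun y => G (acos (1 - y)))); last first.
  by apply: (is_derive_eqx d); ring.
near=> y; rewrite branch_p_out_V//; apply/andP; split.
  by rewrite ltW//; near: y; exact: lt_nbhsr.
by rewrite ltW//; near: y; apply: lt_nbhsl; apply: lt_trans h2 _; rewrite ltr1n.
Unshelve. all: by end_near. Qed.

End Branches.

(** * Locating a fluxon on the branches; existence and vanishing of dL/dh *)

Section BranchFluxon.
Context {R : realType}.
Implicit Types (x y l : R) (s : bool) (b : branch).

Lemma acos_cos_eq x y : 0 <= x <= pi -> cos x = y -> acos y = x.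
Proof. by move=> hx <-; rewrite cosK// in_itv. Qed.

Variables (g L h : R) (phi : R -> R).
Hypotheses (g0 : 0 <= g) (L0 : 0 < L) (pf : pinned_fluxon g L phi)
  (fp : fluxon_parameter g L phi h) (gp : 0 < g).
Local Notation p := (derive1 phi).
Let g01 : 0 < g < 1. Proof. by rewrite gp (fluxon_g_lt1 g0 L0 pf fp). Qed.
Let tm : turning g (phi_max g). Proof. exact: phi_max_turning g01. Qed.
Let m_pi : pi < phi_max g. Proof. exact: turning_gt_pi gp (fluxon_g_le g0 L0 pf fp) tm. Qed.
Let cos_in := fluxon_cos_in g0 L0 pf fp.
Let cos_out := fluxon_cos_out g0 L0 pf fp.
Let in_bounds := fluxon_in_bounds g0 L0 pf fp gp.
Let out_cases := fluxon_out_cases g0 L0 pf fp gp.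

Lemma fluxon_p_sqrt x : - L <= x -> x <= L ->
  Num.sqrt (2 * (H_0 g + h - g * phi x)) = `|p x|.
Proof.
move=> x1 x2; rewrite -sqrtr_sqr; congr Num.sqrt.
by have := fluxon_energy_in L0 pf fp x1 x2; lra.
Qed.

Lemma on_branch_intro s b : branch_range g b h -> phi (- L) = branch_phi_in g s h ->
  phi L = branch_phi_out b h -> p L = branch_sign_out g b h * `|p L| ->
  on_branch g L phi h s b.
Proof.
have L1 := L0; move=> hr hi ho hs; have [pin _] := in_bounds.
have pi_ : p (- L) = branch_p_in g s h.
  by rewrite /branch_p_in -hi fluxon_p_sqrt ?gtr0_norm//; lra.
have po : p L = branch_p_out g b h.
  by rewrite /branch_p_out -ho fluxon_p_sqrt//; lra.
split => //; rewrite /branch_L -pi_ -po.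
by have e := fluxon_p_out L0 pf; rewrite e; field; rewrite gt_eqF.
Qed.

Lemma fluxon_saddle_h : phi L = asin g + 2 * pi -> h = h_2 g.
Proof. by move=> fL; move: cos_out; rewrite fL cos_D2pi (h_2E g01); lra. Qed.

Lemma fluxon_branch_in : exists s, phi (- L) = branch_phi_in g s h.
Proof.
have [_ /andP[i1 i2]] := in_bounds; have /andP[a0 _] := asin_bounds g01.
have [/andP[_ m2] _] := tm.
have hb : 0 <= phi (- L) <= 2 * pi by rewrite ltW ?(lt_trans a0)//= ltW// (lt_trans i2).
have cE : 2 * pi * g - (1 - h) = - cos (phi (- L)) by rewrite cos_in; ring.
rewrite /branch_phi_in cE acos_opp_cos//; have [h1|h1] := leP pi (phi (- L)).
  by exists true; rewrite ger0_norm ?subr_ge0//; ring.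
by exists false; rewrite ltr0_norm ?subr_lt0//; ring.
Qed.

(** The branch is read off from the position of phi_out relative to 2 pi, the saddle and 3 pi, and,
    beyond the saddle, from the sign of the momentum. *)
Lemma fluxon_branch_out : exists b, [/\ branch_range g b h, phi L = branch_phi_out b h
  & p L = branch_sign_out g b h * `|p L|].
Proof.
have p0 := @pi_gt0 R; have /andP[a0 a1] := asin_bounds g01.
have [/andP[_ m2] em] := tm; have m3 := m_pi.
have h0 := fluxon_h_ge0 g0 L0 pf fp; have hm := fluxon_h_max g0 L0 pf fp.
have co : cos (phi L - 2 * pi) = 1 - h by rewrite -cos_D2pi subrK cos_out.
have turn2 : 2 * pi <= phi L <= 3 * pi -> phi L = 2 * pi + acos (1 - h).
  by move=> hb; rewrite -cos_out acos_cos_turn2//; ring.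
have [cst|[pp /andP[h1 h2]]|/andP[h1 h2]] := out_cases.
- have [fL pL] := cst L (lexx L); exists Br2; split => /=; rewrite ?h0 ?hm//.
    by rewrite (fluxon_saddle_h fL) (acos_h_2 g01) fL addrC.
  by rewrite pL normr0 mulr0.
- have [h3|h3] := leP (2 * pi) (phi L); last first.
    exists Br1; split => /=; rewrite ?h0 ?mul1r ?gtr0_norm//.
    by rewrite -cos_out acos_cos_turn1 ?h1 ?ltW//; ring.
  have lt : h < h_2 g.
    have i : phi L - 2 * pi < asin g by rewrite ltrBlDr.
    have := cos_decr (x := phi L - 2 * pi) _ i; rewrite subr_ge0 co (h_2E g01) => /(_ h3 ltac:(lra)).
    by lra.
  exists Br2; split => /=; rewrite ?h0 ?(ltW lt) ?mul1r ?gtr0_norm//.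
  by apply: turn2; rewrite h3 ltW// (lt_trans h2)//; lra.
have g1 : asin g < phi L - 2 * pi by rewrite ltrBrDr.
have [h3|h3] := leP (phi L) (3 * pi).
  have lt : h_2 g < h.
    have := cos_decr (ltW a0) g1; rewrite co (h_2E g01) => /(_ ltac:(lra)).
    by lra.
  have fE : phi L = 2 * pi + acos (1 - h).
    by apply: turn2; rewrite h3 andbT ltW// (lt_trans _ h1)// ltrDr.
  have [pp|pn] := leP 0 (p L); first by exists Br3; split => /=; rewrite ?lt ?hm ?mul1r ?ger0_norm.
  exists Br2; split => /=; rewrite ?h0 ?hm//.
  by rewrite leNgt lt /= ltr0_norm//; ring.
have fE : phi L = 4 * pi - acos (1 - h).
  rewrite -cos_out acos_cos_turn3; first by ring.
  by rewrite ltW//= (le_trans h2)//; lra.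
have h3' : pi <= phi L - 2 * pi by lra.
have incr : phi L - 2 * pi < phi_max g -> h_1 g < h.
  by move=> /(cos_incr h3') /(_ (ltW m2)); rewrite co /h_1; lra.
have [pp|pn] := leP 0 (p L).
  exists Br4; split => /=; rewrite ?hm ?mul1r ?ger0_norm// andbT.
  have [e|ne] := eqVneq (phi L - 2 * pi) (phi_max g).
    by rewrite /h_1 -e co opprB addrC subrK.
  by apply/ltW/incr; rewrite lt_neqAle ne lerBlDl.
exists Br5; split => /=; rewrite ?hm ?ltr0_norm//; last by ring.
(* Branch 5 leaves out h = h_1: there phi_out is the turning point and the momentum is zero, not
   negative. *)
rewrite andbT; apply: incr; rewrite lt_neqAle lerBlDl h2 andbT; apply/eqP => e.
have := fluxon_energy_right g0 L0 pf (lexx L).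
rewrite (fluxon_H0 g0 L0 pf) (_ : phi L = phi_max g + 2 * pi); last by rewrite -e subrK.
have pp : 0 < p L ^+ 2 by rewrite exprn_even_gt0//= lt_eqF.
by move: em pp; rewrite /V cos_D2pi; lra.
Qed.

Lemma fluxon_on_branch : exists s b, on_branch g L phi h s b.
Proof.
have [s hs] := fluxon_branch_in; have [b [hb1 hb2 hb3]] := fluxon_branch_out.
by exists s, b; exact: on_branch_intro.
Qed.

Lemma branch_range_bounds b y : branch_range g b y -> 0 <= y <= h_max g.
Proof.
have h2 := h_2_gt0 g01; have h1 := h_1_gt0 g01.
by case: b => //= /andP[y1 ->]; rewrite andbT;
  [exact: ltW (lt_trans h2 y1)|exact: le_trans (ltW h1) y1|exact: ltW (lt_trans h1 y1)].
Qed.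

Lemma h_max_le2 : h_max g <= 2.
Proof. by rewrite /h_max ler_piMr// gerBl mulr_ge0// pi_ge0. Qed.

Lemma branch_range_limit_point b : branch_range g b h -> h < h_max g ->
  limit_point (branch_range g b) h.
Proof.
move=> hb hm U /nbhs_ballP[d /= d0 HU].
pose y := Num.min (h + d / 2) (h_max g).
have hy : h < y by rewrite lt_min hm andbT; lra.
have y1 : y <= h + d / 2 by rewrite ge_min lexx.
have y2 : y <= h_max g by rewrite ge_min lexx orbT.
exists y; split; first by rewrite gt_eqF.
  by case: b hb => /= /andP[b1 b2]; apply/andP; split => //; lra.
by apply: HU; rewrite /ball /= ltr0_norm; lra.
Qed.

Lemma mid_bounds : 0 < h -> h < h_max g -> -1 < 2 * pi * g - (1 - h) < 1 /\ 0 < h < 2.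
Proof.
have : 0 < pi * g by rewrite mulr_gt0 ?pi_gt0.
by rewrite /h_max => *; split; apply/andP; split; lra.
Qed.

Lemma on_branch_saddle s b : on_branch g L phi h s b -> phi L = asin g + 2 * pi -> b = Br2.
Proof.
move=> [hb _ _ [oE _]] fL; have /andP[a0 a1] := asin_bounds g01; have p0 := @pi_gt0 R.
have aE : acos (1 - h) = asin g by rewrite (fluxon_saddle_h fL) (acos_h_2 g01).
move: oE hb; rewrite fL; case: b => //= oE hb; exfalso.
- by move: oE; rewrite aE; lra.
- by move: hb; rewrite -(fluxon_saddle_h fL) ltxx.
- by move: oE; rewrite aE; lra.
- by move: oE; rewrite aE; lra.
Qed.

Lemma on_branch_derivative s b : on_branch g L phi h s b -> 0 < h -> h < h_max g ->
  p L != 0 \/ phi L = asin g + 2 * pi ->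
  exists2 l, is_derive_in (branch_range g b) (branch_L g s b) h l &
    l = 0 <-> is_eigenvalue L phi 0.
Proof.
move=> ob h0 hm cs; have [hb _ [iE piE] [oE poE]] := ob; have [hx h2] := mid_bounds h0 hm.
have [pin _] := in_bounds.
have [si di] := branch_phi_in_derive s hx.
have [so do_] := branch_phi_out_derive b h2.
have pi0 : 0 < branch_p_in g s h by rewrite -piE.
have dpi := branch_p_in_derive hx pi0.
have lp := branch_range_limit_point hb hm.
have key (l : R) : is_derive h 1 (branch_p_out g b) l ->
    is_derive_in (branch_range g b) (branch_L g s b) h
     (((1 - g / sin (branch_phi_in g s h)) / branch_p_in g s h - l) / (2 * g)).
  move=> dl; apply: derive_in_of => //.
  by apply: (is_derive_eqx (is_deriveMx (is_deriveBx dpi dl) (is_derive_cstx (2 * g)^-1 h))); ring.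
have gn : (2 * g)^-1 != 0 by rewrite invr_eq0 gt_eqF// mulr_gt0.
rewrite -iE in si *; rewrite -piE -?iE in key.
have pn : p (- L) != 0 by rewrite gt_eqF.
have [fL|fL] := eqVneq (phi L) (asin g + 2 * pi).
  have hE := fluxon_saddle_h fL; have bE := on_branch_saddle ob fL.
  rewrite bE in key *; have d := branch_p_out_saddle g01; rewrite -hE in d.
  have D := key _ d; eexists; first exact: D.
  rewrite (fluxon_eigenvalue_cst g0 L0 pf fp gp fL).
  set k := Num.sqrt _.
  have e : g * p (- L) * sin (phi (- L)) *
     ((1 - g / sin (phi (- L))) / p (- L) - - (k / g)) =
     g * (sin (phi (- L)) - g) + k * p (- L) * sin (phi (- L)).
    by field; rewrite si pn gt_eqF.
  have nz : g * p (- L) * sin (phi (- L)) != 0 by rewrite !mulf_neq0// gt_eqF.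
  split=> [/eqP|e0].
    by rewrite mulf_eq0 (negbTE gn) orbF => /eqP e0; rewrite -e e0 mulr0.
  rewrite (_ : _ - _ = 0) ?mul0r//; apply: (mulfI nz); rewrite e e0 mulr0 //.
have {cs} pL : p L != 0 by case: cs => // e; rewrite e eqxx in fL.
have hb2 : b = Br2 -> h != h_2 g.
  move=> bE; apply/eqP => hE; move: fL; rewrite oE bE /= hE acos_h_2//.
  by rewrite addrC eqxx.
have pn2 : branch_p_out g b h != 0 by rewrite -poE.
have d := branch_p_out_derive h2 hb2 pn2.
have D := key _ d; eexists; first exact: D.
rewrite -poE -oE (fluxon_eigenvalue g0 L0 pf fp gp fL).
rewrite -oE in so.
(* Clearing denominators in 2 g dL/dh gives the difference of the two sides in [fluxon_eigenvalue],
   up to sign. *)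
have e : p (- L) * p L * sin (phi (- L)) * sin (phi L) *
     ((1 - g / sin (phi (- L))) / p (- L) - (1 - g / sin (phi L)) / p L) =
     p L * (sin (phi (- L)) - g) * sin (phi L) - p (- L) * (sin (phi L) - g) * sin (phi (- L)).
  by field; rewrite si so pL pn.
have nz : p (- L) * p L * sin (phi (- L)) * sin (phi L) != 0 by rewrite !mulf_neq0.
split=> [/eqP|e0].
  rewrite mulf_eq0 (negbTE gn) orbF => /eqP e0; symmetry; apply/eqP.
  by rewrite -subr_eq0 -e e0 mulr0.
rewrite (_ : _ - _ = 0) ?mul0r//; apply: (mulfI nz); rewrite e e0 mulr0 subrr//.
Qed.

Lemma norm_branch_p_out b y :
  `|branch_p_out g b y| = Num.sqrt (2 * (H_0 g + y - g * branch_phi_out b y)).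
Proof.
rewrite /branch_p_out normrM [X in _ * X]ger0_norm ?sqrtr_ge0//.
suff -> : `|branch_sign_out g b y| = 1 by rewrite mul1r.
by case: b => /=; rewrite ?normr1 ?normrN1//; case: ifP; rewrite ?normr1 ?normrN1.
Qed.

Lemma acos_sq_ge (c : R) : 0 <= c <= 2 -> 2 * c <= acos (1 - c) ^+ 2.
Proof.
move=> /andP[c0 c2]; have hx : -1 <= 1 - c <= 1 by apply/andP; split; lra.
by have := cos_ge_sq (acos_ge0 hx); rewrite acosK ?in_itv//; lra.
Qed.

(** p_out = p_in - 2 g L, so a derivative of L transfers regularity from one momentum to the
    other. *)
Lemma branch_lip_out A s b l y : is_derive_in A (branch_L g s b) y l ->
  lip_at A (branch_p_in g s) y -> lip_at A (branch_p_out g b) y.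
Proof.
move=> d li; have [Ay _ _] := d.
apply: lip_eq (lip_lin 1 (- (2 * g)) 0 li (derive_in_lip d)) => // z _.
by rewrite /branch_L; field; rewrite gt_eqF.
Qed.

Lemma branch_lip_in A s b l y : is_derive_in A (branch_L g s b) y l ->
  lip_at A (branch_p_out g b) y -> lip_at A (branch_p_in g s) y.
Proof.
move=> d li; have [Ay _ _] := d.
apply: lip_eq (lip_lin 1 (2 * g) 0 li (derive_in_lip d)) => // z _.
by rewrite /branch_L; field; rewrite gt_eqF.
Qed.

(* [f] stands for the angle and [F] for the square of the momentum. *)
Lemma lip_angle A (f F : R -> R) y : A y -> F = (fun z => 2 * (H_0 g + z - g * f z)) ->
  lip_at A (fun z => Num.sqrt (F z)) y -> 0 < F y -> lip_at A f y.
Proof.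
move=> Ay FE lF F0; have := lip_sqrt lF F0.
have li : lip_at A (fun z => z) y := derive_lip A (is_derive_idx y).
move=> lF'; apply: lip_eq (lip_lin (- (2 * g)^-1) g^-1 (g^-1 * H_0 g) lF' li) => // z _.
by rewrite FE; field; rewrite gt_eqF.
Qed.

(** For g = 1/pi one has h_max = 0, hence h = 0 and the cosines at the edges are -1 and 1; the
    bounds on the angles leave pi and 2 pi. *)
Lemma fluxon_critical : g = pi^-1 ->
  [/\ phi (- L) = pi, phi L = 2 * pi & 0 < p L].
Proof.
move=> gE; have p0 := @pi_gt0 R; have pg : pi * g = 1 by rewrite gE divff// gt_eqF.
have h0 : h = 0.
  have := fluxon_h_ge0 g0 L0 pf fp; have := fluxon_h_max g0 L0 pf fp.
  by rewrite /h_max => h1 h2; apply/eqP; rewrite eq_le h2 andbT; lra.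
have /andP[a0 a1] := asin_bounds g01; have [/andP[m1 m2] em] := tm.
have [pin /andP[i1 i2]] := in_bounds.
have cpi x : 0 < x < 2 * pi -> cos x = -1 -> x = pi.
  move=> /andP[x0 x2] cx; have [h1|/ltW h1] := leP x pi.
    by rewrite -(acos_cos_eq (y := -1) _ cx) ?acosN1//; apply/andP; split; lra.
  have e := @acos_cos_eq (2 * pi - x) (-1); rewrite cos_2pi_sub acosN1 in e.
  by have := e ltac:(apply/andP; split; lra) cx; lra.
have c1 := cos_out; rewrite h0 subr0 in c1.
split.
- by apply: cpi; [apply/andP; split; lra|rewrite cos_in h0; lra].
- have c2 : cos (phi L - pi) = -1.
    by rewrite -[LHS]opprK -cos_Dpi subrK c1.
  have b : 0 < phi L - pi < 2 * pi.
    have [cst|[pp /andP[h1 h2]]|/andP[h1 h2]] := out_cases.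
    + by have [e _] := cst L (lexx L); rewrite e; apply/andP; split; lra.
    + apply/andP; split; last by lra.
      rewrite subr_gt0 lt_neqAle h1 andbT; apply/eqP => e.
      by move: c2; rewrite -e subrr cos0 => e2; lra.
    + have [//|h3] := boolP (0 < phi L - pi < 2 * pi).
      rewrite negb_and -!leNgt in h3; case/orP: h3 => h3; first by lra.
      have e := @cos_lt1 R (4 * pi - phi L) ltac:(lra) ltac:(lra).
      exfalso; move: e; rewrite (_ : 4 * pi - _ = - (phi L - 2 * pi - 2 * pi)); last by ring.
      by rewrite cosN -cos_D2pi subrK -cos_D2pi subrK c1 ltxx.
  by have := cpi _ b c2; lra.
have [cst|[//]|/andP[f1 f2]] := out_cases.
  have [fL _] := cst L (lexx L); move: c1; rewrite fL cos_D2pi => c1.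
  by have := @cos_lt1 R (asin g) a0 ltac:(lra); rewrite c1; lra.
have := @cos_lt1 R (phi L - 2 * pi) ltac:(lra) ltac:(lra).
by rewrite -cos_D2pi subrK c1 ltxx.
Qed.

Lemma fluxon_critical_eigenvalue : g = pi^-1 -> is_eigenvalue L phi 0.
Proof.
move=> gE; have [iE oE _] := fluxon_critical gE.
have /andP[a0 a1] := asin_bounds g01.
have ne : phi L != asin g + 2 * pi by rewrite oE lt_eqF//; lra.
have s2 : sin (2 * pi) = 0 :> R by rewrite -[2 * pi]add0r sin_D2pi sin0.
by rewrite (fluxon_eigenvalue g0 L0 pf fp gp ne) iE oE sinpi s2 !mulr0.
Qed.

Lemma fluxon_turning_out : phi L = 2 * pi + phi_max g -> p L = 0.
Proof.
move=> oE; have [_ em] := tm.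
have := fluxon_energy_right g0 L0 pf (lexx L).
rewrite (fluxon_H0 g0 L0 pf) oE [2 * pi + _]addrC; move: em; rewrite /V cos_D2pi => em e.
by apply/eqP; rewrite -sqrf_eq0; apply/eqP; lra.
Qed.

Lemma fluxon_exceptional_eigenvalue : phi (- L) = pi -> phi L = 2 * pi + phi_max g ->
  is_eigenvalue L phi 0.
Proof.
move=> iE oE; have m3 := m_pi; have /andP[a0 a1] := asin_bounds g01; have p0 := @pi_gt0 R.
have ne : phi L != asin g + 2 * pi by rewrite oE gt_eqF//; lra.
rewrite (fluxon_eigenvalue g0 L0 pf fp gp ne).
by rewrite (fluxon_turning_out oE) iE sinpi mulr0 !mul0r.
Qed.

Lemma fluxon_h_max_turning : h = h_max g -> p L = 0 -> phi L != asin g + 2 * pi ->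
  [/\ phi (- L) = pi, phi L = 2 * pi + phi_max g & cos (phi_max g) + 1 = 2 * pi * g].
Proof.
move=> hE pL ne; have oE := fluxon_p_out_zero g0 L0 pf fp gp pL ne; have p0 := @pi_gt0 R.
have /andP[a0 a1] := asin_bounds g01; have [/andP[m1 m2] em] := tm.
have [pin /andP[i1 i2]] := in_bounds.
split => //; last first.
  by have := cos_out; rewrite oE addrC cos_D2pi hE /h_max => ->; ring.
have cx : cos (phi (- L)) = -1 by rewrite cos_in hE /h_max; ring.
have [h1|/ltW h1] := leP (phi (- L)) pi.
  by rewrite -(acos_cos_eq (y := -1) _ cx) ?acosN1//; apply/andP; split; lra.
have e := @acos_cos_eq (2 * pi - phi (- L)) (-1); rewrite cos_2pi_sub acosN1 in e.
by have := e ltac:(apply/andP; split; lra) cx; lra.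
Qed.

Hypothesis gl : g < pi^-1.
Let pg : pi * g < 1.
Proof. by have := gl; rewrite -[pi^-1]mul1r ltr_pdivlMr ?pi_gt0// mulrC. Qed.

(** p_in is differentiable at h = 0 and p_out does not vanish, so a derivative of L would make
    phi_out Lipschitz, although acos(1 - h) behaves like the square root of 2 h. *)
Lemma on_branch_h0_no_derivative s b l : on_branch g L phi h s b -> h = 0 ->
  ~ is_derive_in (branch_range g b) (branch_L g s b) h l.
Proof.
move=> [hb _ [iE piE] [oE poE]] h0 d; have p0 := @pi_gt0 R; have pg1 := pg.
have pgp : 0 < pi * g by rewrite mulr_gt0.
have /andP[a0 a1] := asin_bounds g01; have [/andP[m1 m2] em] := tm.
have [pin _] := in_bounds; have [_ lp _] := d.
have hx : -1 < 2 * pi * g - (1 - h) < 1 by rewrite h0; apply/andP; split; lra.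
have pi0 : 0 < branch_p_in g s h by rewrite -piE.
have lo := branch_lip_out d (derive_lip _ (branch_p_in_derive hx pi0)).
have pL : p L != 0.
  have c1 := cos_out; rewrite h0 subr0 in c1.
  have [cst|[pp _]|/andP[f1 f2]] := out_cases.
  - have [fL _] := cst L (lexx L); move: c1; rewrite fL cos_D2pi => c1.
    have := @cos_lt1 R (asin g) a0 ltac:(lra); rewrite c1; lra.
  - by rewrite gt_eqF.
  have := @cos_lt1 R (phi L - 2 * pi) ltac:(lra) ltac:(lra).
  by rewrite -cos_D2pi subrK c1 ltxx.
have F0 : 0 < 2 * (H_0 g + h - g * branch_phi_out b h).
  by rewrite -sqrtr_gt0 -norm_branch_p_out -poE normr_gt0.
have lf := @lip_angle _ (branch_phi_out b) _ h hb erefl (lip_eq hb (fun y _ => norm_branch_p_out b y) (lip_norm lo)) F0.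
apply: (not_lip_acos lp _ lf) => y Ay.
have h2p := h_2_gt0 g01; have h1p := h_1_gt0 g01.
have /andP[y0 y2] := branch_range_bounds Ay.
have yb : 0 <= y <= 2 by rewrite y0 (le_trans y2)// h_max_le2.
have e : (branch_phi_out b y - branch_phi_out b h) ^+ 2 = acos (1 - y) ^+ 2.
  move: hb; rewrite h0; case: b {Ay oE poE d lo F0 lf lp} => /= /andP[b1 b2].
  - by rewrite subr0 acos1; ring.
  - by rewrite subr0 acos1; ring.
  - by lra.
  - by lra.
  - by lra.
by rewrite e h0 subr0 ger0_norm// acos_sq_ge.
Qed.

(** Mirror image of the case h = 0: p_out is differentiable, at the saddle too, and phi_in has the
    vertical tangent. *)
Lemma on_branch_h_max_no_derivative s b l : on_branch g L phi h s b -> h = h_max g ->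
  p L != 0 \/ phi L = asin g + 2 * pi ->
  ~ is_derive_in (branch_range g b) (branch_L g s b) h l.
Proof.
move=> ob hE cs d; have [hb _ [iE piE] [oE poE]] := ob; have p0 := @pi_gt0 R; have pg1 := pg.
have pgp : 0 < pi * g by rewrite mulr_gt0.
have h2 : 0 < h < 2 by rewrite hE /h_max; apply/andP; split; lra.
have [pin _] := in_bounds; have [_ lp _] := d.
have lo : lip_at (branch_range g b) (branch_p_out g b) h.
  have [bh|bh] := pselect (b = Br2 /\ h = h_2 g).
    case: bh => bE ->; rewrite {2}bE; exact: derive_lip (branch_p_out_saddle g01).
  have bh' : b = Br2 -> h != h_2 g by move=> bE; apply/eqP => h2E; exact: bh.
  apply: derive_lip (branch_p_out_derive h2 bh' _); rewrite -poE.
  case: cs => // fL; exfalso; apply: bh.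
  by split; [exact: on_branch_saddle ob fL|exact: fluxon_saddle_h].
have li := branch_lip_in d lo.
have F0 : 0 < 2 * (H_0 g + h - g * branch_phi_in g s h).
  by rewrite -sqrtr_gt0 -/(branch_p_in g s h) -piE.
have lf := @lip_angle _ (branch_phi_in g s) _ h hb erefl li F0.
apply: (not_lip_acos lp _ lf) => y Ay.
have /andP[y0 y2] := branch_range_bounds Ay; rewrite -hE in y2.
have yb : 0 <= h - y <= 2.
  by rewrite subr_ge0 y2 lerBlDr ler_wpDr// hE h_max_le2.
have e : (branch_phi_in g s y - branch_phi_in g s h) ^+ 2 = acos (1 - (h - y)) ^+ 2.
  have z : acos (2 * pi * g - (1 - h)) = 0.
    by rewrite (_ : 2 * pi * g - (1 - h) = 1) ?acos1// hE /h_max; ring.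
  have z' : 2 * pi * g - (1 - y) = 1 - (h - y) by rewrite hE /h_max; ring.
  by rewrite /branch_phi_in; case: s {iE piE d li F0 lf ob}; rewrite z z'; ring.
by rewrite e distrC ger0_norm ?subr_ge0// acos_sq_ge.
Qed.

(** Here both angles are differentiable, but p_out is the root of a function with a simple zero at
    h_1, the left endpoint of branch 4. *)
Lemma on_branch_turning_no_derivative s b l : on_branch g L phi h s b -> 0 < h ->
  h < h_max g -> p L = 0 -> phi L != asin g + 2 * pi ->
  ~ is_derive_in (branch_range g b) (branch_L g s b) h l.
Proof.
move=> [hb _ [iE piE] [oE poE]] h0 hm pL ne d; have p0 := @pi_gt0 R.
have fL := fluxon_p_out_zero g0 L0 pf fp gp pL ne.
have [/andP[m1 m2] em] := tm; have m3 := m_pi; have [hx h2] := mid_bounds h0 hm.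
have [pin _] := in_bounds; have [_ lp _] := d.
have pi0 : 0 < branch_p_in g s h by rewrite -piE.
have lo := branch_lip_out d (derive_lip _ (branch_p_in_derive hx pi0)).
have hE : h = h_1 g by move: cos_out; rewrite fL addrC cos_D2pi /h_1; lra.
have bE : b = Br4.
  have hx2 : -1 <= 1 - h <= 1 by case/andP: h2 => i1 i2; apply/andP; split; lra.
  have b0 := acos_ge0 hx2; have b1 := acos_lepi hx2.
  move: oE hb; rewrite fL; case: b {poE d lp lo} => //= oE hb; exfalso; lra.
rewrite bE in d lo lp oE poE hb.
pose F y := 2 * (H_0 g + y - g * branch_phi_out Br4 y).
have Fh : F h = 0.
  apply/eqP; rewrite eq_le; apply/andP; split.
    by rewrite -sqrtr_eq0 -norm_branch_p_out -poE pL normr0.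
  by have := fluxon_energy_in L0 pf fp (x := L); rewrite pL oE /F; have := L0 => ?; lra.
have [so do_] := branch_phi_out_derive Br4 h2.
have dF : is_derive h 1 F (2 * (1 - g / sin (branch_phi_out Br4 h))).
  apply: (is_derive_eqx (is_deriveMx (is_derive_cstx 2 h) (is_deriveBx (is_deriveDx (is_derive_cstx (H_0 g) h) (is_derive_idx h)) (is_deriveMx (is_derive_cstx g h) do_)))).
  by ring.
have sneg : sin (branch_phi_out Br4 h) < 0.
  rewrite -oE fL addrC sin_D2pi -(subrK pi (phi_max g)) sin_Dpi oppr_lt0.
  by apply: sin_gt0_pi; apply/andP; split; lra.
apply: (not_lip_sqrt lp Fh _ dF _ (lip_eq hb (fun y _ => norm_branch_p_out Br4 y) (lip_norm lo))).
  have : g / sin (branch_phi_out Br4 h) < 0 by rewrite pmulr_rlt0// invr_lt0.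
  by lra.
by move=> y /=; rewrite -hE => /andP[].
Qed.

(** At h = 0 the sine of phi_out is zero, and the eigenvalue relation reduces to p_in g sin phi_in =
    0, whereas cos phi_in = 1 - 2 pi g lies strictly between -1 and 1. *)
Lemma fluxon_h0_no_eigenvalue : h = 0 -> ~ is_eigenvalue L phi 0.
Proof.
move=> h0; have p0 := @pi_gt0 R; have pg1 := pg.
have pgp : 0 < pi * g by rewrite mulr_gt0.
have /andP[a0 a1] := asin_bounds g01.
have [pin _] := in_bounds.
have c1 := cos_out; rewrite h0 subr0 in c1.
have fL : phi L != asin g + 2 * pi.
  apply/eqP => fL; move: c1; rewrite fL cos_D2pi => c1.
  by have := @cos_lt1 R (asin g) a0 ltac:(lra); rewrite c1; lra.
have sz : sin (phi L) = 0.
  by have := cos2Dsin2 (phi L); rewrite c1 expr1n => /eqP; rewrite -subr_eq0 addrC addKr sqrf_eq0 => /eqP.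
rewrite (fluxon_eigenvalue g0 L0 pf fp gp fL) sz mulr0 sub0r => /eqP.
rewrite !mulf_eq0 oppr_eq0 (gt_eqF pin) (gt_eqF gp) /= => /eqP si.
have := cos2Dsin2 (phi (- L)); rewrite si expr0n addr0 cos_in h0 subr0 => e.
have : (1 - 2 * pi * g) ^+ 2 < 1.
  rewrite -subr_gt0 (_ : _ - _ = 4 * (pi * g) * (1 - pi * g)); last by ring.
  by rewrite !mulr_gt0//; lra.
by rewrite e ltxx.
Qed.

Lemma sin_in_neq0 : 0 < h -> h < h_max g -> sin (phi (- L)) != 0.
Proof.
move=> h0 hm; have p0 := @pi_gt0 R; have pgp : 0 < pi * g by rewrite mulr_gt0.
apply/eqP => si; have := cos2Dsin2 (phi (- L)); rewrite si expr0n addr0 cos_in => e.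
have : (1 - 2 * pi * g - h) ^+ 2 < 1.
  rewrite -subr_gt0 (_ : _ - _ = (2 * pi * g + h) * (h_max g - h)); last by rewrite /h_max; ring.
  by rewrite !mulr_gt0//; lra.
by rewrite e ltxx.
Qed.

(** Where L is differentiable, the determinant is a non-zero multiple of dL/dh. At h = 0, at h =
    h_max and at the turning point the two are compared separately; only h = h_max with phi_out at
    the turning point gives an eigenvalue without a derivative. *)
Lemma fluxon_eigenvalue_iff : is_eigenvalue L phi 0 <->
  (exists s b, on_branch g L phi h s b /\
     is_derive_in (branch_range g b) (branch_L g s b) h 0) \/
  [/\ h = h_max g, p L = 0 & phi L != asin g + 2 * pi].
Proof.
have h0 := fluxon_h_ge0 g0 L0 pf fp; have hm := fluxon_h_max g0 L0 pf fp.
have p0 := @pi_gt0 R; have pg1 := pg; have [pin _] := in_bounds.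
have pgp : 0 < pi * g by rewrite mulr_gt0.
have smax : h = h_max g -> sin (phi (- L)) = 0.
  move=> hE; have := cos2Dsin2 (phi (- L)); rewrite cos_in hE /h_max => e.
  by apply/eqP; rewrite -sqrf_eq0; apply/eqP; lra.
have [h0E|h0n] := eqVneq h 0.
  split=> [/(fluxon_h0_no_eigenvalue h0E) //|[[s [b [ob d]]]|[hE _ _]]].
    by have := on_branch_h0_no_derivative ob h0E d.
  by move: hE; rewrite h0E /h_max => hE; exfalso; lra.
have hp : 0 < h by rewrite lt_neqAle eq_sym h0n.
have [hE|hn] := eqVneq h (h_max g).
  have sz := smax hE.
  have [fL|fL] := eqVneq (phi L) (asin g + 2 * pi).
    split=> [|[[s [b [ob d]]]|[]//]].
      rewrite (fluxon_eigenvalue_cst g0 L0 pf fp gp fL) sz mulr0 addr0 sub0r mulrN => /eqP.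
      by rewrite oppr_eq0 mulf_eq0 gt_eqF.
    by have := on_branch_h_max_no_derivative ob hE (or_intror fL) d.
  rewrite (fluxon_eigenvalue g0 L0 pf fp gp fL) sz mulr0 sub0r.
  split=> [/esym/eqP|[[s [b [ob d]]]|[_ -> _]]]; last by rewrite !mul0r.
    rewrite mulrAC mulf_eq0 oppr_eq0 (gt_eqF gp) orbF mulf_eq0 => /orP[/eqP pL|/eqP so].
      by right; split.
    have := cos2Dsin2 (phi L); rewrite so expr0n addr0 cos_out hE /h_max => e.
    have : (1 - 2 * (1 - pi * g)) ^+ 2 < 1.
      rewrite -subr_gt0 (_ : _ - _ = 4 * (pi * g) * (1 - pi * g)); last by ring.
      by rewrite !mulr_gt0//; lra.
    by rewrite e ltxx.
  have [pL|pL] := eqVneq (p L) 0; first by rewrite pL !mul0r.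
  by have := on_branch_h_max_no_derivative ob hE (or_introl pL) d.
have hlt : h < h_max g by rewrite lt_neqAle hn.
have [[pL fL]|cs] := pselect (p L = 0 /\ phi L != asin g + 2 * pi).
  split=> [|[[s [b [ob d]]]|[hE _ _]]].
  - rewrite (fluxon_eigenvalue g0 L0 pf fp gp fL) pL !mul0r => /eqP.
    rewrite !mulf_eq0 (gt_eqF pin) (negbTE (sin_in_neq0 hp hlt)) orbF /=.
    rewrite (fluxon_p_out_zero g0 L0 pf fp gp pL fL) [2 * pi + _]addrC sin_D2pi subr_eq0 lt_eqF//.
    exact: (sin_turning g01 tm).
  - by have := on_branch_turning_no_derivative ob hp hlt pL fL d.
  - by rewrite hE eqxx in hn.
have cs' : p L != 0 \/ phi L = asin g + 2 * pi.
  have [fL|fL] := eqVneq (phi L) (asin g + 2 * pi); first by right.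
  by left; apply/eqP => pL; apply: cs.
split=> [ev|[[s [b [ob d]]]|[hE _ _]]].
- left; have [s [b ob]] := fluxon_on_branch; exists s, b; split => //.
  by have [l dl [_ /(_ ev) l0]] := on_branch_derivative ob hp hlt cs'; rewrite l0 in dl.
- have [l dl [+ _]] := on_branch_derivative ob hp hlt cs'.
  by apply; exact: derive_in_uniq dl d.
- by rewrite hE eqxx in hn.
Qed.

End BranchFluxon.

(** * The critical bias current *)

Section Critical.
Context {R : realType}.
Implicit Types (x y l a : R).

(* Along an orbit converging to the saddle, [u'^2 - u''^2] is a function of [u]
   that is minimal at the saddle. *)
Lemma stable_ratio (g a : R) (u u1 : R -> R) : 0 < g < 1 -> stable g (asin g) a u u1 ->
  exists X, forall x, X <= x -> (sin (u x) - g) ^+ 2 <= u1 x ^+ 2.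
Proof.
move=> g01 [orb ul]; have [_ E] := orbit_limit orb ul.
have /andP[a0 a1] := asin_bounds g01; have p0 := @pi_gt0 R.
(* This distance keeps the orbit between - pi - asin g and pi - asin g, where sin - g has the sign
   of the distance to the saddle. *)
have [M HM] := cvgy_dist ul (eps := pi - 2 * asin g) ltac:(lra).
exists (Num.max a M) => x; rewrite ge_max => /andP[ax Mx].
have Ex := E x ax; have := HM x Mx; rewrite ltr_norml => /andP[h1 h2].
pose F y : R := 2 * (V g (asin g) - V g y) - (sin y - g) ^+ 2.
have dF y : is_derive y 1 F (2 * (sin y - g) * (1 - cos y)).
  have d1 := is_derive_sqrx (is_deriveBx (is_derive_sinx (is_derive_idx y)) (is_derive_cstx g y)).
  have d2 := is_deriveMx (is_derive_cstx 2 y) (is_deriveBx (is_derive_cstx (V g (asin g)) y) (is_derive_V g y)).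
  by apply: (is_derive_eqx (is_deriveBx d2 d1)); ring.
have cF y : {for y, continuous F} by exact: is_derive_cont (dF y).
have Fa : F (asin g) = 0 by rewrite /F sin_asin// !subrr expr0n mulr0 subrr.
suff F0 : 0 <= F (u x).
  by move: F0; rewrite /F -Ex /energy; lra.
rewrite -Fa; have [ua|au] := leP (u x) (asin g).
  apply: (@derive_le0_le R F (fun y => 2 * (sin y - g) * (1 - cos y))) => // y /andP[y1 y2].
  rewrite mulr_le0_ge0 ?subr_ge0 ?cos_le1// pmulr_rle0// subr_le0 ltW//.
  by apply: (sin_lt_g_left g01); lra.
apply: (@derive_ge0_le R F (fun y => 2 * (sin y - g) * (1 - cos y))) => //; first exact: ltW.
move=> y /andP[y1 y2].
rewrite mulr_ge0 ?subr_ge0 ?cos_le1// pmulr_rge0// subr_ge0 ltW//.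
by apply: (sin_gt_g g01); lra.
Qed.

Lemma dense_off_norm (L d x : R) : 0 < L -> 0 < d ->
  exists2 y, `|y - x| < d & `|y| != L.
Proof.
move=> L0 d0; have [xL|xL] := eqVneq `|x| L; last by exists x; rewrite ?subrr ?normr0.
have t0 : 0 < d / (2 * L) by rewrite divr_gt0// mulr_gt0.
exists (x * (1 + d / (2 * L))).
  have -> : x * (1 + d / (2 * L)) - x = x * (d / (2 * L)) by ring.
  rewrite normrM xL gtr0_norm//.
  have -> : L * (d / (2 * L)) = d / 2 by field; rewrite gt_eqF.
  by lra.
rewrite normrM xL gtr0_norm ?addr_gt0// -subr_eq0 mulrDr mulr1 addrAC subrr add0r.
by rewrite mulf_neq0// gt_eqF.
Qed.

Section Picone.
Variables (w w1 p q : R -> R) (mu : R).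
Hypotheses (mu0 : 0 < mu) (cw : continuous w) (cw1 : continuous w1)
  (cp : continuous p) (cq : continuous q).

(** Picone's expression for a solution [w] at level mu > 0 and a zero mode [p] with derivative [q];
    its derivative is a sum of nonnegative terms. *)
Definition picone x := (w1 x * p x - w x * q x) * w x / p x.

Lemma picone_derive x (c : R) : p x != 0 -> is_derive x 1 w (w1 x) ->
  is_derive x 1 w1 ((c + mu) * w x) -> is_derive x 1 p (q x) -> is_derive x 1 q (c * p x) ->
  is_derive x 1 picone (mu * w x ^+ 2 + ((w1 x * p x - w x * q x) / p x) ^+ 2).
Proof.
move=> px dw dw1 dp dq.
have d := is_deriveMx (is_deriveMx (is_deriveBx (is_deriveMx dw1 dp) (is_deriveMx dw dq)) dw) (is_deriveVx px dp).
by apply: (is_derive_eqx d); field.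
Qed.

Lemma picone_le a b (c : R -> R) : a <= b -> (forall x, a <= x -> x <= b -> 0 < p x) ->
  (forall x : R, a < x -> x < b -> [/\ is_derive x 1 w (w1 x), is_derive x 1 w1 ((c x + mu) * w x),
     is_derive x 1 p (q x) & is_derive x 1 q (c x * p x)]) ->
  picone a <= picone b.
Proof.
move=> ab pp d.
apply: (@derive_ge0_le R picone (fun x => mu * w x ^+ 2 + ((w1 x * p x - w x * q x) / p x) ^+ 2)) => //.
- move=> x /andP[x1 x2]; have px : p x != 0 by rewrite gt_eqF// pp.
  apply: cvgM; last by apply: cvgV => //; exact: cp.
  apply: cvgM; last exact: cw.
  by apply: cvgB; apply: cvgM; [exact: cw1|exact: cp|exact: cw|exact: cq].
- move=> x /andP[x1 x2]; have [d1 d2 d3 d4] := d x x1 x2.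
  by apply: picone_derive d1 d2 d3 d4; rewrite gt_eqF// pp// ltW.
by move=> x _; rewrite addr_ge0 ?sqr_ge0// mulr_ge0 ?sqr_ge0// ltW.
Qed.

(** Where the expression is constant its derivative vanishes, and with it the term mu w^2. *)
Lemma picone_cst_zero a b (c : R) x : a < x -> x < b -> 0 < p x ->
  (forall y, a < y -> y < b -> picone y = 0) ->
  is_derive x 1 w (w1 x) -> is_derive x 1 w1 ((c + mu) * w x) ->
  is_derive x 1 p (q x) -> is_derive x 1 q (c * p x) -> w x = 0.
Proof.
move=> ax xb px P0 dw dw1 dp dq; have pn : p x != 0 by rewrite gt_eqF.
have d := picone_derive pn dw dw1 dp dq.
have d0 : is_derive x 1 picone 0.
  apply: near_eq_is_derive (is_derive_cstx 0 x); near=> y; rewrite P0//; near: y.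
    exact: lt_nbhsr.
  exact: lt_nbhsl.
have /eqP := is_derive_uniq d d0.
rewrite paddr_eq0 ?sqr_ge0//; last by rewrite mulr_ge0 ?sqr_ge0// ltW.
by rewrite mulf_eq0 (gt_eqF mu0) /= sqrf_eq0 => /andP[/eqP].
Unshelve. all: by end_near. Qed.

(** Dominance of p over q bounds the quotient q / p by one; the bound has the shape of
    [decaying_small] applied to [w] twice. *)
Lemma picone_bound x : q x ^+ 2 <= p x ^+ 2 -> 0 < p x ->
  `|picone x| <= w x ^+ 2 + w1 x ^+ 2 + w x ^+ 2 + w1 x ^+ 2.
Proof.
move=> qp px; have pn : p x != 0 by rewrite gt_eqF.
have r1 : `|q x / p x| <= 1.
  rewrite normrM normfV ler_pdivrMr ?normr_gt0// mul1r.
  by rewrite -ler_sqr ?nnegrE// !real_normK ?num_real.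
have -> : picone x = w1 x * w x - w x ^+ 2 * (q x / p x) by rewrite /picone; field.
apply: le_trans (ler_normB _ _) _; rewrite [ `|w x ^+ 2 * _| ]normrM [ `|w x ^+ 2| ]ger0_norm ?sqr_ge0//.
have i1 : w x ^+ 2 * `|q x / p x| <= w x ^+ 2 by rewrite ler_piMr// sqr_ge0.
have i2 : `|w1 x * w x| <= w x ^+ 2 + w1 x ^+ 2.
  have s0 := sqr_ge0 (w x); have s1 := sqr_ge0 (w1 x).
  have s2 := sqr_ge0 (w x + w1 x); have s3 := sqr_ge0 (w x - w1 x).
  by rewrite ler_norml; apply/andP; split; lra.
by have s1 := sqr_ge0 (w1 x); lra.
Qed.

End Picone.

Variables (g L h : R) (phi : R -> R).
Hypotheses (g0 : 0 <= g) (L0 : 0 < L) (pf : pinned_fluxon g L phi)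
  (fp : fluxon_parameter g L phi h) (gE : g = pi^-1).
Local Notation p := (derive1 phi).
Let gp : 0 < g. Proof. by rewrite gE invr_gt0 pi_gt0. Qed.
Let g01 : 0 < g < 1. Proof. by rewrite gp (fluxon_g_lt1 g0 L0 pf fp). Qed.
Let tm : turning g (phi_max g). Proof. exact: phi_max_turning g01. Qed.

(** Left tail: the way up the homoclinic loop starting from the saddle. Inside, the momentum
    decreases to a positive value; the right tail approaches its saddle from below. *)
Lemma critical_increasing x : 0 < p x.
Proof.
have L1 := L0; have [iE oE pL] := fluxon_critical g0 L0 pf fp gp gE.
have /andP[a0 a1] := asin_bounds g01; have p0 := @pi_gt0 R.
have [pin _] := fluxon_in_bounds g0 L0 pf fp gp.
have [Lx|xL] := leP L x.
  have [hr|hr|hr] := stable_cases g01 tm (stable_shift (fluxon_right L0 pf)).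
  - by have [_ pz] := hr L (lexx L); rewrite pz ltxx in pL.
  - by have [] := hr x Lx.
  - by have /andP[] := hr L (lexx L); rewrite oE => ? ?; lra.
have [xl|lx] := leP x (- L); last first.
  have := @fluxon_in R g L phi pf x L (ltW lx) (ltW xL) ltac:(lra) (lexx _).
  have : 0 <= g * (L - x) by rewrite mulr_ge0//; lra.
  by lra.
move: xl; rewrite le_eqVlt => /orP[/eqP -> //|xl].
have := stable_well_decr g01 tm (fluxon_left L0 pf); rewrite iE => H.
have := H ltac:(lra) ltac:(lra) (- x) ltac:(lra); rewrite opprK; lra.
Qed.

(** The Picone expression is nondecreasing along the line and arbitrarily small far out on both
    sides, hence zero, which kills the eigenfunction off the edges and then everywhere by
    continuity. *)
Lemma critical_largest mu : is_eigenvalue L phi mu -> mu <= 0.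
Proof.
have L1 := L0; have cphi := fluxon_continuous pf; have cp := fluxon_p_continuous pf.
rewrite leNgt => ev; apply/negP => mu0.
have [w [w1 ew]] := eigenvalue_eigenfunction L0 cphi ev.
have [[cw cw1] dw _ [x0 wx0]] := ew.
have [_ dr] := eigenfunction_right L0 ew; have [_ dl] := eigenfunction_left L0 ew.
have [iE oE pL] := fluxon_critical g0 L0 pf fp gp gE.
pose qo x := sin (phi x) - g; pose qi (x : R) : R := - g.
have cqo : continuous qo.
  move=> x; apply: cvgB; last exact: cvg_cst.
  by apply: (@continuous_comp _ _ _ phi sin); [exact: cphi|exact: continuous_sin].
have cqi : continuous qi by move=> x; exact: cvg_cst.
have dqo x : is_derive x 1 qo (cos (phi x) * p x).
  by apply: (is_derive_eqx (is_deriveBx (is_derive_sinx (fluxon_derive pf x)) (is_derive_cstx g x))); rewrite subr0.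
have dout x : L < `|x| -> [/\ is_derive x 1 w (w1 x), is_derive x 1 w1 ((cos (phi x) + mu) * w x),
     is_derive x 1 p (qo x) & is_derive x 1 qo (cos (phi x) * p x)].
  move=> xL; have [|d1 d2] := dw x; first by rewrite gt_eqF.
  split => //; last exact: (fluxon_derive2_out pf).
  by move: d2; rewrite /coef D_out ?mul1r// ltW.
have din x : `|x| < L -> [/\ is_derive x 1 w (w1 x), is_derive x 1 w1 ((0 + mu) * w x),
     is_derive x 1 p (qi x) & is_derive x 1 qi (0 * p x)].
  move=> xL; have [|d1 d2] := dw x; first by rewrite lt_eqF.
  split => //; [by move: d2; rewrite /coef D_in ?mul0r| |by rewrite mul0r; exact: is_derive_cstx].
  exact: (fluxon_derive2_in pf).
have s2 : sin (2 * pi) = 0 :> R by rewrite -[2 * pi]add0r sin_D2pi sin0.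
pose Po := picone w w1 p qo; pose Pi := picone w w1 p qi.
(* The second derivative of phi jumps by the sine at an edge, and here phi is pi and 2 pi there; so
   the Picone expression does not jump. *)
have eL : Po L = Pi L by rewrite /Po /Pi /picone /qo /qi oE s2 sub0r.
have eR : Po (- L) = Pi (- L) by rewrite /Po /Pi /picone /qo /qi iE sinpi sub0r.
have pp x : 0 < p x := critical_increasing x.
have mo a b : a <= b -> (forall x, a < x -> x < b -> L < `|x|) -> Po a <= Po b.
  move=> ab H; apply: (picone_le mu0 cw cw1 cp cqo (c := fun x => cos (phi x)) ab) => // x x1 x2.
  exact/dout/H.
have mi a b : - L <= a -> a <= b -> b <= L -> Pi a <= Pi b.
  move=> La ab bL; apply: (picone_le mu0 cw cw1 cp cqi (c := fun=> 0) ab) => // x x1 x2.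
  by apply: din; rewrite ltr_norml (le_lt_trans La x1) (lt_le_trans x2 bL).
have nR a x : L <= a -> a < x -> L < `|x|.
  by move=> La ax; apply: lt_le_trans (ler_norm x); exact: le_lt_trans ax.
have nL b x : b <= - L -> x < b -> L < `|x|.
  move=> bL xb; rewrite -normrN; apply: lt_le_trans (ler_norm _).
  by rewrite ltrNr; exact: lt_le_trans bL.
have [X1 H1] := stable_ratio g01 (stable_shift (fluxon_right L0 pf)).
have [X2 H2] := stable_ratio g01 (fluxon_left L0 pf).
have right0 y : L <= y -> Po y <= 0.
  move=> Ly; apply/ler_addgt0Pr => e e0; rewrite add0r.
  have [x] := decaying_small (Num.max X1 y) dr dr e0; rewrite ge_max => /andP[Xx yx] hx.
  apply: le_trans (mo _ _ yx (fun z z1 _ => nR y z Ly z1)) _.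
  apply: le_trans (ler_norm _) _; apply: le_trans (picone_bound w w1 _ (pp x)) (ltW hx).
  by have := H1 x Xx; rewrite -sin_D2pi subrK.
have left0 y : y <= - L -> 0 <= Po y.
  move=> yL; rewrite -oppr_le0; apply/ler_addgt0Pr => e e0; rewrite add0r.
  have [x] := decaying_small (Num.max X2 (- y)) dl dl e0; rewrite ge_max => /andP[Xx yx] hx.
  have xy : - x <= y by rewrite lerNl.
  apply: le_trans (_ : - Po (- x) <= _).
    by rewrite lerN2; apply: mo xy (fun z _ z2 => nL y z yL z2).
  apply: le_trans (ler_norm _) _; rewrite normrN.
  apply: le_trans (picone_bound w w1 _ (pp (- x))) _.
    by have := H2 x Xx; rewrite sqrrN.
  by move: hx; rewrite sqrrN => hx; exact: ltW.
have L2 : - L <= L by rewrite (gt0_cp L0).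
have m1 := mi (- L) L (lexx _) L2 (lexx _).
have l1 := left0 (- L) (lexx _); have r1 := right0 L (lexx _).
have l2 : Po (- L) <= 0 by rewrite eR (le_trans m1)// -eL.
have r2 : 0 <= Po L by rewrite eL (le_trans _ m1)// -eR.
have Z1 y : y <= - L -> Po y = 0.
  move=> yL; apply/eqP; rewrite eq_le left0// andbT.
  exact: le_trans (mo y (- L) yL (fun z _ z2 => nL (- L) z (lexx _) z2)) l2.
have Z2 y : L <= y -> Po y = 0.
  move=> yL; apply/eqP; rewrite eq_le right0//=.
  exact: le_trans r2 (mo L y yL (fun z z1 _ => nR L z (lexx _) z1)).
have Z3 y : - L <= y -> y <= L -> Pi y = 0.
  move=> y1 y2; have i1 := mi (- L) y (lexx _) y1 y2; have i2 := mi y L y1 y2 (lexx _).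
  by apply/eqP; rewrite eq_le (le_trans i2) -?eL//= (le_trans _ i1)// -eR.
have wz x : `|x| != L -> w x = 0.
  move=> xL; have [xi|xo] : `|x| < L \/ L < `|x| by apply/orP; rewrite -neq_lt.
    have [d1 d2 d3 d4] := din x xi; move: xi; rewrite ltr_norml => /andP[x1 x2].
    apply: (picone_cst_zero mu0 x1 x2 (pp x) _ d1 d2 d3 d4) => y y1 y2.
    by apply: Z3; exact: ltW.
  have [d1 d2 d3 d4] := dout x xo.
  have [h0|h0] := leP 0 x.
    rewrite ger0_norm// in xo.
    apply: (picone_cst_zero mu0 xo (_ : x < x + 1) (pp x) _ d1 d2 d3 d4); first by rewrite ltrDl.
    by move=> y y1 y2; apply: Z2; exact: ltW.
  rewrite ltr0_norm// in xo.
  apply: (picone_cst_zero mu0 (_ : x - 1 < x) (_ : x < - L) (pp x) _ d1 d2 d3 d4);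
    [by rewrite gtrBl|by rewrite ltrNr|].
  by move=> y y1 y2; apply: Z1; exact: ltW.
have [|d d0 Hd] := continuous_at_dist (@cw x0) (eps := `|w x0|); first by rewrite normr_gt0.
have [y yd yL] := dense_off_norm x0 L0 d0.
by have := Hd y yd; rewrite (wz y yL) sub0r normrN ltxx.
Qed.

End Critical.

(** * Decaying solutions for positive eigenvalues *)

Section HalfLine.
Context {R : realType}.
Notation mu := (@lebesgue_measure R).
Implicit Types (q u v w : R -> R) (a b x y l X : R).

Lemma linear_ivp (q : R -> R) (B l a al be : R) : continuous q -> (forall x, `|q x| <= B) ->
  exists y y1 : R -> R,
  [/\ forall x : R, is_derive x 1 y (y1 x), forall x : R, is_derive x 1 y1 ((q x + l) * y x),
      y a = al & y1 a = be].
Proof.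
move=> cq qB; have B0 : 0 <= B by apply: le_trans (qB 0).
apply: (@picard R (fun x t => (q x + l) * t) (B + `|l| + 1) 0).
- by have := normr_ge0 l; lra.
- move=> x s t; rewrite -mulrBr normrM ler_wpM2r//.
  by apply: le_trans (ler_normD _ _) _; have := qB x; lra.
- by move=> x; rewrite mulr0 normr0.
move=> y cy x; apply: cvgM; last exact: cy.
by apply: cvgD; [exact: cq|exact: cvg_cst].
Qed.

(* The recessive solution [s y - z], where [s = lim z / y] and [y], [z] are the
   fundamental solutions at a point beyond which the equation is hyperbolic. *)
Lemma decaying_exists (q : R -> R) (B l dl a : R) : continuous q -> (forall x, `|q x| <= B) ->
  0 < dl -> (forall x, a <= x -> dl <= q x + l) ->
  exists u u1 : R -> R,
  [/\ forall x : R, is_derive x 1 u (u1 x), forall x : R, is_derive x 1 u1 ((q x + l) * u x),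
      decaying u u1, forall x, a + 1 <= x -> 0 <= u x
    & forall x, (u x != 0) || (u1 x != 0)].
Proof.
move=> cq qB dl0 qd.
have [y [y1 [dy dy1 ya y1a]]] := linear_ivp l a 1 0 cq qB.
have [z [z1 [dz dz1 za z1a]]] := linear_ivp l a 0 1 cq qB.
have cy : continuous y by move=> x; exact: is_derive_cont (dy x).
have cy1 : continuous y1 by move=> x; exact: is_derive_cont (dy1 x).
have cz : continuous z by move=> x; exact: is_derive_cont (dz x).
have dyy x : is_derive x 1 (fun x => y x * y1 x) (y1 x ^+ 2 + (q x + l) * y x ^+ 2).
  by apply: (is_derive_eqx (is_deriveMx (dy x) (dy1 x))); ring.
have cyy x : {for x, continuous (fun x => y x * y1 x)} by exact: is_derive_cont (dyy x).
have yy0 x : a <= x -> 0 <= y x * y1 x.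
  move=> ax; rewrite -(mulr0 (y a)) -y1a.
  apply: (@derive_ge0_le R (fun x => y x * y1 x) (fun x => y1 x ^+ 2 + (q x + l) * y x ^+ 2)) => // t /andP[at_ _].
  by rewrite addr_ge0 ?sqr_ge0// mulr_ge0 ?sqr_ge0// (le_trans (ltW dl0))// qd// ltW.
have y2 x : a <= x -> 1 <= y x ^+ 2.
  move=> ax; rewrite -[leLHS](expr1n _ 2) -ya.
  apply: (@derive_ge0_le R (fun x => y x ^+ 2) (fun x => 2 * (y x * y1 x))) => //.
  - by move=> t _; exact: continuous_sq.
  - by move=> t _; apply: (is_derive_eqx (is_derive_sqrx (dy t))); ring.
  by move=> t /andP[at_ _]; rewrite mulr_ge0// yy0// ltW.
have ny x : a <= x -> y x != 0.
  by move=> ax; apply/eqP => y0; have := y2 x ax; rewrite y0 expr0n /= ler10.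
have yp x : a <= x -> 0 < y x.
  move=> ax; have c : continuous (fun x => - y x) by move=> t; apply: cvgN; exact: cy.
  have := @sign_persist R (fun x => - y x) a c; rewrite ya => H.
  have h1 t : a <= t -> - y t != 0 by move=> at_; rewrite oppr_eq0 ny.
  by have := H h1 ltac:(lra) x ax; rewrite oppr_lt0.
have y1lo x : a <= x -> dl * (x - a) <= y x * y1 x.
  move=> ax; rewrite -subr_ge0.
  rewrite (_ : 0 = y a * y1 a - dl * (a - a)); last by rewrite y1a subrr !mulr0 subrr.
  apply: (@derive_ge0_le R (fun x => y x * y1 x - dl * (x - a)) (fun x => (y1 x ^+ 2 + (q x + l) * y x ^+ 2) - dl)) => //.
  - move=> t _; apply: cvgB; first exact: cyy.
    by apply: cvgM; [exact: cvg_cst|apply: cvgB; [exact: cvg_id|exact: cvg_cst]].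
  - move=> t _.
    apply: (is_derive_eqx (is_deriveBx (dyy t) (is_deriveMx (is_derive_cstx dl t) (is_deriveBx (is_derive_idx t) (is_derive_cstx a t))))).
    by ring.
  move=> t /andP[at_ _]; have h1 := y2 t (ltW at_); have h2 := qd t (ltW at_).
  have h3 := sqr_ge0 (y1 t).
  have h4 : dl * 1 <= (q t + l) * y t ^+ 2 by rewrite ler_pM// ltW.
  by lra.
have y1p x : a < x -> 0 < y1 x.
  move=> ax; rewrite -(pmulr_rgt0 _ (yp x (ltW ax))).
  by apply: lt_le_trans (y1lo x (ltW ax)); rewrite mulr_gt0// subr_gt0.
have wr x : y x * z1 x - y1 x * z x = 1.
  have c (f : R -> R) (f1 : R -> R) : (forall x : R, is_derive x 1 f (f1 x)) -> continuous f.
    by move=> df t; exact: is_derive_cont (df t).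
  have cz1 := c _ _ dz1.
  have e s t : s <= t -> y s * z1 s - y1 s * z s = y t * z1 t - y1 t * z t.
    move=> st; apply: (@derive_0_eq R (fun x => y x * z1 x - y1 x * z x)) => // r _.
      exact: wronskian_continuous.
    by apply: (is_derive_eqx (is_deriveBx (is_deriveMx (dy r) (dz1 r)) (is_deriveMx (dy1 r) (dz r)))); ring.
  have ea : y a * z1 a - y1 a * z a = 1 by rewrite ya z1a za mulr0 subr0 mul1r.
  by have [/e|/ltW/e] := leP a x; rewrite ea.
pose r x := z x / y x.
have dr x : a <= x -> is_derive x 1 r (y x ^- 2).
  move=> ax; have yn := ny x ax.
  apply: (is_derive_eqx (is_deriveMx (dz x) (is_deriveVx yn (dy x)))).
  transitivity ((y x * z1 x - y1 x * z x) / y x ^+ 2); first by field.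
  by rewrite wr mul1r.
have cr x : a <= x -> {for x, continuous r} by move=> /dr/is_derive_cont.
have rinc s t : a <= s -> s <= t -> r s <= r t.
  move=> as_ st; apply: (@derive_ge0_le R r (fun x => y x ^- 2)) => //.
  - by move=> x /andP[sx _]; apply: cr; exact: le_trans sx.
  - by move=> x /andP[sx _]; apply: dr; exact: le_trans (ltW sx).
  by move=> x _; rewrite invr_ge0 sqr_ge0.
(* A decreasing majorant of the increasing function r. The limit s lies between r and k: s >= r
   gives u >= 0, and s <= k amounts to u' <= 0; together they bound u u'. *)
pose k x := r x + (y x * y1 x)^-1.
have kdec s t : a < s -> s <= t -> k t <= k s.
  move=> as_ st.
  have nyy x : a < x -> y x * y1 x != 0 by move=> ax; rewrite mulf_neq0 ?ny ?gt_eqF ?y1p// ltW.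
  apply: (@derive_le0_le R k (fun x => y x ^- 2 + - (y1 x ^+ 2 + (q x + l) * y x ^+ 2) / (y x * y1 x) ^+ 2)) => //.
  - move=> x /andP[sx _]; have ax := lt_le_trans as_ sx.
    apply: cvgD; first by apply: cr; exact: ltW.
    by apply: cvgV; [exact: nyy|exact: cyy].
  - move=> x /andP[sx _]; have ax := lt_trans as_ sx.
    exact: is_deriveDx (dr x (ltW ax)) (@is_deriveVx R (fun x => y x * y1 x) x _ (nyy x ax) (dyy x)).
  move=> x /andP[sx _]; have ax := lt_trans as_ sx.
  have n1 := ny x (ltW ax); have n2 : y1 x != 0 by rewrite gt_eqF ?y1p.
  rewrite (_ : _ + _ = - ((q x + l) / y1 x ^+ 2)); last by field; rewrite n1 n2.
  rewrite oppr_le0 divr_ge0 ?sqr_ge0// (le_trans (ltW dl0))// qd// ltW//.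
have k0 x : a < x -> r x <= k x.
  by move=> ax; rewrite lerDl invr_ge0 yy0// ltW.
have [s rs] : exists s : R, r x @[x --> +oo] --> s.
  apply: (@monotone_cvgy R r (a + 1) (k (a + 1))).
    by move=> s t as_ st; apply: rinc => //; lra.
  by move=> x ax; apply: le_trans (k0 x ltac:(lra)) _; apply: kdec => //; lra.
have lo x : a <= x -> r x <= s.
  move=> ax; apply/ler_addgt0Pr => e e0.
  have [M HM] := cvgy_dist rs e0.
  have := HM (Num.max M x); rewrite le_max lexx => /(_ isT).
  have := @rinc x (Num.max M x) ax; rewrite le_max lexx orbT => /(_ isT) h1.
  by rewrite ltr_norml => /andP[_]; lra.
have hi x : a < x -> s <= k x.
  move=> ax; apply/ler_addgt0Pr => e e0.
  have [M HM] := cvgy_dist rs e0.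
  have := HM (Num.max M x); rewrite le_max lexx => /(_ isT).
  have := @kdec x (Num.max M x) ax; rewrite le_max lexx orbT => /(_ isT) h1.
  have h2 := k0 (Num.max M x) (lt_le_trans ax _).
  have := h2 ltac:(by rewrite le_max lexx orbT) => h3.
  by rewrite ltr_norml => /andP[+ _]; lra.
pose u x := s * y x - z x; pose u1 x := s * y1 x - z1 x.
have du x : is_derive x 1 u (u1 x).
  by apply: (is_derive_eqx (is_deriveBx (is_deriveMx (is_derive_cstx s x) (dy x)) (dz x))); rewrite /u1; ring.
have du1 x : is_derive x 1 u1 ((q x + l) * u x).
  by apply: (is_derive_eqx (is_deriveBx (is_deriveMx (is_derive_cstx s x) (dy1 x)) (dz1 x))); rewrite /u; ring.
have wu x : y x * u1 x - y1 x * u x = -1.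
  rewrite (_ : _ - _ = - (y x * z1 x - y1 x * z x)); last by rewrite /u /u1; ring.
  by rewrite wr.
have uE x : a <= x -> u x = y x * (s - r x).
  by move=> ax; rewrite /u /r; field; exact: ny.
have u0 x : a <= x -> 0 <= u x.
  by move=> ax; rewrite uE// mulr_ge0 ?subr_ge0 ?lo// ltW// yp.
have u10 x : a < x -> u1 x <= 0.
  move=> ax; have yx := yp x (ltW ax); rewrite -(pmulr_rle0 _ yx).
  have -> : y x * u1 x = y1 x * u x - 1 by have := wu x; lra.
  rewrite subr_le0 (uE x (ltW ax)).
  have h := hi x ax; rewrite /k in h.
  have : y x * y1 x * (s - r x) <= y x * y1 x * (y x * y1 x)^-1.
    by apply: ler_wpM2l; [exact/yy0/ltW|lra].
  rewrite divff; last by rewrite mulf_neq0 ?gt_eqF ?y1p.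
  by rewrite mulrA (mulrC (y1 x)).
have cu : continuous u by move=> x; exact: is_derive_cont (du x).
have cu1 : continuous u1 by move=> x; exact: is_derive_cont (du1 x).
have hs : half_sol (fun x => q x + l) a u u1 by split.
exists u, u1; split => //.
- apply: (@half_sol_decaying R _ a u u1 (a + 1) dl 0 hs dl0); first by lra.
    by move=> x ax; apply: qd; lra.
  by move=> x ax; rewrite mulr_ge0_le0 ?u0 ?u10//; lra.
- by move=> x ax; apply: u0; lra.
move=> x; rewrite -negb_and; apply/negP => /andP[/eqP e1 /eqP e2].
by have := wu x; rewrite e1 e2 !mulr0 subrr; lra.
Qed.

End HalfLine.

(** * The slope of the decaying solution as a function of the spectral parameter *)

Section Recessive.
Context {R : realType}.
Notation mu := (@lebesgue_measure R).
Implicit Types (u v w : R -> R) (b x y : R).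

Lemma decaying_prim_bound w (w1 : R -> R) a : continuous w -> decaying w w1 ->
  exists K, forall x, a <= x -> prim (fun t => w t ^+ 2) x - prim (fun t => w t ^+ 2) a <= K.
Proof.
move=> cw [iw _]; exists (\int[mu]_(t in `[a, +oo[) (w t ^+ 2)) => x ax.
have c2 := continuous_sq cw.
rewrite prim_diff//; last exact: continuous_loc_int.
have i1 := iw a; have i2 := continuous_loc_int c2 a x.
have s : `[a, x]%classic `<=` `[a, +oo[%classic.
  by move=> t /=; rewrite !in_itv /= => /andP[->].
rewrite /Rintegral; apply: fine_le.
- by apply: integrable_fin_num i2.
- by apply: integrable_fin_num i1.
apply: ge0_subset_integral => //.
  apply/measurable_EFinP; apply: measurable_funTS; exact: continuous_measurable_fun.
by move=> t _; rewrite lee_fin sqr_ge0.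
Qed.

Lemma pos_right_limit (f : R -> R) (b : R) : {for b, continuous f} ->
  (forall x, b < x -> 0 < f x) -> 0 <= f b.
Proof.
move=> cf fp; rewrite leNgt; apply/negP => lt.
have [d dp Hd] := continuous_at_dist cf (eps := - f b) ltac:(lra).
have bx : b < b + d / 2 by lra.
have := Hd (b + d / 2); rewrite gtr0_norm; last by lra.
move=> /(_ ltac:(lra)); have := fp _ bx.
by move=> h; rewrite ltr_norml => /andP[_]; lra.
Qed.

Variables (q : R -> R) (a : R).
Hypothesis cq : continuous q.

(** Normalized by u a = 1, so that [u1 a] is the logarithmic derivative at [a], a Weyl-Titchmarsh
    function of [l]. *)
Definition recessive (l : R) (u u1 : R -> R) : Prop :=
  [/\ half_sol (fun x => q x + l) a u u1, decaying u u1, u a = 1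
    & forall x, a <= x -> 0 < u x].

(** The derivative (m - l) u v is nonnegative, and the expression is arbitrarily small far out. *)
Lemma wronskian_recessive (l m : R) u (u1 : R -> R) v (v1 : R -> R) x : l < m ->
  half_sol (fun x => q x + l) a v v1 -> decaying v v1 ->
  half_sol (fun x => q x + m) a u u1 -> decaying u u1 ->
  (forall y, a < y -> 0 <= u y * v y) -> a <= x -> u1 x * v x - u x * v1 x <= 0.
Proof.
move=> lm [cv cv1 dv] Dv [cu cu1 du] Du uv ax.
apply/ler_addgt0Pr => e e0; rewrite add0r.
have [y xy hy] := decaying_small x Du Dv e0.
apply: le_trans (_ : u1 y * v y - u y * v1 y <= _); last first.
  apply: le_trans (ltW hy); apply: le_trans (ler_norm _) _; rewrite distrC.
  by have := wronskian_bound (u y) (u1 y) (v y) (v1 y); lra.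
apply: (@derive_ge0_le R (fun x => u1 x * v x - u x * v1 x) (fun y => (m - l) * (u y * v y))) => //.
- move=> z _; apply: cvgB; apply: cvgM; [exact: cu1|exact: cv|exact: cu|exact: cv1].
- move=> z /andP[xz _]; have az := le_lt_trans ax xz.
  have [d1 d2] := du z az; have [d3 d4] := dv z az.
  by apply: (is_derive_eqx (is_deriveBx (is_deriveMx d2 d3) (is_deriveMx d1 d4))); ring.
move=> z /andP[xz _]; rewrite mulr_ge0 ?subr_ge0 ?(ltW lm)// uv//.
exact: le_lt_trans xz.
Qed.

(** The sign of the mixed Wronskian makes u / v nonincreasing from the value 1. *)
Lemma recessive_le (l m : R) u (u1 : R -> R) v (v1 : R -> R) : l < m -> recessive l v v1 -> recessive m u u1 ->
  (forall x, a <= x -> u x <= v x) /\ u1 a <= v1 a.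
Proof.
move=> lm [hv Dv va vp] [hu Du ua up].
have uv y : a < y -> 0 <= u y * v y by move=> ay; rewrite ltW// mulr_gt0// ?up ?vp// ltW.
have W x : a <= x -> u1 x * v x - u x * v1 x <= 0 by exact: wronskian_recessive lm hv Dv hu Du uv.
have [cv cv1 dv] := hv; have [cu cu1 du] := hu.
split; last by have := W a (lexx _); rewrite ua va; lra.
move=> x ax; have vx := vp x ax.
have nv z : a <= z -> v z != 0 by move=> az; rewrite gt_eqF// vp.
suff : u x / v x <= u a / v a.
  by rewrite ua va divr1 ler_pdivrMr// mul1r.
apply: (@derive_le0_le R (fun x => u x / v x) (fun x => (u1 x * v x - u x * v1 x) / v x ^+ 2)) => //.
- move=> z /andP[az _]; apply: cvgM; first exact: cu.
  by apply: cvgV; [exact: nv|exact: cv].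
- move=> z /andP[az _]; have [d1 d2] := du z az; have [d3 d4] := dv z az.
  have n := nv z (ltW az).
  by apply: (is_derive_eqx (is_deriveMx d1 (is_deriveVx n d3))); field.
by move=> z /andP[az _]; rewrite mulr_le0_ge0 ?W ?(ltW az)// invr_ge0 sqr_ge0.
Qed.

(** The slopes differ by (m - l) times the integral of u v, and u <= v <= w; [K] is a bound for the
    integral of w^2 and does not depend on the two levels. *)
Lemma recessive_slope_dist w (w1 : R -> R) : continuous w -> decaying w w1 ->
  exists K, forall (l m : R) u (u1 : R -> R) v (v1 : R -> R), l < m -> recessive l v v1 ->
    recessive m u u1 -> (forall x, a <= x -> v x <= w x) -> v1 a - u1 a <= (m - l) * K.
Proof.
move=> cw Dw; have [K HK] := decaying_prim_bound a cw Dw.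
exists K => l m u u1 v v1 lm rv ru vw.
have [uv _] := recessive_le lm rv ru.
have [[cv cv1 dv] Dv va vp] := rv; have [[cu cu1 du] Du ua up] := ru.
pose W x := u1 x * v x - u x * v1 x; pose P := prim (fun t => w t ^+ 2).
have c2 := continuous_sq cw.
have Wa : v1 a - u1 a = - W a by rewrite /W ua va; ring.
rewrite Wa; apply/ler_addgt0Pr => e e0.
have [x ax hx] := decaying_small a Du Dv e0.
have Wx : - W x <= e.
  apply: le_trans (ltW hx); apply: le_trans (ler_norm _) _; rewrite normrN /W distrC.
  by have := wronskian_bound (u x) (u1 x) (v x) (v1 x); lra.
have : W x - (m - l) * P x <= W a - (m - l) * P a.
  apply: (@derive_le0_le R (fun x => W x - (m - l) * P x) (fun y => (m - l) * (u y * v y) - (m - l) * w y ^+ 2)) => //.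
  - move=> z _; apply: cvgB.
      by apply: cvgB; apply: cvgM; [exact: cu1|exact: cv|exact: cu|exact: cv1].
    by apply: cvgM; [exact: cvg_cst|apply: prim_cont; exact: continuous_loc_int].
  - move=> z /andP[az _]; have [d1 d2] := du z az; have [d3 d4] := dv z az.
    have dP : is_derive z 1 P (w z ^+ 2) by apply: prim_deriv; [exact: continuous_loc_int|exact: c2].
    apply: (is_derive_eqx (is_deriveBx (is_deriveBx (is_deriveMx d2 d3) (is_deriveMx d1 d4)) (is_deriveMx (is_derive_cstx (m - l) z) dP))).
    by ring.
  move=> z /andP[az _]; rewrite -mulrBr mulr_ge0_le0 ?subr_ge0 ?(ltW lm)// subr_le0 expr2.
  have h1 := uv z (ltW az); have h2 := vw z (ltW az).
  by apply: ler_pM => //; [exact/ltW/up/ltW|exact/ltW/vp/ltW|exact: le_trans h2].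
have i : (m - l) * (P x - P a) <= (m - l) * K.
  by rewrite ler_wpM2l ?subr_ge0 ?(ltW lm)// HK.
by rewrite mulrBr in i; lra.
Qed.

(** u u' is nondecreasing and arbitrarily small far out. *)
Lemma recessive_slope_le0 (l : R) u (u1 : R -> R) : (forall x, a < x -> 0 <= q x + l) ->
  recessive l u u1 -> u1 a <= 0.
Proof.
move=> ql [[cu cu1 du] Du ua up]; apply/ler_addgt0Pr => e e0; rewrite add0r.
have [x ax hx] := decaying_small a Du Du e0.
rewrite -[u1 a]mul1r -ua; apply: le_trans (_ : u x * u1 x <= _).
  apply: (@derive_ge0_le R (fun x => u x * u1 x) (fun x => u1 x ^+ 2 + (q x + l) * u x ^+ 2)) => //.
  - by move=> z _; apply: cvgM; [exact: cu|exact: cu1].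
  - move=> z /andP[az _]; have [d1 d2] := du z az.
    by apply: (is_derive_eqx (is_deriveMx d1 d2)); ring.
  by move=> z /andP[az _]; rewrite addr_ge0 ?sqr_ge0// mulr_ge0 ?sqr_ge0// ql.
have s2 := sqr_ge0 (u x - u1 x); have s0 := sqr_ge0 (u x); have s1 := sqr_ge0 (u1 x); lra.
Qed.

Variables (B dl X : R) (u0 u01 : R -> R).
Hypotheses (qB : forall x, `|q x| <= B) (dl0 : 0 < dl)
  (qX : forall x, X <= x -> dl <= q x)
  (hs0 : half_sol q a u0 u01) (D0 : decaying u0 u01) (u0p : forall x, a < x -> 0 < u0 x)
  (ratio : forall x, X <= x -> u01 x ^+ 2 <= u0 x ^+ 2).

(* Picone's identity against the zero mode [u0] excludes zeros. *)
Lemma recessive_exists (l : R) : 0 < l -> exists u u1, recessive l u u1.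
Proof.
move=> l0.
have [u [u1 [du du1 Du ulo nz]]] := @decaying_exists R q B l dl X cq qB dl0 (fun x Xx =>
  le_trans (qX Xx) (ltac:(rewrite lerDl; exact: ltW) : q x <= q x + l)).
have cu : continuous u by move=> x; exact: is_derive_cont (du x).
have cu1 : continuous u1 by move=> x; exact: is_derive_cont (du1 x).
have [c0 c01 d0] := hs0.
have u0a := pos_right_limit (@c0 a) u0p.
pose P := picone u u1 u0 u01.
have Pmono x y : a <= x -> 0 < u0 x -> x <= y -> P x <= P y.
  move=> ax u0x xy; apply: (picone_le l0 cu cu1 c0 c01 (c := q) xy).
    by move=> z; rewrite le_eqVlt => /orP[/eqP <- //|xz] _; apply: u0p; exact: le_lt_trans xz.
  move=> z xz _; have [d1 d2] := d0 z (le_lt_trans ax xz).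
  by split.
have Ple x : a <= x -> 0 < u0 x -> P x <= 0.
  move=> ax u0x; apply/ler_addgt0Pr => e e0; rewrite add0r.
  have [y] := decaying_small (Num.max X x) Du Du e0; rewrite ge_max => /andP[Xy xy] hy.
  have u0y : 0 < u0 y.
    by move: xy; rewrite le_eqVlt => /orP[/eqP <- //|xy]; apply: u0p; exact: le_lt_trans xy.
  apply: le_trans (Pmono x y ax u0x xy) _; apply: le_trans (ler_norm _) _.
  apply: le_trans (picone_bound u u1 _ u0y) (ltW hy); exact: ratio.
(* Were the Picone expression zero at one point, it would vanish from there on, and so would u
   together with u'. *)
have Plt x : a <= x -> 0 < u0 x -> P x < 0.
  move=> ax u0x; rewrite lt_neqAle Ple// andbT; apply/eqP => Px.
  have Pz y : x <= y -> P y = 0.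
    move=> xy; have u0y : 0 < u0 y.
      by move: xy; rewrite le_eqVlt => /orP[/eqP <- //|xy]; apply: u0p; exact: le_lt_trans xy.
    apply/eqP; rewrite eq_le Ple ?(le_trans ax)//= -Px; exact: Pmono.
  have uz y : x < y -> u y = 0.
    move=> xy; have ay := le_lt_trans ax xy; have [d1 d2] := d0 y ay.
    apply: (picone_cst_zero l0 xy (_ : y < y + 1) (u0p ay) _ (du y) (du1 y) d1 d2); first by lra.
    by move=> z xz _; apply: Pz; exact: ltW.
  have u1z : u1 (x + 1) = 0.
    have dz : is_derive (x + 1) 1 u 0.
      apply: near_eq_is_derive (is_derive_cstx 0 (x + 1)); near=> y; rewrite uz//.
      by near: y; apply: lt_nbhsr; lra.
    exact: is_derive_uniq (du _) dz.
  by have := nz (x + 1); rewrite u1z uz ?eqxx//; lra.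
have nzp x : a <= x -> 0 < u0 x -> u x != 0.
  move=> ax u0x; apply/eqP => ux; have := Plt x ax u0x.
  by rewrite /P /picone ux mulr0 mul0r ltxx.
have nonneg x : a < x -> 0 < u x.
  move=> ax; have nx : u x != 0 by apply: nzp; [exact: ltW|exact: u0p].
  rewrite lt_neqAle eq_sym nx /= leNgt; apply/negP => ux.
  have nn y : x <= y -> u y != 0.
    by move=> xy; have ay := lt_le_trans ax xy; apply: nzp; [exact: ltW|exact: u0p].
  have := sign_persist cu nn ux (x := Num.max x (X + 1)).
  rewrite le_max lexx => /(_ isT); apply/negP; rewrite -leNgt; apply: ulo.
  by rewrite le_max lexx orbT.
have hs : half_sol (fun x => q x + l) a u u1 by split.
have hs0' : half_sol (fun x => q x + 0) a u0 u01.
  by split => // x ax; have [d1 d2] := d0 x ax; rewrite addr0.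
(* The zero mode may vanish at [a], as it does on the right of the exceptional fluxon. Then u a = 0
   would make the mixed Wronskian start at 0 and increase strictly, although it is never
   positive. *)
have ua : 0 < u a.
  have ua0 := pos_right_limit (@cu a) nonneg.
  rewrite lt_neqAle ua0 andbT eq_sym; move: u0a; rewrite le_eqVlt => /orP[/eqP u0z|u0a]; last exact: nzp.
  have W x : a <= x -> u1 x * u0 x - u x * u01 x <= 0.
    apply: wronskian_recessive l0 hs0' D0 hs Du _ => y ay.
    by rewrite ltW// mulr_gt0 ?nonneg ?u0p.
  have : u1 a * u0 a - u a * u01 a < u1 (a + 1) * u0 (a + 1) - u (a + 1) * u01 (a + 1).
    apply: (@derive_gt0_lt R (fun x => u1 x * u0 x - u x * u01 x) (fun y => l * (u y * u0 y))); first by lra.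
    - move=> z _; apply: cvgB; apply: cvgM; [exact: cu1|exact: c0|exact: cu|exact: c01].
    - move=> z /andP[az _]; have [d3 d4] := d0 z az.
      by apply: (is_derive_eqx (is_deriveBx (is_deriveMx (du1 z) d3) (is_deriveMx (du z) d4))); ring.
    by move=> z /andP[az _]; rewrite !mulr_gt0 ?nonneg ?u0p.
  have := W (a + 1) ltac:(lra).
  move=> h1 h2; apply/eqP => uz; move: h2; rewrite uz -u0z mulr0 mul0r subrr; lra.
exists (fun x => (u a)^-1 * u x), (fun x => (u a)^-1 * u1 x); split.
- exact: half_sol_scale.
- exact: decaying_scale.
- by rewrite mulVf// gt_eqF.
move=> x; rewrite le_eqVlt => /orP[/eqP <-|ax]; first by rewrite mulVf// gt_eqF.
by apply: mulr_gt0; [rewrite invr_gt0|exact: nonneg].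
Unshelve. all: by end_near. Qed.

(** Assembles the slope function; [recessive_le] makes it nonincreasing, and for l >= B the
    coefficient is nonnegative, whence a nonpositive slope. *)
Lemma recessive_slope : exists m : R -> R,
  [/\ forall l : R, 0 < l -> exists u u1, recessive l u u1 /\ u1 a = m l,
      forall l : R, 0 < l -> {for l, continuous m},
      forall l l', 0 < l -> l < l' -> m l' <= m l
    & forall l, 0 < l -> B <= l -> m l <= 0].
Proof.
have ex l : exists m : R, 0 < l -> exists u u1, recessive l u u1 /\ u1 a = m.
  have [l0|l0] := ltP 0 l; last by exists 0 => h; lra.
  by have [u [u1 r]] := recessive_exists l0; exists (u1 a) => _; exists u, u1.
have [m Hm] := choice ex; exists m.
have anti l l' : 0 < l -> l < l' -> m l' <= m l.
  move=> l0 ll; have [u [u1 [r e]]] := Hm l l0.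
  have [v [v1 [r' e']]] := Hm l' (lt_trans l0 ll).
  by rewrite -e -e'; have [] := recessive_le ll r r'.
split => //; last first.
  move=> l l0 Bl; have [u [u1 [r e]]] := Hm l l0; rewrite -e.
  apply: recessive_slope_le0 r => x _; have := qB x; rewrite ler_norml => /andP[]; lra.
(* The recessive solution at level l/2 dominates all those at nearby levels, which gives a common
   Lipschitz constant around l. *)
move=> l l0; have l2 : 0 < l / 2 by lra.
have [w [w1 [rw ew]]] := Hm _ l2; have [[cw _ _] Dw _ wp] := rw.
have [K HK] := recessive_slope_dist cw Dw.
have dist s t : l / 2 < s -> s < t -> m s - m t <= (t - s) * K.
  move=> ls st; have [v [v1 [rv ev]]] := Hm s (lt_trans l2 ls).
  have [u [u1 [ru eu]]] := Hm t (lt_trans (lt_trans l2 ls) st).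
  by rewrite -ev -eu; exact: HK st rv ru (recessive_le ls rw rv).1.
apply/cvgrPdist_lt => e e0.
have K0 : 0 < `|K| + 1 by have := normr_ge0 K; lra.
exists (Num.min (l / 2) (e / (`|K| + 1))); first by rewrite /= lt_min l2 divr_gt0.
move=> t /=; rewrite lt_min => /andP[t1 t2]; rewrite ltr_pdivlMr// in t2.
have KK := ler_norm K.
have key s t' : l / 2 < s -> s < t' -> (t' - s) * (`|K| + 1) < e -> `|m s - m t'| < e.
  move=> ls st h; have a1 := anti s t' (lt_trans l2 ls) st.
  rewrite ger0_norm ?subr_ge0//; apply: le_lt_trans (dist s t' ls st) _; apply: le_lt_trans h.
  by rewrite ler_wpM2l ?subr_ge0 ?(ltW st)//; lra.
move: t1 t2; case: (ltgtP t l) => [tl|lt|->] t1 t2; last by rewrite subrr normr0.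
  rewrite gtr0_norm ?subr_gt0// in t1 t2; rewrite distrC; apply: key => //; lra.
rewrite ltr0_norm ?subr_lt0// opprB in t1 t2; apply: key => //; lra.
Qed.

(** If the zero mode does not vanish at [a], its normalization is recessive at level 0, and the
    Lipschitz estimate extends down to 0. *)
Lemma recessive_slope_near0 : 0 < u0 a -> exists K, forall (l : R) u (u1 : R -> R), 0 < l -> recessive l u u1 ->
  u1 a <= u01 a / u0 a /\ u01 a / u0 a - u1 a <= l * K.
Proof.
move=> u0a; pose v x := (u0 a)^-1 * u0 x; pose v1 x := (u0 a)^-1 * u01 x.
have rv : recessive 0 v v1.
  split; [|exact: decaying_scale| by rewrite /v mulVf// gt_eqF|].
    apply: half_sol_scale; have [c0 c01 d0] := hs0.
    by split => // x ax; have [d1 d2] := d0 x ax; rewrite addr0.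
  move=> x; rewrite le_eqVlt => /orP[/eqP <-|ax]; first by rewrite /v mulVf// gt_eqF.
  by apply: mulr_gt0; [rewrite invr_gt0|exact: u0p].
have [[cv _ _] Dv _ _] := rv.
have [K HK] := recessive_slope_dist cv Dv.
exists K => l u u1 l0 ru; have [_ h] := recessive_le l0 rv ru.
rewrite (mulrC (u01 a)); split => //.
by have := HK _ _ _ _ _ _ l0 rv ru (fun x _ => lexx _); rewrite subr0.
Qed.

End Recessive.

(** * Matching the slopes across the inhomogeneity *)

Section Shooting.
Context {R : realType}.
Implicit Types (k t x y : R).

Definition Ch t : R := (expR t + expR (- t)) / 2.
Definition Sh t : R := (expR t - expR (- t)) / 2.

Lemma is_derive_Ch (f : R -> R) x df : is_derive x 1 f df ->
  is_derive x 1 (fun y => Ch (f y)) (Sh (f x) * df).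
Proof.
move=> d; have d1 := is_derive_expx d; have d2 := is_derive_expx (is_deriveNx d).
by apply: (is_derive_eqx (is_deriveMx (is_deriveDx d1 d2) (is_derive_cstx 2^-1 x))); rewrite /Sh; field.
Qed.

Lemma is_derive_Sh (f : R -> R) x df : is_derive x 1 f df ->
  is_derive x 1 (fun y => Sh (f y)) (Ch (f x) * df).
Proof.
move=> d; have d1 := is_derive_expx d; have d2 := is_derive_expx (is_deriveNx d).
by apply: (is_derive_eqx (is_deriveMx (is_deriveBx d1 d2) (is_derive_cstx 2^-1 x))); rewrite /Ch; field.
Qed.

Lemma Ch0 : Ch 0 = 1. Proof. by rewrite /Ch oppr0 expR0; field. Qed.
Lemma Sh0 : Sh 0 = 0. Proof. by rewrite /Sh oppr0 subrr mul0r. Qed.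

Lemma Ch_ge1 t : 1 <= Ch t.
Proof.
have e := expRN t; have p := expR_gt0 t; rewrite /Ch e ler_pdivlMr// -subr_ge0.
rewrite (_ : _ - _ = (expR t - 1) ^+ 2 / expR t); last by field; rewrite gt_eqF.
by rewrite divr_ge0 ?sqr_ge0// ltW.
Qed.

Lemma continuous_Ch : continuous Ch.
Proof. by move=> x; exact: is_derive_cont (is_derive_Ch (is_derive_idx x)). Qed.

Lemma continuous_Sh : continuous Sh.
Proof. by move=> x; exact: is_derive_cont (is_derive_Sh (is_derive_idx x)). Qed.

Lemma Sh_ge_id t : 0 <= t -> t <= Sh t.
Proof.
move=> t0; rewrite -subr_ge0 -[leLHS](_ : Sh 0 - 0 = 0); last by rewrite Sh0 subrr.
apply: (@derive_ge0_le R (fun t => Sh t - t) (fun t => Ch t * 1 - 1)) => //.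
- by move=> x _; apply: cvgB; [exact: continuous_Sh|exact: cvg_id].
- by move=> x _; exact: is_deriveBx (is_derive_Sh (is_derive_idx x)) (is_derive_idx x).
by move=> x _; rewrite mulr1 subr_ge0 Ch_ge1.
Qed.

Lemma Sh_le_mul_Ch t : 0 <= t -> Sh t <= t * Ch t.
Proof.
move=> t0; rewrite -subr_ge0 -[leLHS](_ : 0 * Ch 0 - Sh 0 = 0); last by rewrite Sh0 mul0r subrr.
apply: (@derive_ge0_le R (fun t => t * Ch t - Sh t) (fun t => t * Sh t)) => //.
- move=> x _; apply: cvgB; last exact: continuous_Sh.
  by apply: cvgM; [exact: cvg_id|exact: continuous_Ch].
- move=> x _; have d := is_derive_idx x.
  by apply: (is_derive_eqx (is_deriveBx (is_deriveMx d (is_derive_Ch d)) (is_derive_Sh d))); ring.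
move=> x /andP[x0 _]; rewrite mulr_ge0 ?(ltW x0)//.
by apply: le_trans (Sh_ge_id (ltW x0)); exact: ltW.
Qed.

(* The solution of [v'' = k^2 v] with [v = 1], [v' = - mm] at one end of an interval
   of length [T] meets the slope condition [v' = mp v] at the other end for some
   [k] in ]0, 1]: near [k = 0] one has [v = 0 < - v'], and at [k = 1] the opposite. *)
Lemma shooting (T K : R) (mp mm : R -> R) : 0 < T ->
  (forall l, 0 < l -> {for l, continuous mp}) -> (forall l, 0 < l -> {for l, continuous mm}) ->
  (forall l l', 0 < l -> l < l' -> mp l' <= mp l) -> mp 1 <= 0 -> mm 1 <= 0 ->
  (forall l, 0 < l -> mm l <= T^-1 /\ T^-1 - mm l <= l * K) ->
  exists2 k, 0 < k & k * Sh (k * T) - mm (k ^+ 2) * Ch (k * T) =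
    mp (k ^+ 2) * (Ch (k * T) - mm (k ^+ 2) * (Sh (k * T) / k)).
Proof.
move=> T0 cp cm ap p1 m1 near0.
pose v k := Ch (k * T) - mm (k ^+ 2) * (Sh (k * T) / k).
pose F k := k * Sh (k * T) - mm (k ^+ 2) * Ch (k * T) - mp (k ^+ 2) * v k.
have ckT : continuous (fun k => k * T) by move=> k; apply: cvgM; [exact: cvg_id|exact: cvg_cst].
have cC : continuous (fun k => Ch (k * T)).
  by move=> k; apply: (@continuous_comp _ _ _ (fun k => k * T) Ch); [exact: ckT|exact: continuous_Ch].
have cS : continuous (fun k => Sh (k * T)).
  by move=> k; apply: (@continuous_comp _ _ _ (fun k => k * T) Sh); [exact: ckT|exact: continuous_Sh].
have ck2 : continuous (fun k : R => k ^+ 2) by move=> k; exact: exprn_continuous.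
have cm2 k : 0 < k -> {for k, continuous (fun k => mm (k ^+ 2))}.
  move=> k0; apply: (@continuous_comp _ _ _ (fun k => k ^+ 2) mm); [exact: ck2|].
  by apply: cm; rewrite exprn_gt0.
have cp2 k : 0 < k -> {for k, continuous (fun k => mp (k ^+ 2))}.
  move=> k0; apply: (@continuous_comp _ _ _ (fun k => k ^+ 2) mp); [exact: ck2|].
  by apply: cp; rewrite exprn_gt0.
have cv k : 0 < k -> {for k, continuous v}.
  move=> k0; apply: cvgB; first exact: cC.
  apply: cvgM; first exact: cm2.
  by apply: cvgM; [exact: cS|apply: cvgV; [rewrite gt_eqF|exact: cvg_id]].
have cF k : 0 < k -> {for k, continuous F}.
  move=> k0; apply: cvgB; last by apply: cvgM; [exact: cp2|exact: cv].
  by apply: cvgB; apply: cvgM; [exact: cvg_id|exact: cS|exact: cm2|exact: cC].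
(* At level 1 both slopes are nonpositive, so no term of F 1 is negative and the first is
   positive. *)
have F1 : 0 < F 1.
  have S1 : 0 < Sh (1 * T) by apply: lt_le_trans (Sh_ge_id _); rewrite ?mul1r// ltW.
  have C1 : 1 <= Ch (1 * T) := Ch_ge1 _.
  rewrite /F /v expr1n divr1 mul1r; move: (Sh _) (Ch _) S1 C1 => S C S0 C1.
  have h1 : 0 <= - mm 1 * C by rewrite mulr_ge0; lra.
  have h2 : 0 <= - mm 1 * S by rewrite mulr_ge0; lra.
  have h3 : 0 <= - mp 1 * (C - mm 1 * S) by rewrite mulr_ge0; lra.
  by lra.
(* A majorant of F for small k that is continuous at 0 with value - 1/T. No limit of [mp] at 0 is
   assumed: monotonicity bounds it below by mp 1, and its cofactor is nonnegative. *)
pose G k := k * Sh (k * T) - (T^-1 - k ^+ 2 * K) * Ch (k * T)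
   - mp 1 * (Ch (k * T) - 1 + k ^+ 2 * (K * T)).
have cG : continuous G.
  move=> k; apply: cvgB.
    apply: cvgB; apply: cvgM; [exact: cvg_id|exact: cS| |exact: cC].
    by apply: cvgB; [exact: cvg_cst|apply: cvgM; [exact: ck2|exact: cvg_cst]].
  apply: cvgM; first exact: cvg_cst.
  apply: cvgD; first by apply: cvgB; [exact: cC|exact: cvg_cst].
  by apply: cvgM; [exact: ck2|exact: cvg_cst].
have G0 : G 0 = - T^-1 by rewrite /G !mul0r Ch0 expr0n /=; ring.
have T1 : 0 < T^-1 by rewrite invr_gt0.
have [d d0 Hd] := continuous_at_dist (@cG 0) T1.
have [d' d'0 Hd'] := continuous_at_dist (x := 0 : R) (f := fun k => k ^+ 2 * K)
  ltac:(by apply: cvgM; [exact: ck2|exact: cvg_cst]) T1.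
pose k0 := Num.min (d / 2) (Num.min (d' / 2) (1 / 2)).
have k00 : 0 < k0 by rewrite !lt_min !divr_gt0.
have kd : k0 <= d / 2 by rewrite ge_min lexx.
have kd' : k0 <= d' / 2 by rewrite ge_min; apply/orP; right; rewrite ge_min lexx.
have k1 : k0 <= 1 / 2 by rewrite ge_min; apply/orP; right; rewrite ge_min lexx orbT.
have Gk : G k0 < 0.
  by have := Hd k0; rewrite subr0 gtr0_norm// => /(_ ltac:(lra)); rewrite G0 ltr_norml => /andP[_]; lra.
have Kk : k0 ^+ 2 * K < T^-1.
  have := Hd' k0; rewrite subr0 gtr0_norm// => /(_ ltac:(lra)).
  by rewrite expr0n /= mul0r subr0 ltr_norml => /andP[].
have k2 : 0 < k0 ^+ 2 by rewrite exprn_gt0.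
have k21 : k0 ^+ 2 < 1 by rewrite expr_lt1// ?ltW//; lra.
have [n1 n2] := near0 _ k2; have ap1 := ap _ _ k2 k21.
(* F <= G at [k0], from t <= Sh t <= t Ch t and the two-sided bound on [mm]. *)
have F0 : F k0 < 0.
  apply: le_lt_trans Gk; rewrite /F /G /v.
  have kT : 0 <= k0 * T by rewrite mulr_ge0 ?ltW.
  have s1 := Sh_ge_id kT; have s2 := Sh_le_mul_Ch kT; have c1 := Ch_ge1 (k0 * T).
  have e1 : T <= Sh (k0 * T) / k0 by rewrite ler_pdivlMr// mulrC.
  have e2 : Sh (k0 * T) / k0 <= T * Ch (k0 * T) by rewrite ler_pdivrMr// mulrAC (mulrC T).
  move: (k0 ^+ 2) (Sh (k0 * T)) (Ch (k0 * T)) (Sh (k0 * T) / k0) (mm (k0 ^+ 2)) (mp (k0 ^+ 2)) s1 s2 c1 e1 e2 n1 n2 ap1 Kk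
    => l S C Q m p s1 s2 c1 e1 e2 n1 n2 ap1 Kk.
  have TT : T^-1 * T = 1 by rewrite mulVf// gt_eqF.
  have Q0 : 0 <= Q by apply: le_trans e1; exact: ltW.
  have j1 : 0 <= p - mp 1 by rewrite subr_ge0.
  have j2 : 0 <= - mp 1 by rewrite oppr_ge0.
  have j3 : 0 <= m - (T^-1 - l * K) by clear -n2; lra.
  have j4 : 0 <= T^-1 - l * K by rewrite subr_ge0 ltW.
  have C0 : 0 <= C by apply: le_trans c1.
  have mQ : m * Q <= C.
    apply: le_trans (_ : T^-1 * Q <= _); first by rewrite ler_wpM2r.
    apply: le_trans (_ : T^-1 * (T * C) <= _); first by rewrite ler_wpM2l// ltW.
    by rewrite mulrA TT mul1r.
  have mQ' : (T^-1 - l * K) * T <= m * Q.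
    by apply: ler_pM => //; [exact: ltW|rewrite -subr_ge0].
  have i1 : (p - mp 1) * (C - m * Q) >= 0 by rewrite mulr_ge0 ?subr_ge0.
  have i2 : - mp 1 * (m * Q - (T^-1 - l * K) * T) >= 0 by rewrite mulr_ge0 ?subr_ge0.
  have i3 : (m - (T^-1 - l * K)) * C >= 0 by rewrite mulr_ge0.
  have i4 : mp 1 * ((T^-1 - l * K) * T) = mp 1 * (1 - l * (K * T)) by rewrite mulrBl TT; ring.
  by move: i1 i2 i3 i4; clear; lra.
have k01 : k0 <= 1 by lra.
have cF' x : k0 <= x <= 1 -> {for x, continuous F}.
  by move=> /andP[x0 _]; apply: cF; exact: lt_le_trans x0.
have [k /andP[kk _] Fk] : exists2 k, k0 <= k <= 1 & F k = 0.
  by apply: IVT_val k01 cF' _; left; rewrite (ltW F0) ltW.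
exists k; first exact: lt_le_trans kk.
by apply/eqP; rewrite -subr_eq0; apply/eqP; exact: Fk.
Qed.

End Shooting.

(** * A positive eigenvalue for the exceptional fluxon *)

Section Exceptional.
Context {R : realType}.
Implicit Types (x y : R).

Variables (g L h : R) (phi : R -> R).
Hypotheses (g0 : 0 <= g) (L0 : 0 < L) (pf : pinned_fluxon g L phi)
  (fp : fluxon_parameter g L phi h) (gp : 0 < g).
Hypotheses (iE : phi (- L) = pi) (oE : phi L = 2 * pi + phi_max g).
Local Notation p := (derive1 phi).
Let g01 : 0 < g < 1. Proof. by rewrite gp (fluxon_g_lt1 g0 L0 pf fp). Qed.
Let tm : turning g (phi_max g). Proof. exact: phi_max_turning g01. Qed.
Let m_pi : pi < phi_max g. Proof. exact: turning_gt_pi gp (fluxon_g_le g0 L0 pf fp) tm. Qed.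

(** On each side a multiple of phi' is a positive zero mode: phi falls from the turning point on the
    right and rises to pi on the left. The right one vanishes at L, so the estimate near level 0 is
    available on the left only; [shooting] is designed for this asymmetry. *)
Lemma exceptional_positive_eigenvalue : exists2 l : R, 0 < l & is_eigenvalue L phi l.
Proof.
have L1 := L0; have cphi := fluxon_continuous pf; have m3 := m_pi; have p0 := @pi_gt0 R.
have /andP[a0 a1] := asin_bounds g01.
have [pin _] := fluxon_in_bounds g0 L0 pf fp gp.
have pL := fluxon_turning_out g0 L0 pf fp gp oE.
have ca := cos_asin_gt0 g01.
have sr := stable_shift (fluxon_right L0 pf); have sl := fluxon_left L0 pf.
have [hr dr] := fluxon_right_decaying g0 L0 pf fp.
have [hl dl] := fluxon_left_decaying g0 L0 pf fp.
have cb (f : R -> R) x : `|cos (f x)| <= 1 by exact: cos_max.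
have cc (f : R -> R) : continuous f -> continuous (fun x => cos (f x)).
  by move=> cf x; apply: (@continuous_comp _ _ _ f cos); [exact: cf|exact: continuous_cos].
have prp x : L < x -> 0 < -1 * p x.
  move=> Lx; have := stable_well_decr g01 tm sr; rewrite pL oE => H.
  by have := H ltac:(lra) (lexx _) x Lx; lra.
have plp x : L < x -> 0 < -1 * - p (- x).
  move=> Lx; have := stable_well_decr g01 tm sl; rewrite iE => H.
  by have := H ltac:(lra) ltac:(lra) x Lx; lra.
have [Xr1 Hr1] := stable_cos_tail sr ca; have [Xr2 Hr2] := stable_ratio g01 sr.
have [Xl1 Hl1] := stable_cos_tail sl ca; have [Xl2 Hl2] := stable_ratio g01 sl.
have ca2 : 0 < cos (asin g) / 2 by rewrite divr_gt0.
pose Xr := Num.max Xr1 Xr2; pose Xl := Num.max Xl1 Xl2.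
have xr x : Xr <= x -> Xr1 <= x /\ Xr2 <= x by rewrite ge_max => /andP[].
have xl x : Xl <= x -> Xl1 <= x /\ Xl2 <= x by rewrite ge_max => /andP[].
have qr x : Xr <= x -> cos (asin g) / 2 <= cos (phi x).
  by move=> /xr[/Hr1 + _]; rewrite -[cos (_ - _)]cos_D2pi subrK.
have ql x : Xl <= x -> cos (asin g) / 2 <= cos (phi (- x)) by move=> /xl[/Hl1].
have rr x : Xr <= x -> (-1 * (sin (phi x) - g)) ^+ 2 <= (-1 * p x) ^+ 2.
  by move=> /xr[_ /Hr2]; rewrite -[sin (_ - _)]sin_D2pi subrK !mulN1r !sqrrN.
have rl x : Xl <= x -> (-1 * (sin (phi (- x)) - g)) ^+ 2 <= (-1 * - p (- x)) ^+ 2.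
  by move=> /xl[_ /Hl2]; rewrite !mulN1r !sqrrN.
have cnl := continuous_neg cphi.
have [mp [ep cp ap np]] := recessive_slope (cc _ cphi) (cb phi) ca2 qr (half_sol_scale (-1) hr) (decaying_scale (-1) dr) prp rr.
have [mm [em cm am nm]] := recessive_slope (cc _ cnl) (cb (fun x => phi (- x))) ca2 ql (half_sol_scale (-1) hl) (decaying_scale (-1) dl) plp rl.
have plL : 0 < -1 * - p (- L) by lra.
have [K HK] := recessive_slope_near0 (half_sol_scale (-1) hl) (decaying_scale (-1) dl) plp plL.
(* As phi_in = pi and p_out = 0, p_in = 2 g L and the left slope at level 0 is the inverse of the
   length 2 L: the affine continuation of the zero mode vanishes exactly at the other edge. *)
have TE : -1 * (sin (phi (- L)) - g) / (-1 * - p (- L)) = (2 * L)^-1.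
  have := fluxon_p_out L0 pf; rewrite pL iE sinpi => e.
  have -> : p (- L) = g * (2 * L) by lra.
  by field; rewrite !gt_eqF.
rewrite TE in HK.
have T0 : 0 < 2 * L by lra.
have near0 l : 0 < l -> mm l <= (2 * L)^-1 /\ (2 * L)^-1 - mm l <= l * K.
  by move=> l0; have [u [u1 [ru <-]]] := em l l0; exact: HK l0 ru.
(* Level 1 dominates the coefficient because |cos| <= 1, so both slopes are nonpositive there. *)
have [k k0 match_] := shooting T0 cp cm ap (np 1 ltr01 (lexx _)) (nm 1 ltr01 (lexx _)) near0.
have k2 : 0 < k ^+ 2 by rewrite exprn_gt0.
exists (k ^+ 2) => //.
have [r [r1 [[hsr dsr ra rp] er]]] := ep _ k2; have [s [s1 [[hss dss sa sp] es]]] := em _ k2.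
pose b := Ch (k * (2 * L)) - mm (k ^+ 2) * (Sh (k * (2 * L)) / k).
pose w x := Ch (k * (x + L)) - mm (k ^+ 2) * (Sh (k * (x + L)) / k).
pose w1 x := k * Sh (k * (x + L)) - mm (k ^+ 2) * Ch (k * (x + L)).
have kn : k != 0 by rewrite gt_eqF.
have dk x : is_derive x 1 (fun y => k * (y + L)) k.
  by apply: (is_derive_eqx (is_deriveMx (is_derive_cstx k x) (is_deriveDx (is_derive_idx x) (is_derive_cstx L x)))); ring.
have dw x : is_derive x 1 w (w1 x).
  apply: (is_derive_eqx (is_deriveBx (is_derive_Ch (dk x)) (is_deriveMx (is_derive_cstx (mm (k ^+ 2)) x) (is_deriveMx (is_derive_Sh (dk x)) (is_derive_cstx k^-1 x))))).
  by rewrite /w1; field.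
have dw1 x : is_derive x 1 w1 (k ^+ 2 * w x).
  apply: (is_derive_eqx (is_deriveBx (is_deriveMx (is_derive_cstx k x) (is_derive_Sh (dk x))) (is_deriveMx (is_derive_cstx (mm (k ^+ 2)) x) (is_derive_Ch (dk x))))).
  by rewrite /w; field.
have LL : L + L = 2 * L by ring.
have cw : continuous w by move=> x; exact: is_derive_cont (dw x).
have cw1 : continuous w1 by move=> x; exact: is_derive_cont (dw1 x).
have ode x : `|x| < L -> is_derive x 1 w (w1 x) /\ is_derive x 1 w1 (k ^+ 2 * w x) by [].
have e1 : w L = b * r L by rewrite /w LL ra mulr1.
have e2 : w1 L = b * r1 L by rewrite /w1 LL er match_ mulrC.
have e3 : w (- L) = s L by rewrite /w addNr mulr0 Ch0 Sh0 mul0r mulr0 subr0 sa.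
have e4 : w1 (- L) = - s1 L by rewrite /w1 addNr mulr0 Ch0 Sh0 mulr0 mulr1 sub0r es.
have nz : exists2 x, L < x & s x != 0.
  by exists (L + 1); rewrite ?gt_eqF ?sp// ?ltrDl// lerDl.
exact: glued_eigenvalue L0 cphi (half_sol_scale b hsr) (decaying_scale b dsr) hss dss cw cw1
  ode e1 e2 e3 e4 (or_intror nz).
Qed.

End Exceptional.

(** * The case of zero bias *)

Section ZeroBias.
Context {R : realType}.

(** A decreasing positive numerator over an increasing denominator: at zero bias dL/dh never
    vanishes, in agreement with the absence of the eigenvalue zero. *)
Lemma L_gamma0_derivative (h : R) : 0 < h < 2 ->
  exists2 l, is_derive_in [set k | 0 < k < 2] (@L_gamma0 R) h l & l < 0.
Proof.
move=> h2; have /andP[hp h2'] := h2.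
have hx : -1 < 1 - h < 1 by apply/andP; split; lra.
have s0 := sin_acos_gt0 hx.
have d0 : is_derive h 1 (fun y => 1 - y) (-1 : R) by deriv; ring.
have dN := is_deriveBx (is_derive_cstx pi h) (is_derive_acosx d0 hx).
have hh : 0 < 2 * h by rewrite mulr_gt0.
have D0 : 0 < Num.sqrt (2 * h) by rewrite sqrtr_gt0.
have Dn : Num.sqrt (2 * h) != 0 by rewrite gt_eqF.
have dD := @is_derive_sqrtx R (fun y => 2 * y) h _ hh (is_deriveMx (is_derive_cstx 2 h) (is_derive_idx h)).
have dV := @is_deriveVx R (fun y => Num.sqrt (2 * y)) h _ Dn dD.
have N0 : 0 < pi - acos (1 - h).
  by rewrite subr_gt0 acos_ltpi//; apply/andP; split; lra.
exists (- ((sin (acos (1 - h)))^-1 / Num.sqrt (2 * h)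
  + (pi - acos (1 - h)) / Num.sqrt (2 * h) / Num.sqrt (2 * h) ^+ 2)); last first.
  by rewrite oppr_lt0 addr_gt0 ?divr_gt0 ?invr_gt0 ?exprn_gt0.
apply: derive_in_of => //.
  move=> U /nbhs_ballP[d /= dp HU]; pose y := Num.min (h + d / 2) ((h + 2) / 2).
  have hy : h < y by rewrite lt_min; apply/andP; split; lra.
  have y1 : y <= h + d / 2 by rewrite ge_min lexx.
  have y2 : y <= (h + 2) / 2 by rewrite ge_min lexx orbT.
  exists y; split; [by rewrite gt_eqF|by apply/andP; split; lra|].
  by apply: HU; rewrite /ball /= ltr0_norm; lra.
apply: (is_derive_eqx (is_deriveMx dN dV)).
have sn : sin (acos (1 - h)) != 0 by rewrite gt_eqF.
by field; rewrite sn Dn.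
Qed.

End ZeroBias.

Theorem lemma7 (R : realType) :
  exists g1 : R,
    [/\ gamma_1_equation g1,
        forall g : R, gamma_1_equation g -> g = g1,
        `|g1 - 18 / 100| < 5 / 1000
      & 4 * pi - acos (2 * pi * g1 - 1) = 2 * pi + phi_max g1] /\
    forall (g L h : R) (phi : R -> R),
      0 <= g -> 0 < L ->
      pinned_fluxon g L phi -> fluxon_parameter g L phi h ->
      [/\ is_eigenvalue L phi 0 <->
            [\/ dL_dh g L phi h 0,
                g = pi^-1
              | exceptional_fluxon g1 g L phi],
          g = pi^-1 -> is_largest_eigenvalue L phi 0
        & exceptional_fluxon g1 g L phi ->
            is_eigenvalue L phi 0 /\ ~ is_largest_eigenvalue L phi 0].
Proof.
have [g1 [eq1 uniq1 dist1 cand1]] := @gamma_1_exists R.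
have tE : 4 * pi - acos (2 * pi * g1 - 1) = 2 * pi + phi_max g1.
  by rewrite -cand1 /turning_candidate; ring.
exists g1; split; first by split.
move=> g L h phi g0 L0 pf fp.
have crit : g = pi^-1 -> is_largest_eigenvalue L phi 0.
  move=> gE; have gp : 0 < g by rewrite gE invr_gt0 pi_gt0.
  split; first exact: (fluxon_critical_eigenvalue g0 L0 pf fp gp gE).
  by move=> mu; exact: (critical_largest g0 L0 pf fp gE).
have g1p : 0 < g1 by have [/andP[]] := eq1.
have exc : exceptional_fluxon g1 g L phi ->
    is_eigenvalue L phi 0 /\ ~ is_largest_eigenvalue L phi 0.
  move=> [gE iE]; rewrite tE -gE => oE; have gp : 0 < g by rewrite gE.
  split; first exact: (fluxon_exceptional_eigenvalue g0 L0 pf fp gp iE oE).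
  move=> [_ max]; have [l l0 /max] := exceptional_positive_eigenvalue g0 L0 pf fp gp iE oE.
  by rewrite leNgt l0.
split => //; split; last first.
  case=> [[[gE h2 _ d]|[/andP[gp gl] [s [b [ob d]]]]]|/crit[]//|/exc[]//].
    by have [l dl l0] := L_gamma0_derivative h2; have := derive_in_uniq d dl; lra.
  have [/crit[]//|gn] := eqVneq g pi^-1.
  have gl' : g < pi^-1 by rewrite lt_neqAle gn.
  by apply/(fluxon_eigenvalue_iff g0 L0 pf fp gp gl'); left; exists s, b.
move=> ev; have [gE|gn] := eqVneq g pi^-1; first exact: Or32.
have [gz|gz] := eqVneq g 0.
  by have := fluxon_zero_bias_eigenvalue g0 L0 pf fp gz ev.
have gp : 0 < g by rewrite lt_neqAle eq_sym gz.
have gl := fluxon_g_le g0 L0 pf fp.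
have gl' : g < pi^-1 by rewrite lt_neqAle gn.
(* The alternative without dL/dh satisfies the equation defining gamma_1, so uniqueness of its
   solution identifies g. *)
case/(fluxon_eigenvalue_iff g0 L0 pf fp gp gl'): ev => [[s [b [ob d]]]|[hE pL ne]].
  by apply: Or31; right; rewrite gp gl; split => //; exists s, b.
have [iE oE cE] := fluxon_h_max_turning g0 L0 pf fp gp hE pL ne.
have gE : g = g1 by apply: uniq1; split => //; rewrite gp (fluxon_g_lt1 g0 L0 pf fp).
by apply: Or33; split => //; rewrite tE -gE.
Qed.
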